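(* Let $d \ge 1$ and let $P \subset \mathbb{R}^d$ be a $d$-dimensional lattice-face polytope. Then for every positive integer $m$, $$i(P,m) = \mathrm{Vol}_d(mP) + i(\pi(P),m) = \sum_{k=0}^d \mathrm{Vol}_k\bigl(\pi^{(d-k)}(P)\bigr)\, m^k .$$ In other words, for each $0 \le k \le d$, the coefficient of $m^k$ in the Ehrhart polynomial $i(P,m)$ is the (normalized) $k$-dimensional volume of the projection $\pi^{(d-k)}(P)$.
   Context: A polytope is the convex hull of a finite set of points; all polytopes are full-dimensional in their ambient space. $\mathrm{conv}$ and $\mathrm{aff}$ denote convex hull and affine hull. For $0\le k\le d$, $\pi^{(k)}:\mathbb{R}^d \to \mathbb{R}^{d-k}$ is the map that forgets the last $k$ coordinates, and $\pi = \pi^{(1)}$. For a set $S \subset \mathbb{R}^d$, $\mathcal{L}(S) = S \cap \mathbb{Z}^d$. For a positive integer $m$, $mP = \{mx : x \in P\}$ and $i(P,m) = |\mathcal{L}(mP)|$ is the number of lattice points in $mP$ (for a polytope in $\mathbb{R}^0 = \mathbb{Z}^0$, a single point, this is $1$). $\mathrm{Vol}_k$ is the volume in $\mathbb{R}^k$ normalized with respect to the lattice $\mathbb{Z}^k$, i.e. the usual Lebesgue measure on $\mathbb{R}^k$, with $\mathrm{Vol}_0$ of a point equal to $1$. Lattice-face polytopes are defined recursively. A $1$-dimensional polytope (in $\mathbb{R}^1$) is a lattice-face polytope if it is integral, i.e. its vertices are integers. For $d \ge 2$, a $d$-dimensional polytope $P\subset\mathbb{R}^d$ with vertex set $V$ is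 a lattice-face polytope if for every subset $U \subset V$ spanning a $(d-1)$-dimensional affine space: (a) $\pi(\mathrm{conv}(U))$ is a lattice-face polytope (of dimension $d-1$ in $\mathbb{R}^{d-1}$), and (b) $\pi(\mathcal{L}(\mathrm{aff}(U))) = \mathbb{Z}^{d-1}$. *)

(* Defs.v *)
From HB Require Import structures.
From mathcomp Require Import all_boot all_order all_algebra finmap.
From mathcomp Require Import all_classical all_reals all_analysis.

Set Implicit Arguments.
Unset Strict Implicit.
Unset Printing Implicit Defensive.

Import Order.TTheory GRing.Theory Num.Theory.
Import numFieldNormedType.Exports.

Local Open Scope classical_set_scope.
Local Open Scope ring_scope.

(* Lebesgue measure on [R^n], realised on the measurable space of [n]-tuples
   (with the product sigma-algebra): [lebesgue_tuple n.+1] is the product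
   measure [lebesgue_tuple n \x lebesgue_measure] transported along
   [tuple_snoc], and [lebesgue_tuple 0] is the unit mass of the only point. *)

Section LebesgueTuple.
Context {R : realType}.
Let T : measurableType _ := measurableTypeR R.

Definition tuple_snoc n (p : n.-tuple T * T) : n.+1.-tuple T :=
  [tuple of rcons p.1 p.2].

Definition tuple_unsnoc n (t : n.+1.-tuple T) : n.-tuple T * T :=
  ([tuple tnth t (widen_ord (leqnSn n) i) | i < n], tnth t ord_max).

Lemma tuple_snocK n : cancel (@tuple_snoc n) (@tuple_unsnoc n).
Proof.
move=> [t x]; rewrite /tuple_unsnoc /tuple_snoc /=; congr pair.
  apply: eq_from_tnth => i; rewrite tnth_mktuple !(tnth_nth x) /=.
  by rewrite nth_rcons size_tuple ltn_ord.
by rewrite (tnth_nth x) /= nth_rcons size_tuple ltnn eqxx.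
Qed.

Lemma measurable_tuple_snoc n : measurable_fun [set: _] (@tuple_snoc n).
Proof.
apply/measurable_fun_tnthP => i.
have [ilt|ige] := ltnP i n.
  rewrite (_ : _ \o _ = (fun t : n.-tuple T => tnth t (Ordinal ilt)) \o fst).
    apply: measurableT_comp; first exact: measurable_tnth.
    exact: measurable_fst.
  apply/funext => -[t x] /=; rewrite !(tnth_nth x) /= nth_rcons size_tuple.
  by rewrite ilt.
rewrite (_ : _ \o _ = snd); first exact: measurable_snd.
apply/funext => -[t x] /=; rewrite (tnth_nth x) /= nth_rcons size_tuple.
have -> : nat_of_ord i = n by apply/eqP; rewrite eqn_leq ige -ltnS ltn_ord.
by rewrite ltnn eqxx.
Qed.

Lemma measurable_tuple_unsnoc n : measurable_fun [set: _] (@tuple_unsnoc n).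
Proof.
apply/measurable_fun_pairP; split; last exact: measurable_tnth.
apply/measurable_fun_tnthP => i.
rewrite (_ : _ \o _ = fun t : n.+1.-tuple T => tnth t (widen_ord (leqnSn n) i)).
  exact: measurable_tnth.
by apply/funext => t /=; rewrite tnth_mktuple.
Qed.

Section step.
Variables (n : nat) (mu : {sigma_finite_measure set (n.-tuple T) -> \bar R}).

Definition lebesgue_snoc : set (n.+1.-tuple T) -> \bar R :=
  pushforward (mu \x @lebesgue_measure R)%E (@tuple_snoc n).

HB.instance Definition _ := isMeasurableFun.Build _ _ _ _ (@tuple_snoc n)
  (@measurable_tuple_snoc n).

Let lebesgue_snoc0 : lebesgue_snoc set0 = 0%E.
Proof. exact: measure0. Qed.

Let lebesgue_snoc_ge0 A : (0 <= lebesgue_snoc A)%E.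
Proof. exact: measure_ge0. Qed.

Let lebesgue_snoc_sigma_additive : semi_sigma_additive lebesgue_snoc.
Proof. exact: measure_semi_sigma_additive. Qed.

HB.instance Definition _ := isMeasure.Build _ _ _ lebesgue_snoc
  lebesgue_snoc0 lebesgue_snoc_ge0 lebesgue_snoc_sigma_additive.

Let lebesgue_snoc_sigma_finite : sigma_finite setT lebesgue_snoc.
Proof.
have /sigma_finiteP[F [TF ndF Foo]] := sigma_finiteT mu.
have /sigma_finiteP[G [TG ndG Goo]] := sigma_finiteT (@lebesgue_measure R).
exists (fun k => @tuple_unsnoc n @^-1` (F k `*` G k)).
  rewrite -preimage_bigcup; apply/esym; rewrite -subTset => t _ /=.
  have [k _ Fk] : (\bigcup_k F k) (tuple_unsnoc t).1 by rewrite -TF.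
  have [l _ Gl] : (\bigcup_k G k) (tuple_unsnoc t).2 by rewrite -TG.
  exists (maxn k l) => //; split.
    by move: Fk; exact/subsetPset/ndF/leq_maxl.
  by move: Gl; exact/subsetPset/ndG/leq_maxr.
move=> k; have [mF Fk] := Foo k; have [mG Gk] := Goo k; split.
  rewrite -[X in measurable X]setTI.
  by apply: measurable_tuple_unsnoc => //; exact: measurableX.
rewrite /lebesgue_snoc /pushforward -comp_preimage.
rewrite (_ : _ \o _ = id); last by apply/funext => p /=; rewrite tuple_snocK.
rewrite (_ : id @^-1` _ = F k `*` G k)//.
by rewrite product_measure1E// lte_mul_pinfty// ge0_fin_numE.
Qed.

HB.instance Definition _ := Measure_isSigmaFinite.Build _ _ _ lebesgue_snoc
  lebesgue_snoc_sigma_finite.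

End step.

Fixpoint lebesgue_tuple n : {sigma_finite_measure set (n.-tuple T) -> \bar R} :=
  match n with
  | 0 => \d_([tuple] : 0.-tuple T)
  | n'.+1 => lebesgue_snoc (lebesgue_tuple n')
  end.

End LebesgueTuple.

Section LatticeFace.
Context {R : realType}.

Definition Vol k (A : set 'rV[R]_k) : \bar R :=
  lebesgue_tuple k
    [set t : k.-tuple (measurableTypeR R) | A (\row_i tnth t i)].

(* [forget h] keeps the first [k] of [d] coordinates: it is the projection
   pi^(d-k) of the theory, and [forget (leqnSn d)] is pi. *)
Definition forget k d (h : (k <= d)%N) (x : 'rV[R]_d) : 'rV[R]_k :=
  \row_i x 0 (widen_ord h i).

Definition conv d (A : set 'rV[R]_d) : set 'rV[R]_d :=
  [set x | exists n (p : 'I_n -> 'rV[R]_d) (c : 'I_n -> R),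
     [/\ forall i, A (p i), forall i, 0 <= c i, \sum_i c i = 1
       & x = \sum_i c i *: p i]].

Definition aff d (A : set 'rV[R]_d) : set 'rV[R]_d :=
  [set x | exists n (p : 'I_n -> 'rV[R]_d) (c : 'I_n -> R),
     [/\ forall i, A (p i), \sum_i c i = 1 & x = \sum_i c i *: p i]].

Definition affine_space_of_dim d (k : nat) (A : set 'rV[R]_d) : Prop :=
  exists (x0 : 'rV[R]_d) (W : {vspace 'rV[R]_d}),
    \dim W = k /\ A = [set x | x - x0 \in W].

Definition full_dim_polytope d (P : set 'rV[R]_d) : Prop :=
  (exists2 S : set 'rV[R]_d, finite_set S & P = conv S) /\
  affine_space_of_dim d (aff P).

Definition vertices d (P : set 'rV[R]_d) : set 'rV[R]_d :=
  [set v | P v /\ forall x y t, P x -> P y -> 0 < t < 1 ->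
     v = t *: x + (1 - t) *: y -> x = v /\ y = v].

Definition integer_lattice d : set 'rV[R]_d :=
  [set x | forall i, x 0 i \is a Num.int].

Definition lattice_points d (A : set 'rV[R]_d) : set 'rV[R]_d :=
  A `&` @integer_lattice d.

(* The notion is only meant for [d >= 1]; the value at [d = 0] is a dummy that
   the recursion never reaches. *)
Fixpoint lattice_face (d : nat) : set 'rV[R]_d -> Prop :=
  match d with
  | 0 => fun=> False
  | d'.+1 => fun P : set 'rV[R]_d'.+1 =>
      full_dim_polytope P /\
      if d' is 0 then vertices P `<=` @integer_lattice d'.+1
      else forall U : set 'rV[R]_d'.+1, U `<=` vertices P ->
        affine_space_of_dim d' (aff U) ->
        lattice_face (forget (leqnSn d') @` conv U) /\
        forget (leqnSn d') @` lattice_points (aff U) = @integer_lattice d'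
  end.

Definition dilate d (m : nat) (P : set 'rV[R]_d) : set 'rV[R]_d :=
  [set m%:R *: x | x in P].

(* [fset_set] is meaningful on finite sets only; bounded sets have finitely
   many lattice points. *)
Definition lattice_count d (P : set 'rV[R]_d) (m : nat) : nat :=
  #|` fset_set (lattice_points (dilate m P)) |%N.

Definition is_ehrhart_polynomial d (P : set 'rV[R]_d) (p : {poly R}) : Prop :=
  forall m : nat, (0 < m)%N -> p.[m%:R] = (lattice_count P m)%:R.

End LatticeFace.

(* Main.v *)
From HB Require Import structures.
From mathcomp Require Import all_boot all_order all_algebra finmap.
From mathcomp Require Import all_classical all_reals all_analysis.
From mathcomp Require Import measurable_realfun ring lra zify.
Require Import Defs.

Set Implicit Arguments.
Unset Strict Implicit.
Unset Printing Implicit Defensive.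

Import Order.TTheory GRing.Theory Num.Theory.
Import numFieldNormedType.Exports.

Local Open Scope classical_set_scope.
Local Open Scope ring_scope.

(** The lower boundary of P consists of the lowest points of P on the lines
    parallel to the last coordinate axis; let Omega P be P without it. The theorem
    rests on two facts.

    First, every facet of a lattice-face polytope is the graph of an affine
    function with integer coefficients over its shadow, its image under the
    projection pi ([facet_separates]): condition (a) forbids vertical facets,
    and condition (b) says that the graph has a lattice point above each lattice
    point of Z^(d-1), which forces the coefficients to be integers. So a
    vertical line through a lattice point of pi(mP) meets the lower boundary of
    mP in exactly one point, and that point is a lattice point. Counting gives
    #(mP) = #(Omega(mP)) + #(pi(mP)), see [sum_coord_Omega].

    Second, Omega(mP) has exactly Vol(mP) lattice points. This is proved for a
    class of functions closed under the recursion that defines lattice-face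
    polytopes, the lattice step functions: in the last variable such a function
    is a signed sum of indicators of the half-lines t <= l_i(y), with l_i an
    integer affine function and a weight c_i(y) which is a lattice step function
    of the other variables; the c_i sum to 0, and the height sum_i l_i c_i, which
    is the integral over the last variable, has derivative sum_i a_ik c_i in
    each remaining variable k, where a_ik is the slope of l_i. For a lattice
    step function the sum over Z^n equals the integral over R^n
    ([lattice_sum_integral]). Integrate out the last variables and keep the
    k-th one: the function F of y_k so obtained must have the same sum over Z
    and integral over R. Its sum over the translate s + Z has derivative in s
    equal to a combination of the same sums for the c_i, one dimension lower,
    which by induction do not depend on s; so the sum over s + Z is affine in s.
    It is also periodic in s, hence constant, and its mean over 0 <= s <= 1 is
    the integral of F. This is [shift_invariance].

    The indicator of Omega P is a lattice step function by induction on the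
    dimension ([lattice_step_Omega]). The l_i are the facet heights and c_i is
    the indicator of Omega of the shadow of the facet, with sign + for an upper
    and - for a lower facet; the shadow is itself a lattice-face polytope by
    condition (a). For this to work the sets Omega(shadow) of the upper facets
    must partition Omega(pi P), and likewise for the lower facets
    ([upper_facet_cover], [upper_facet_unique]). Omega is what makes this
    exact: a point shared by two shadows belongs to the one that still contains
    the points slightly below, and there is only one because no face of a shadow
    contains a segment in the last remaining direction. The condition on the
    derivative of the height holds because the height is Lipschitz and piecewise
    affine along every coordinate line ([height_increment]).

    Finally, the projection of a lattice-face polytope is a lattice-face
    polytope ([lattice_face_pr]), so the relation between P and pi(P) can be
    iterated, and Vol_k scales by m^k. The values at all positive integers
    determine the coefficients of the Ehrhart polynomial. *)

(** * Integrals over bounded intervals *)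

Section IntervalIntegral.
Context {R : realType}.
Notation mu := (@lebesgue_measure R).

(** The class of integrands is kept this small so that integrability over any
    bounded interval comes for free. *)
Definition bounded_measurable (g : R -> R) : Prop :=
  measurable_fun [set: R] g /\ exists M, forall x, `|g x| <= M.

(** Half-open intervals make the integral additive in the interval without any
    discussion of endpoints. *)
Definition itv_int (a b : R) (g : R -> R) : R :=
  (\int[mu]_(x in `]a, b]) g x)%R.

Lemma bounded_measurable_integrable g a b : bounded_measurable g ->
  mu.-integrable `]a, b] (EFin \o g).
Proof.
move=> [mg [M Mg]]; apply: measurable_bounded_integrable => //.
- rewrite /= lebesgue_measure_itv/=; case: ifPn => // _; exact: ltry.
- exact: measurable_funTS.
- exists M; split; first exact: num_real.
  by move=> r Mr x _ /=; rewrite (le_trans (Mg x))// ltW.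
Qed.

Lemma bounded_measurable_cst c : bounded_measurable (fun=> c).
Proof. by split; [exact: measurable_cst | exists `|c|]. Qed.

Lemma bounded_measurableZ k g : bounded_measurable g ->
  bounded_measurable (fun x => k * g x).
Proof.
move=> [mg [M Mg]]; split; first exact: measurable_funM.
by exists (`|k| * M) => x; rewrite normrM ler_wpM2l.
Qed.

Lemma bounded_measurable_sum (I : Type) (r : seq I) (P : pred I) (g : I -> R -> R) :
  (forall i, bounded_measurable (g i)) ->
  bounded_measurable (fun x => \sum_(i <- r | P i) g i x).
Proof.
move=> bg; elim: r => [|i r [mr [M Mr]]].
  suff -> : (fun x => \sum_(i <- [::] | P i) g i x) = fun=> 0.
    exact: bounded_measurable_cst.
  by apply/funext => x; rewrite big_nil.
have [Pi|Pi] := boolP (P i); last first.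
  suff -> : (fun x => \sum_(j <- i :: r | P j) g j x) =
            fun x => \sum_(j <- r | P j) g j x by split => //; exists M.
  by apply/funext => x; rewrite big_cons (negbTE Pi).
suff -> : (fun x => \sum_(j <- i :: r | P j) g j x) =
          fun x => g i x + \sum_(j <- r | P j) g j x.
  have [mi [N Ni]] := bg i; split; first exact: measurable_funD.
  by exists (N + M) => x; rewrite (le_trans (ler_normD _ _))// lerD.
by apply/funext => x; rewrite big_cons Pi.
Qed.

Lemma bounded_measurable_affine g (k c : R) : bounded_measurable g ->
  bounded_measurable (fun x => g (k * x + c)).
Proof.
move=> [mg [M Mg]]; split; last by exists M.
apply: (measurableT_comp mg).
by apply: measurable_funD => //; exact: measurable_funM.
Qed.

Lemma eq_itv_int a b f g : (forall x, a < x <= b -> f x = g x) ->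
  itv_int a b f = itv_int a b g.
Proof.
move=> fg; apply: eq_Rintegral => x; rewrite inE/= in_itv/= => /fg; exact.
Qed.

Lemma itv_int_cst a b c : a <= b -> itv_int a b (fun=> c) = c * (b - a).
Proof.
move=> ab; rewrite /itv_int Rintegral_cst//= lebesgue_measure_itv/= lte_fin.
move: ab; rewrite le_eqVlt => /predU1P[->|->//].
by rewrite ltxx subrr.
Qed.

Lemma itv_intZ a b k g : bounded_measurable g ->
  itv_int a b (fun x => k * g x) = k * itv_int a b g.
Proof.
move=> bg; apply: RintegralZl => //.
exact: bounded_measurable_integrable.
Qed.

Lemma itv_intD a b f g : bounded_measurable f -> bounded_measurable g ->
  itv_int a b (fun x => f x + g x) = itv_int a b f + itv_int a b g.
Proof.
by move=> bf bg; apply: RintegralD => //;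
   exact: bounded_measurable_integrable.
Qed.

Lemma itv_int_sum a b (I : Type) (r : seq I) (P : pred I) (g : I -> R -> R) :
  (forall i, bounded_measurable (g i)) ->
  itv_int a b (fun x => \sum_(i <- r | P i) g i x) =
  \sum_(i <- r | P i) itv_int a b (g i).
Proof.
move=> bg; elim: r => [|i r IH].
  rewrite big_nil -[RHS](mul0r (b - a)).
  transitivity (itv_int a b (fun=> 0 * 0)).
    by apply: eq_itv_int => x _; rewrite big_nil mul0r.
  by rewrite itv_intZ ?mul0r//; exact: bounded_measurable_cst.
rewrite big_cons -IH; case: ifP => Pi.
  rewrite -itv_intD//; last exact: bounded_measurable_sum.
  by apply: eq_itv_int => x _; rewrite big_cons Pi.
by apply: eq_itv_int => x _; rewrite big_cons Pi.
Qed.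

Lemma itv_int_cat a b c g : a <= b -> b <= c -> bounded_measurable g ->
  itv_int a c g = itv_int a b g + itv_int b c g.
Proof.
move=> ab bc bg; rewrite /itv_int.
have E : [set` `]a, c]] = [set` `]a, b]] `|` [set` `]b, c]].
  by apply: itv_bndbnd_setU; rewrite bnd_simp.
rewrite E Rintegral_setU//.
  by rewrite -E; exact: bounded_measurable_integrable.
apply/disj_set2P; rewrite -subset0 => x [] /=.
by rewrite !in_itv/= => /andP[_ xb] /andP[bx _]; move: (lt_le_trans bx xb); rewrite ltxx.
Qed.

Lemma itv_int_setT a b g : (forall x, ~~ (a < x <= b) -> g x = 0) ->
  (\int[mu]_x g x)%R = itv_int a b g.
Proof.
move=> g0; rewrite /itv_int [in RHS]Rintegral_mkcond; apply: eq_Rintegral => x _.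
rewrite patchE; case: ifPn => // /negP xab; apply: g0; apply/negP => h.
by apply: xab; rewrite inE/= in_itv.
Qed.

Lemma le_itv_int a b f g : bounded_measurable f -> bounded_measurable g ->
  (forall x, a < x <= b -> f x <= g x) -> itv_int a b f <= itv_int a b g.
Proof.
move=> bf bg fg; apply: le_Rintegral => //.
- exact: bounded_measurable_integrable.
- exact: bounded_measurable_integrable.
Qed.

Section affine.
Variables (k c : R) (k0 : 0 < k).
Let T : measurableType _ := measurableTypeR R.
Let phi (x : T) : T := k * x + c.
Let mphi : measurable_fun setT phi.
Proof. by apply: measurable_funD => //; exact: measurable_funM. Qed.
Let k1 : 0 <= k. Proof. exact: ltW. Qed.

Lemma preimage_affine_itv (a b : R) :
  phi @^-1` `]a, b] = `](a - c) / k, (b - c) / k]%classic.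
Proof.
apply/seteqP; split=> x /=; rewrite !in_itv/= ltr_pdivrMr// ler_pdivlMr//.
  by rewrite ltrBlDr lerBrDr mulrC.
by rewrite ltrBlDr lerBrDr mulrC.
Qed.

Let push : {measure set T -> \bar R} :=
  measure_function_pushforward__canonical__measure_function_Measure mu mphi.

(** Both sides are measures that agree on half-open intervals, so uniqueness of
    the Lebesgue measure applies. *)
Lemma lebesgue_measure_affine (A : set T) : measurable A ->
  mu A = mscale (NngNum k1) push A.
Proof.
move=> mA; apply: lebesgue_measure_unique => // _ [[a b]] _ <-.
rewrite [RHS](_ : _ = (k%:E * mu (phi @^-1` `]a, b]))%E)// preimage_affine_itv.
rewrite /= !lebesgue_measure_itv/= !lte_fin ltr_pM2r ?invr_gt0// ltrD2r.
case: ifPn => _; last by rewrite mule0.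
rewrite -!EFinD -EFinM; congr _%:E; field; exact: lt0r_neq0.
Qed.

Let ge0_itv_int_affine (a b : R) g : (forall x, 0 <= g x) ->
  bounded_measurable g ->
  k * itv_int a b (fun x => g (k * x + c)) = itv_int (k * a + c) (k * b + c) g.
Proof.
move=> g0 bg; pose D := `](k * a + c), (k * b + c)]%classic.
have E : phi @^-1` D = `]a, b]%classic.
  rewrite preimage_affine_itv !addrK [k * a]mulrC [k * b]mulrC.
  by rewrite !mulfK ?lt0r_neq0.
have mg : measurable_fun D (EFin \o g).
  by apply/measurable_EFinP/measurable_funTS; case: bg.
rewrite {2}/itv_int /Rintegral.
rewrite (@eq_measure_integral _ _ _ _ (mscale (NngNum k1) push)); last first.
  by move=> A mA _; exact: lebesgue_measure_affine.
rewrite ge0_integral_mscale//; last by move=> x _; rewrite lee_fin.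
rewrite ge0_integral_pushforward//; last by move=> x _; rewrite lee_fin.
rewrite E /= -[k in LHS]/(fine k%:E) -fineM//.
apply: integrable_fin_num => //.
by apply: bounded_measurable_integrable; exact: bounded_measurable_affine.
Qed.

(** Adding a constant reduces the claim to nonnegative functions, for which the
    change of variables is integration against a pushforward measure. *)
Lemma itv_int_affine (a b : R) g : a <= b -> bounded_measurable g ->
  k * itv_int a b (fun x => g (k * x + c)) = itv_int (k * a + c) (k * b + c) g.
Proof.
move=> ab bg; have [M Mg] := bg.2.
have bc := bounded_measurable_cst M.
have bgM : bounded_measurable (fun x => g x + M).
  split; first by apply: measurable_funD => //; case: bg.
  exists (M + `|M|) => x; rewrite (le_trans (ler_normD _ _))// lerD//.
have gM0 x : 0 <= g x + M by have := Mg x; rewrite ler_norml; lra.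
have := ge0_itv_int_affine a b gM0 bgM.
have bga := bounded_measurable_affine k c bg.
rewrite !itv_intD// !itv_int_cst ?lerD2r ?ler_pM2l// => H.
by lra.
Qed.
End affine.

Lemma itv_int_swap (F : R -> R -> R) (M a b c d : R) :
  measurable_fun setT (fun p : measurableTypeR R * measurableTypeR R => F p.1 p.2) ->
  (forall x y, `|F x y| <= M) ->
  itv_int a b (fun x => itv_int c d (F x)) =
  itv_int c d (fun y => itv_int a b (F^~ y)).
Proof.
move=> mF FM.
pose D1 := `]a, b]%classic : set (measurableTypeR R).
pose D2 := `]c, d]%classic : set (measurableTypeR R).
have mD1 : measurable D1 by exact: measurable_itv.
have mD2 : measurable D2 by exact: measurable_itv.
pose F' := fun p : measurableTypeR R * measurableTypeR R => F p.1 p.2.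
have finD e f : (mu `]e, f] < +oo)%E.
  by rewrite /= lebesgue_measure_itv/=; case: ifPn => // _; exact: ltry.
have iF : (mu \x mu)%E.-integrable (D1 `*` D2) (EFin \o F').
  apply: measurable_bounded_integrable => //.
  - exact: measurableX.
  - rewrite [ltLHS]product_measure1E//; apply: lte_mul_pinfty => //.
      by rewrite ge0_fin_numE//; exact: finD.
    exact: finD.
  - exact: measurable_funTS.
  - exists M; split; first exact: num_real.
    by move=> r Mr x _ /=; rewrite (le_trans (FM _ _))// ltW.
have iG : (mu \x mu)%E.-integrable setT ((EFin \o F') \_ (D1 `*` D2)).
  by apply/(integrable_mkcond _ (measurableX mD1 mD2)).
have bF1 x : bounded_measurable (F x).
  split; last by exists M.
  exact: (measurableT_comp mF (pair1_measurable x)).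
have bF2 y : bounded_measurable (F^~ y).
  split; last by exists M.
  exact: (measurableT_comp mF (pair2_measurable y)).
have := Fubini iG; rewrite /itv_int => H.
congr fine; rewrite integral_mkcond [RHS]integral_mkcond.
transitivity (\int[mu]_x \int[mu]_y ((EFin \o F') \_ (D1 `*` D2)) (x, y))%E.
  apply: eq_integral => x _; rewrite patchE; case: ifPn => xD.
    rewrite /= fineK; last by apply: integrable_fin_num => //; exact: bounded_measurable_integrable.
    rewrite integral_mkcond; apply: eq_integral => y _.
    rewrite !patchE; congr (if _ then _ else _).
    by apply/idP/idP; rewrite !inE => //; [split => //; move: xD; rewrite inE | case].
  rewrite integral0_eq// => y _; rewrite patchE; case: ifPn => //.
  by rewrite inE => -[xD1]; move: xD; rewrite notin_setE.
rewrite H; apply: eq_integral => y _; rewrite patchE; case: ifPn => yD; last first.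
  rewrite integral0_eq// => x _; rewrite patchE; case: ifPn => //.
  by rewrite inE => -[_ yD1]; move: yD; rewrite notin_setE.
rewrite /= fineK; last by apply: integrable_fin_num => //; exact: bounded_measurable_integrable.
rewrite [RHS]integral_mkcond; apply: eq_integral => x _.
rewrite !patchE; congr (if _ then _ else _).
by apply/idP/idP; rewrite !inE => //; [case | split => //; move: yD; rewrite inE].
Qed.

End IntervalIntegral.

(** * Continuous piecewise affine functions of one variable *)

Section PiecewiseAffine.
Context {R : realType}.

(** Compactness of [a, b] in the form of an induction: a transitive relation that
    holds between each point and its close neighbours holds between any two points. *)
Lemma real_induction (P : R -> R -> Prop) :
  (forall x y z, x <= y -> y <= z -> P x y -> P y z -> P x z) ->
  (forall t, exists2 e, 0 < e & forall s, t <= s < t + e -> P t s) ->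
  (forall t, exists2 e, 0 < e & forall s, t - e < s <= t -> P s t) ->
  forall a b, a <= b -> P a b.
Proof.
move=> Ptrans Pright Pleft a b ab.
pose S := [set x | a <= x <= b /\ P a x].
have Sa : S a.
  split; first by rewrite lexx.
  by have [e e0 He] := Pright a; apply: He; rewrite lexx ltrDl.
have Sb : ubound S b by move=> x [/andP[]].
have supS : has_sup S by split; [exists a | exists b].
have aS : a <= sup S by apply: sup_upper_bound.
have Sleb : sup S <= b by apply: ge_sup => //; exists a.
have PS : P a (sup S).
  have [e e0 He] := Pleft (sup S).
  have [x [/andP[ax xb] Px] xe] := sup_adherent e0 supS.
  have xS : x <= sup S by apply: sup_upper_bound => //; split => //; apply/andP.
  by apply: (Ptrans a x) => //; apply: He; rewrite xe.
move: Sleb; rewrite le_eqVlt => /predU1P[<-//|Sb'].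
have [e e0 He] := Pright (sup S).
pose s := Num.min b (sup S + e / 2).
have sS : sup S < s by rewrite lt_min Sb' ltrDl divr_gt0.
have se : s < sup S + e by rewrite gt_min; apply/orP; right; rewrite ltrD2l; lra.
have : S s.
  split; first by rewrite ge_min lexx /= andbT; apply/ltW/(le_lt_trans aS).
  by apply: (Ptrans a (sup S)) => //; [exact: ltW | apply: He; rewrite ltW].
by move=> /(sup_upper_bound supS); rewrite leNgt sS.
Qed.

Lemma common_radius (T : finType) (Q : T -> R -> Prop) :
  (forall i e e', 0 < e' -> e' <= e -> Q i e -> Q i e') ->
  (forall i, exists2 e, 0 < e & Q i e) ->
  exists2 e, 0 < e & forall i, Q i e.
Proof.
move=> Qm Qe.
suff [e e0 He] : exists2 e, 0 < e & forall i, i \in enum T -> Q i e.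
  by exists e => // i; apply: He; rewrite mem_enum.
elim: (enum T) => [|i r [e e0 He]]; first by exists 1.
have [d d0 Hd] := Qe i; exists (Num.min d e); first by rewrite lt_min d0.
move=> j; rewrite inE => /predU1P[->|/He Qj].
  by apply: Qm Hd; [rewrite lt_min d0 | rewrite ge_min lexx].
by apply: Qm Qj; [rewrite lt_min d0 | rewrite ge_min lexx orbT].
Qed.

Definition convex_pred (I : pred R) :=
  forall x y z, x <= y -> y <= z -> I x -> I z -> I y.

(** An interval is eventually constant to the right of any point, so finitely
    many of them are simultaneously constant on a common one-sided neighbourhood. *)
Lemma convex_pred_right (I : pred R) t : convex_pred I ->
  exists2 e, 0 < e & exists b : bool, forall s, t < s < t + e -> I s = b.
Proof.
move=> cI; have [[e e0 He]|no] := pselect (exists2 e, 0 < e & forall s, t < s < t + e -> ~~ I s).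
  by exists e => //; exists false => s /He /negbTE.
have ex e : 0 < e -> exists2 s, t < s < t + e & I s.
  move=> e0; apply: contrapT => h; apply: no; exists e => // s st.
  by apply/negP => Is; apply: h; exists s.
have [s1 /andP[ts1 _] Is1] := ex _ (@ltr01 R).
exists (s1 - t); first by rewrite subr_gt0.
exists true => s /andP[ts sts].
have [s2 /andP[ts2 s2s] Is2] : exists2 s2, t < s2 < t + (s - t) & I s2.
  by apply: ex; rewrite subr_gt0.
by apply: (cI s2 s s1) => //; lra.
Qed.

Lemma convex_pred_left (I : pred R) t : convex_pred I ->
  exists2 e, 0 < e & exists b : bool, forall s, t - e < s < t -> I s = b.
Proof.
move=> cI; have [] := @convex_pred_right (fun x => I (- x)) (- t).
  by move=> x y z xy yz Ix Iz; apply: (cI (- z) _ (- x)); rewrite ?lerN2.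
move=> e e0 [b Hb]; exists e => //; exists b => s /andP[s1 s2].
by rewrite -[s]opprK Hb//; apply/andP; split; lra.
Qed.

Lemma convex_pred_measurable (I : pred R) : convex_pred I ->
  bounded_measurable (fun x => (I x)%:R).
Proof.
move=> cI; split; last first.
  by exists 1 => x; case: (I x); rewrite ?normr1 ?normr0.
have -> : (fun x => (I x)%:R) = \1_[set x | I x] :> (R -> R).
  apply/funext => x; rewrite indicE; congr (nat_of_bool _)%:R.
  by apply/idP/idP; rewrite inE.
have mI : measurable ([set x | I x] : set (measurableTypeR R)).
  apply: is_interval_measurable => x z /= Ix Iz y /andP[xy yz].
  exact: (cI x y z).
exact: measurable_indic.
Qed.

(** Removes the one-sided limits from continuity arguments: the value at the end
    of an interval is forced by a Lipschitz estimate. *)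
Lemma small_multiple_eq0 (x C e : R) : 0 < e ->
  (forall d, 0 < d < e -> `|x| <= C * d) -> x = 0.
Proof.
move=> e0 H; apply/eqP; rewrite -normr_le0 leNgt; apply/negP => x0.
have C0 : 0 < C.
  have := H (e / 2) _; rewrite divr_gt0//= ltr_pdivrMr// mulr_natr mulr2n ltrDl e0.
  move=> /(_ isT) /(lt_le_trans x0); rewrite pmulr_lgt0// divr_gt0//.
pose d := Num.min (e / 2) (`|x| / C / 2).
have d0 : 0 < d by rewrite lt_min !divr_gt0.
have de : d < e by rewrite gt_min; apply/orP; left; lra.
have := H d; rewrite d0 de => /(_ isT); rewrite leNgt => /negP; apply.
have : d <= `|x| / C / 2 by rewrite ge_min lexx orbT.
rewrite -(ler_pM2l C0) => /le_lt_trans; apply.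
have -> : C * (`|x| / C / 2) = `|x| / 2 by field; exact: lt0r_neq0.
lra.
Qed.

(** A Lipschitz function that is affine on finitely many intervals is the integral
    of its slope. Near every point, on either side, all the intervals are constant,
    so [h] is affine there up to the value at the point itself, which the Lipschitz
    bound determines; [real_induction] glues these local statements. *)
Lemma piecewise_affine_increment (T : finType) (p q : T -> R) (I : T -> pred R)
    (h : R -> R) (L : R) :
  (forall i, convex_pred (I i)) ->
  (forall t, h t = \sum_i (p i + q i * t) * (I i t)%:R) ->
  (forall s t, `|h s - h t| <= L * `|s - t|) ->
  forall a b, a <= b ->
    h b - h a = itv_int a b (fun t => \sum_i q i * (I i t)%:R).
Proof.
move=> cI hE hL; pose g t := \sum_i q i * (I i t)%:R.
have bg : bounded_measurable g.
  apply: bounded_measurable_sum => i; apply: bounded_measurableZ.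
  exact: convex_pred_measurable.
have [M gM] := bg.2.
have int_cst beta x y : x <= y -> (forall s, x < s <= y -> g s = beta) ->
    itv_int x y g = beta * (y - x).
  by move=> xy gE; rewrite -itv_int_cst//; exact: eq_itv_int.
have locally (e t : R) (U : R -> Prop) : 0 < e ->
  (forall i, exists b : bool, forall s, U s -> I i s = b) ->
  exists al be, (forall s, U s -> h s = al + be * s) /\ (forall s, U s -> g s = be).
  move=> e0 /choice[b Hb]; exists (\sum_i p i * (b i)%:R), (\sum_i q i * (b i)%:R).
  split=> s Us; last by apply: eq_bigr => i _; rewrite Hb.
  rewrite hE mulr_suml -big_split/=; apply: eq_bigr => i _.
  by rewrite (Hb i s)// mulrDl mulrAC.
apply: real_induction => [x y z xy yz Pxy Pyz|t|t].
- by rewrite (itv_int_cat xy yz)// -Pxy -Pyz; lra.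
- have [i e e' e'0 ee' [b Hb]|i|e e0 He] := @common_radius T
    (fun i e => exists b : bool, forall s, t < s < t + e -> I i s = b).
  + by exists b => s /andP[s1 s2]; apply: Hb; rewrite s1/=; lra.
  + exact: convex_pred_right.
  have [al [be [hs gs]]] := locally e t _ e0 He.
  have ht : h t = al + be * t.
    apply/eqP; rewrite -subr_eq0; apply/eqP.
    apply: (@small_multiple_eq0 _ (L + `|be|) e) => // d /andP[d0 de].
    have -> : h t - (al + be * t) = (h t - h (t + d)) + be * d.
      by rewrite (hs (t + d)); [ring | apply/andP; split; lra].
    rewrite (le_trans (ler_normD _ _))// mulrDl lerD//.
      by rewrite (le_trans (hL _ _))// opprD addNKr normrN gtr0_norm.
    by rewrite normrM (gtr0_norm d0).
  exists e => // s /andP[ts se].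
  rewrite -/g (int_cst be)//; last first.
    by move=> r /andP[r1 r2]; apply: gs; rewrite r1/=; lra.
  move: ts; rewrite le_eqVlt => /predU1P[->|ts]; first by rewrite !subrr mulr0.
  by rewrite ht hs; [ring | rewrite ts].
- have [i e e' e'0 ee' [b Hb]|i|e e0 He] := @common_radius T
    (fun i e => exists b : bool, forall s, t - e < s < t -> I i s = b).
  + by exists b => s /andP[s1 s2]; apply: Hb; rewrite s2 andbT; lra.
  + exact: convex_pred_left.
  (* On the left of [t] the integrand may jump at [t] itself, so the last bit of
     length [d] is estimated instead of computed. *)
  have [al [be [hs gs]]] := locally e t _ e0 He.
  exists e => // s /andP[es]; rewrite le_eqVlt => /predU1P[->|st].
    by rewrite subrr -/g (int_cst 0) ?subrr ?mulr0// => r /andP[r1 r2]; lra.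
  apply/eqP; rewrite -subr_eq0; apply/eqP.
  apply: (@small_multiple_eq0 _ (L + M) (t - s)) => [|d /andP[d0 de]].
    by rewrite subr_gt0.
  rewrite -/g (@itv_int_cat _ s (t - d) t); [|lra|lra|by []].
  rewrite (int_cst be); [|lra|]; last first.
    by move=> r /andP[r1 r2]; apply: gs; apply/andP; split; lra.
  have -> : h t - h s - (be * (t - d - s) + itv_int (t - d) t g) =
     (h t - h (t - d)) - itv_int (t - d) t g.
    rewrite (hs s); last by rewrite es.
    rewrite (hs (t - d)); last by apply/andP; split; lra.
    ring.
  rewrite (le_trans (ler_normB _ _))// mulrDl lerD//.
    rewrite (le_trans (hL _ _))//.
    by rewrite opprB addrC subrK gtr0_norm.
  have bM c := bounded_measurable_cst c.
  have td : t - d <= t by lra.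
  have dE : t - (t - d) = d by ring.
  rewrite ler_norml; apply/andP; split.
    have -> : - (M * d) = itv_int (t - d) t (fun=> - M).
      by rewrite itv_int_cst// dE mulNr.
    by apply: le_itv_int => // x _; have := gM x; rewrite ler_norml => /andP[].
  have -> : M * d = itv_int (t - d) t (fun=> M) by rewrite itv_int_cst// dE.
  by apply: le_itv_int => // x _; have := gM x; rewrite ler_norml => /andP[].
Qed.

End PiecewiseAffine.

(** * Functions of finitely many coordinates and integration in one coordinate *)

Section IteratedIntegral.
Context {R : realType}.
Notation mu := (@lebesgue_measure R).
Local Notation pt := (nat -> R).
Implicit Types (y : pt) (f g chi : pt -> R) (k n : nat).

(** Points are infinite sequences, so that one type serves all dimensions and a
    coordinate can be changed or integrated without any cast. *)
Definition upd y k (x : R) : pt := fun j => if j == k then x else y j.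

Lemma upd_same y k x : upd y k x k = x. Proof. by rewrite /upd eqxx. Qed.

Lemma upd_neq y k x j : j != k -> upd y k x j = y j.
Proof. by rewrite /upd => /negbTE ->. Qed.

Lemma updC y j k s t : j != k -> upd (upd y j s) k t = upd (upd y k t) j s.
Proof.
move=> jk; apply/funext => i; rewrite /upd.
by case: (i =P k) => // ->; case: (k =P j) => // kj; rewrite kj eqxx in jk.
Qed.

Lemma updK y k s t : upd (upd y k s) k t = upd y k t.
Proof. by apply/funext => i; rewrite /upd; case: (i == k). Qed.

Lemma upd_id y k : upd y k (y k) = y.
Proof. by apply/funext => i; rewrite /upd; case: (i =P k) => // ->. Qed.

(** Measurability of a function on sequences, tested on all maps into sequences
    with measurable coordinates. This replaces a sigma-algebra on the sequences; it
    is visibly stable under updates of coordinates, and partial integrals inherit it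
    from the Fubini-Tonelli theorem for one product measure. *)
Definition plot_measurable f : Prop :=
  forall (dd : measure_display) (X : measurableType dd) (phi : X -> pt),
    (forall j, measurable_fun [set: X] (fun x => phi x j)) ->
    measurable_fun [set: X] (fun x => f (phi x)).

(** The integrands of all the iterated integrals below. A single natural number
    bounds both the function and its support, so that bounds combine easily. *)
Definition tame n (M : nat) f : Prop :=
  [/\ plot_measurable f, forall y, `|f y| <= M%:R
    & forall y k, (k < n)%N -> M%:R <= `|y k| -> f y = 0].

Lemma tame_le n M M' f : (M <= M')%N -> tame n M f -> tame n M' f.
Proof.
move=> MM' [mf fM f0]; split=> [//|y|y k kn yk].
  by rewrite (le_trans (fM y))// ler_nat.
by apply: f0 kn _; rewrite (le_trans _ yk)// ler_nat.
Qed.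

Lemma plot_measurable_upd1 y k f : plot_measurable f ->
  measurable_fun setT (fun x : measurableTypeR R => f (upd y k x)).
Proof.
move=> mf; apply: mf => j; rewrite /upd; case: (j == k) => //.
Qed.

Lemma tame_section n M f y k : tame n M f ->
  bounded_measurable (fun x => f (upd y k x)).
Proof.
move=> [mf fM _]; split; last by exists M%:R.
exact: plot_measurable_upd1.
Qed.

Lemma tame_sum n (I : finType) (w : I -> R) (f : I -> pt -> R) :
  (forall i, exists M, tame n M (f i)) ->
  exists M, tame n M (fun y => \sum_i w i * f i y).
Proof.
move=> /choice[M Mf]; pose B := \max_i M i.
pose W := \sum_i `|w i| * B%:R.
have W0 : 0 <= W by apply: sumr_ge0 => i _; rewrite mulr_ge0.
have fB i : tame n B (f i) by apply: tame_le (Mf i); exact: leq_bigmax.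
exists (maxn B (Num.bound W)); split.
- move=> dd X phi mphi.
  suff -> : (fun x => \sum_i w i * f i (phi x)) = \sum_i (fun x => w i * f i (phi x)).
    apply: (big_ind (measurable_fun setT)) => [|g h mg mh|i _].
    + exact: measurable_cst.
    + exact: measurable_funD.
    + by apply: measurable_funM => //; case: (fB i) => mf _ _; exact: mf.
  by apply/funext => x; rewrite fct_sumE.
- move=> y; rewrite (@le_trans _ _ W)//; last first.
    rewrite (le_trans (ltW (archi_boundP W0)))// ler_nat leq_maxr//.
  rewrite (le_trans (ler_norm_sum _ _ _))// ler_sum// => i _.
  by rewrite normrM ler_wpM2l//; case: (fB i).
- move=> y k kn yk; rewrite big1// => i _; have [_ _ f0] := fB i.
  rewrite (f0 y k) ?mulr0//; apply: le_trans yk.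
  by rewrite ler_nat leq_maxl.
Qed.

Definition int_coord k f : pt -> R := fun y => (\int[mu]_x f (upd y k x))%R.

Lemma int_coord_itv n (M N : nat) k f y : (k < n)%N -> (M <= N)%N -> tame n M f ->
  int_coord k f y = itv_int (- N%:R) N%:R (fun x => f (upd y k x)).
Proof.
move=> kn MN /(tame_le MN)[_ _ f0]; apply: itv_int_setT => x; rewrite negb_and => xN.
apply: (f0 _ k) => //; rewrite upd_same ler_normr.
case/orP: xN; last by rewrite -ltNge => /ltW ->.
by rewrite -leNgt lerNr => ->; rewrite orbT.
Qed.

Lemma int_coord_plot_measurable k f : plot_measurable f -> plot_measurable (int_coord k f).
Proof.
move=> mf dd X phi mphi.
pose F := fun p : X * measurableTypeR R => (f (upd (phi p.1) k p.2))%:E.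
have mF : measurable_fun setT F.
  apply/measurable_EFinP; apply: (mf _ _ (fun p => upd (phi p.1) k p.2)) => j.
  rewrite /upd; case: (j == k); first exact: measurable_snd.
  exact: (measurableT_comp (mphi j) measurable_fst).
have mP : measurable_fun setT (fun x => \int[mu]_t (F^\+%E (x, t)))%E.
  apply: (measurable_fun_fubini_tonelli_F (m2 := mu)) => //.
  exact: measurable_funepos.
have mN : measurable_fun setT (fun x => \int[mu]_t (F^\-%E (x, t)))%E.
  apply: (measurable_fun_fubini_tonelli_F (m2 := mu)) => //.
  exact: measurable_funeneg.
have mPN := measurableT_comp (fine_measurable measurableT) (emeasurable_funB mP mN).
apply: eq_measurable_fun mPN => x _ /=.
rewrite /int_coord /Rintegral [in RHS]integralE; congr (fine (_ - _)).
  by apply: eq_integral => t _; rewrite !funeposE.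
by apply: eq_integral => t _; rewrite !funenegE.
Qed.

(** The new bound is the length [M + M] of the support times the old bound. *)
Lemma int_coord_tame n M f : tame n.+1 M f -> tame n (M + M * (M + M)) (int_coord n f).
Proof.
move=> nf; have [mf fM f0] := nf; split.
- exact: int_coord_plot_measurable.
- move=> y; rewrite (int_coord_itv _ (ltnSn n) (leqnn M) nf).
  have M2 : - M%:R <= M%:R :> R by rewrite lerNl oppr_le0 || rewrite (@le_trans _ _ 0)// oppr_le0.
  have bs := tame_section y n nf.
  have bc c := bounded_measurable_cst c.
  have : `|itv_int (- M%:R) M%:R (fun x => f (upd y n x))| <= M%:R * (M%:R + M%:R).
    rewrite ler_norml; apply/andP; split.
      have -> : - (M%:R * (M%:R + M%:R)) = itv_int (- M%:R) M%:R (fun=> - M%:R) :> R.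
        by rewrite itv_int_cst// opprK mulNr.
      by apply: le_itv_int => // x _; have := fM (upd y n x); rewrite ler_norml => /andP[].
    have -> : M%:R * (M%:R + M%:R) = itv_int (- M%:R) M%:R (fun=> M%:R) :> R.
      by rewrite itv_int_cst// opprK.
    by apply: le_itv_int => // x _; have := fM (upd y n x); rewrite ler_norml => /andP[].
  by move=> /le_trans; apply; rewrite natrD natrM natrD lerDr.
- move=> y k kn yk; rewrite (int_coord_itv _ (ltnSn n) (leqnn M) nf).
  have yk' : M%:R <= `|y k| by rewrite (le_trans _ yk)// ler_nat leq_addr.
  rewrite -[RHS](mul0r (M%:R - - M%:R)) -itv_int_cst; last first.
    by rewrite (@le_trans _ _ 0)// oppr_le0.
  apply: eq_itv_int => x _; apply: (f0 _ k); first exact: ltnW.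
  by rewrite upd_neq// ltn_eqF.
Qed.

End IteratedIntegral.

(** * Lattice step functions *)

Section LatticeStep.
Context {R : realType}.
Local Notation pt := (nat -> R).
Implicit Types (y : pt) (f g chi : pt -> R) (k n : nat).

(** Integer affine functions take integers to integers; this is where the
    condition on lattice points enters the analytic part. *)
Definition affine (z : int) (a : nat -> int) n y : R :=
  z%:~R + \sum_(j < n) (a j)%:~R * y j.

(** The functions whose sum over the lattice will turn out to be their integral.
    The vanishing sum of the weights makes the support bounded below in the last
    variable. The last clause says that the height, which is the integral of [chi]
    over the last variable ([int_coord_lattice_step]), is an indefinite integral of
    the combination of the weights by the slopes; that is, moving in the direction
    [k] the jumps of the weights contribute nothing to the height. *)
Fixpoint lattice_step n chi : Prop :=
  match n with
  | 0 => exists c, chi = fun=> c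
  | n'.+1 => exists (I : finType) (z : I -> int) (a : I -> nat -> int)
        (c : I -> pt -> R),
      [/\ forall i, lattice_step n' (c i),
          forall y, \sum_i c i y = 0,
          forall y, chi y = \sum_i (y n' <= affine (z i) (a i) n' y)%R%:R * c i y
        & let h y := \sum_i affine (z i) (a i) n' y * c i y in
          forall k y s t, (k < n')%N -> s <= t ->
            h (upd y k t) - h (upd y k s) =
            itv_int s t (fun u => \sum_i (a i k)%:~R * c i (upd y k u))]
  end.

Lemma affine_ext z a n y y' : (forall j, (j < n)%N -> y j = y' j) ->
  affine z a n y = affine z a n y'.
Proof. by move=> yy'; congr (_ + _); apply: eq_bigr => j _; rewrite yy'. Qed.

Lemma affine_upd z a n y k x : (n <= k)%N ->
  affine z a n (upd y k x) = affine z a n y.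
Proof.
move=> nk; apply: affine_ext => j jn; rewrite upd_neq// ltn_eqF//.
exact: leq_trans nk.
Qed.

Lemma affine_int z a n y : (forall j, (j < n)%N -> y j \is a Num.int) ->
  affine z a n y \is a Num.int.
Proof.
move=> yint; apply: rpredD; first exact: intr_int.
by apply: rpred_sum => j _; apply: rpredM; [exact: intr_int | exact: yint].
Qed.

Lemma lattice_step_ext n chi y y' : lattice_step n chi ->
  (forall j, (j < n)%N -> y j = y' j) -> chi y = chi y'.
Proof.
elim: n chi => [|n IH] chi /=; first by move=> [c ->].
move=> [I [z [a [c [Gc _ chiE _]]]]] yy'.
have yyn j : (j < n)%N -> y j = y' j by move=> jn; apply: yy'; exact: ltnW.
rewrite !chiE; apply: eq_bigr => i _.
by rewrite (IH _ (Gc i) yyn) (affine_ext _ _ yyn) (yy' n).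
Qed.

Lemma lattice_step_upd n chi y k x : lattice_step n chi -> (n <= k)%N ->
  chi (upd y k x) = chi y.
Proof.
move=> Gc nk; apply: lattice_step_ext Gc _ => j jn; rewrite upd_neq// ltn_eqF//.
exact: leq_trans nk.
Qed.

(** The weights have a bounded support, on which all the affine functions are
    bounded; so far from the origin the half-lines are all present or all absent. *)
Lemma affine_bounded (I : finType) (z : I -> int) (a : I -> nat -> int) n M
    (c : I -> pt -> R) : (forall i, tame n M (c i)) ->
  exists B : nat, forall y i j, c i y != 0 ->
    `|affine (z j) (a j) n y| < B%:R.
Proof.
move=> nc; pose W := \sum_j (`|(z j)%:~R : R| + \sum_(k < n) `|(a j k)%:~R| * M%:R).
have term0 j : 0 <= `|(z j)%:~R : R| + \sum_(k < n) `|(a j k)%:~R| * M%:R.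
  by rewrite addr_ge0// sumr_ge0// => k _; rewrite mulr_ge0.
have W0 : 0 <= W by rewrite sumr_ge0.
exists (Num.bound W) => y i j ci; apply: le_lt_trans (archi_boundP W0).
apply: (@le_trans _ _ (`|(z j)%:~R : R| + \sum_(k < n) `|(a j k)%:~R| * M%:R)).
  rewrite (le_trans (ler_normD _ _))// lerD// (le_trans (ler_norm_sum _ _ _))//.
  apply: ler_sum => k _; rewrite normrM ler_wpM2l//.
  rewrite leNgt; apply: contra ci => Mk; apply/eqP.
  by have [_ _ c0] := nc i; apply: (c0 _ k); rewrite ?ltn_ord// ltW.
by rewrite /W (bigD1 j)//= lerDl sumr_ge0.
Qed.

Lemma plot_measurable_affine z a n : plot_measurable (affine z a n).
Proof.
move=> dd X phi mphi; apply: measurable_funD; first exact: measurable_cst.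
suff -> : (fun x => \sum_(j < n) (a j)%:~R * phi x j) =
  \sum_(j < n) (fun x => (a j)%:~R * phi x j).
  apply: (big_ind (measurable_fun setT)) => [|g h mg mh|i _].
  + exact: measurable_cst.
  + exact: measurable_funD.
  + by apply: measurable_funM.
by apply/funext => x; rewrite fct_sumE.
Qed.

Lemma measurable_bool_natr dd (X : measurableType dd) (b : X -> bool) :
  measurable_fun setT b -> measurable_fun setT (fun x => (b x)%:R : R).
Proof.
move=> mb.
have mB : measurable (b @^-1` [set true]).
  by rewrite -[X in measurable X]setTI; apply: mb.
apply: (eq_measurable_fun (\1_(b @^-1` [set true]) : X -> R)); last first.
  exact: measurable_indic.
move=> x _; rewrite indicE; congr (nat_of_bool _)%:R.
by apply/idP/idP; rewrite inE.
Qed.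

Lemma common_tame n (I : finType) (c : I -> pt -> R) :
  (forall i, exists M, tame n M (c i)) -> exists M, forall i, tame n M (c i).
Proof.
move=> /choice[M Mc]; exists (\max_i M i) => i.
by apply: tame_le (Mc i); exact: leq_bigmax.
Qed.

(** Above all the heights every half-line indicator is 0; below them all are 1 and
    the weights cancel. *)
Lemma lattice_step_tame n chi : lattice_step n chi -> exists M, tame n M chi.
Proof.
elim: n chi => [|n IH] chi /=.
  move=> [c ->]; exists (Num.bound `|c|); split=> //.
  by move=> y; rewrite ltW// archi_boundP.
move=> [I [z [a [c [Gc c0 chiE _]]]]].
have [M nc] := common_tame (fun i => IH _ (Gc i)).
have [B HB] := affine_bounded z a nc.
exists (#|I| * M + B + M)%N; split.
- move=> dd X phi mphi.
  have -> : (fun x => chi (phi x)) = \sum_i (fun x =>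
      (phi x n <= affine (z i) (a i) n (phi x))%R%:R * c i (phi x)).
    by apply/funext => x; rewrite chiE fct_sumE.
  apply: (big_ind (measurable_fun setT)) => [|g h mg mh|i _].
  + exact: measurable_cst.
  + exact: measurable_funD.
  + apply: measurable_funM; last by case: (nc i) => mc _ _; exact: mc.
    apply: measurable_bool_natr; apply: measurable_fun_ler => //.
    exact: plot_measurable_affine.
- move=> y; rewrite chiE (le_trans (ler_norm_sum _ _ _))//.
  apply: (@le_trans _ _ (\sum_(i in I) M%:R)).
    apply: ler_sum => i _; rewrite normrM -[leRHS]mul1r ler_pM//.
      by rewrite normr_nat (ler_nat _ _ 1) leq_b1.
    by case: (nc i).
  by rewrite sumr_const -mulrnA ler_nat -addnA mulnC leq_addr.
- move=> y k kn yk; rewrite chiE.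
  have yM : M%:R <= `|y k| by rewrite (le_trans _ yk)// ler_nat leq_addl.
  have yB : B%:R <= `|y k| by rewrite (le_trans _ yk)// ler_nat -addnA addnCA leq_addr.
  have [all0|/existsP[i0 ci0]] := boolP [forall i, c i y == 0].
    by rewrite big1// => i _; rewrite (eqP (forallP all0 i)) mulr0.
  have := kn; rewrite ltnS leq_eqVlt => /predU1P[kE|kn']; last first.
    by rewrite big1// => i _; have [_ _ z0] := nc i; rewrite (z0 y k) ?mulr0.
  rewrite kE in yB.
  have bl i : `|affine (z i) (a i) n y| < B%:R by exact: HB ci0.
  have [y0|y0] := leP 0 (y n).
    rewrite big1// => i _; rewrite leNgt (_ : _ < _) ?mul0r//.
    apply: (le_lt_trans (ler_norm _)); apply: (lt_le_trans (bl i)).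
    by rewrite ger0_norm in yB.
  rewrite -[RHS](c0 y); apply: eq_bigr => i _.
  rewrite (_ : (_ <= _) = true) ?mul1r//.
  have := bl i; rewrite ltr_norml => /andP[+ _]; rewrite ltr0_norm// in yB.
  lra.
Qed.

Lemma itv_int_step (N : nat) (l : R) : `|l| <= N%:R ->
  itv_int (- N%:R) N%:R (fun x => (x <= l)%R%:R) = l + N%:R.
Proof.
rewrite ler_norml => /andP[l1 l2].
have bm : bounded_measurable (fun x : R => (x <= l)%R%:R).
  by apply: convex_pred_measurable => x y z xy yz _ zl; exact: le_trans zl.
rewrite (itv_int_cat l1 l2)//.
rewrite (eq_itv_int (g := fun=> 1)); last by move=> x /andP[_ ->].
rewrite [X in _ + X](eq_itv_int (g := fun=> 0)); last first.
  by move=> x /andP[lx _]; rewrite leNgt lx.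
by rewrite !itv_int_cst// mul0r addr0 mul1r opprK.
Qed.

Lemma int_coord_lattice_step n chi (I : finType) (z : I -> int) (a : I -> nat -> int)
    (c : I -> pt -> R) :
  (forall i, lattice_step n (c i)) -> (forall y, \sum_i c i y = 0) ->
  (exists M, tame n.+1 M chi) ->
  (forall y, chi y = \sum_i (y n <= affine (z i) (a i) n y)%R%:R * c i y) ->
  forall y, int_coord n chi y = \sum_i affine (z i) (a i) n y * c i y.
Proof.
move=> Gc c0 [M nchi] chiE y.
pose W := \sum_i `|affine (z i) (a i) n y|.
have W0 : 0 <= W by rewrite sumr_ge0.
pose N := maxn M (Num.bound W).
have lN i : `|affine (z i) (a i) n y| <= N%:R.
  apply: (@le_trans _ _ W); first by rewrite /W (bigD1 i)//= lerDl sumr_ge0.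
  by rewrite (le_trans (ltW (archi_boundP W0)))// ler_nat leq_maxr.
rewrite (int_coord_itv y (ltnSn n) (leq_maxl _ _ : (M <= N)%N) nchi).
rewrite (eq_itv_int (g := fun x => \sum_i c i y * (x <= affine (z i) (a i) n y)%R%:R)); last first.
  move=> x _; rewrite chiE; apply: eq_bigr => i _.
  by rewrite upd_same affine_upd// (lattice_step_upd _ _ (Gc i))// mulrC.
have bm l : bounded_measurable (fun x : R => (x <= l)%R%:R).
  by apply: convex_pred_measurable => x1 x2 x3 xy yz _ zl; exact: le_trans zl.
rewrite itv_int_sum; last by move=> i; exact: bounded_measurableZ.
transitivity (\sum_i (affine (z i) (a i) n y * c i y + N%:R * c i y)).
  by apply: eq_bigr => i _; rewrite itv_intZ// itv_int_step//; ring.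
by rewrite big_split/= -mulr_sumr c0 mulr0 addr0.
Qed.

End LatticeStep.

(** * Lattice sums of lattice step functions are integrals *)

Section SumIntegral.
Context {R : realType}.
Local Notation pt := (nat -> R).
Implicit Types (y : pt) (f g chi : pt -> R) (k n : nat).

(** Integrates out the coordinates from [k] to [k + j - 1], the last one first. *)
Fixpoint int_iter k j f : pt -> R := if j is j'.+1 then int_iter k j' (int_coord (k + j') f) else f.

Lemma int_iterS k j f : int_iter k j.+1 f = int_coord k (int_iter k.+1 j f).
Proof.
elim: j f => [|j IH] f; first by rewrite /= addn0.
by rewrite -[LHS]/(int_iter k j.+1 (int_coord (k + j.+1) f)) IH /= addSnnS.
Qed.

Lemma int_iter_tame k j f : (exists M, tame (k + j) M f) -> exists M, tame k M (int_iter k j f).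
Proof.
elim: j f => [|j IH] f /=; first by rewrite addn0.
rewrite addnS => -[M nf]; apply: IH; exists (M + M * (M + M))%N.
exact: int_coord_tame.
Qed.

Lemma int_coord_sum n (I : finType) (w : I -> R) (f : I -> pt -> R) :
  (forall i, exists M, tame n.+1 M (f i)) ->
  int_coord n (fun y => \sum_i w i * f i y) = fun y => \sum_i w i * int_coord n (f i) y.
Proof.
move=> nf; have [M Mf] := common_tame nf; have [N Ns] := tame_sum w nf.
apply/funext => y; rewrite (int_coord_itv _ (ltnSn n) (leq_maxl N M) Ns).
rewrite itv_int_sum; last first.
  by move=> i; apply: bounded_measurableZ; exact: tame_section (Mf i).
apply: eq_bigr => i _; rewrite itv_intZ; last exact: tame_section (Mf i).
by rewrite (int_coord_itv _ (ltnSn n) (leq_maxr N M) (Mf i)).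
Qed.

Lemma int_iter_sum k j (I : finType) (w : I -> R) (f : I -> pt -> R) :
  (forall i, exists M, tame (k + j) M (f i)) ->
  int_iter k j (fun y => \sum_i w i * f i y) = fun y => \sum_i w i * int_iter k j (f i) y.
Proof.
elim: j f => [|j IH] f // nf /=.
rewrite addnS in nf; rewrite int_coord_sum// IH// => i.
by have [M Mf] := nf i; exists (M + M * (M + M))%N; exact: int_coord_tame.
Qed.

(** [g] is the derivative of [f] in the direction [k], in integrated form: the
    functions at hand are absolutely continuous but not differentiable. *)
Definition deriv_along k f g := forall y s t, s <= t ->
  f (upd y k t) - f (upd y k s) = itv_int s t (fun u => g (upd y k u)).

(** Differentiation under the integral sign, which in integrated form is an
    exchange of two integrals over bounded intervals. *)
Lemma deriv_along_int_coord n k f g : (k < n)%N ->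
  (exists M, tame n.+1 M f) -> (exists M, tame n.+1 M g) ->
  deriv_along k f g -> deriv_along k (int_coord n f) (int_coord n g).
Proof.
move=> kn [M1 nf] [M2 ng] fg y s t st; pose M := maxn M1 M2.
have {}nf : tame n.+1 M f by apply: tame_le nf; exact: leq_maxl.
have {}ng : tame n.+1 M g by apply: tame_le ng; exact: leq_maxr.
have nk : n != k by rewrite gtn_eqF.
rewrite !(int_coord_itv _ (ltnSn n) (leqnn M) nf).
have -> : itv_int s t (fun u => int_coord n g (upd y k u)) =
  itv_int s t (fun u => itv_int (- M%:R) M%:R (fun x => g (upd (upd y k u) n x))).
  by apply: eq_itv_int => u _; rewrite (int_coord_itv _ (ltnSn n) (leqnn M) ng).
rewrite (@itv_int_swap _ (fun u x => g (upd (upd y k u) n x)) M%:R); last 2 first.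
- have [mg _ _] := ng; apply: mg => i.
  rewrite /upd; case: (i == n); first exact: measurable_snd.
  by case: (i == k) => //; exact: measurable_fst.
- by move=> u x; have [_ gM _] := ng; exact: gM.
have bf z := tame_section z n nf.
have -> : itv_int (- M%:R) M%:R (fun x => itv_int s t (fun u => g (upd (upd y k u) n x))) =
  itv_int (- M%:R) M%:R (fun x => f (upd (upd y k t) n x) + -1 * f (upd (upd y k s) n x)).
  apply: eq_itv_int => x _.
  rewrite mulN1r !(updC _ _ _ (_ : k != n)) 1?eq_sym// fg//.
  by apply: eq_itv_int => u _; rewrite updC// eq_sym.
rewrite itv_intD//; last exact: bounded_measurableZ.
by rewrite itv_intZ// mulN1r.
Qed.

Lemma deriv_along_int_iter k j f g :
  (exists M, tame (k.+1 + j) M f) -> (exists M, tame (k.+1 + j) M g) ->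
  deriv_along k f g -> deriv_along k (int_iter k.+1 j f) (int_iter k.+1 j g).
Proof.
elim: j f g => [//|j IH] f g nf ng fg /=.
rewrite !addnS in nf ng.
apply: IH.
- by have [M Mf] := nf; exists (M + M * (M + M))%N; exact: int_coord_tame.
- by have [M Mf] := ng; exists (M + M * (M + M))%N; exact: int_coord_tame.
- by apply: deriv_along_int_coord => //; rewrite ltnS leq_addr.
Qed.

(** The sum over all integer values of the coordinate [k], as soon as [M] exceeds
    the support of [f]. *)
Definition sum_coord M k f y := \sum_(i < M.*2) f (upd y k (i%:R - M%:R)).

(** The integers [t] with [t + s <= l] are the same for all [s] in ]0, 1] because
    [l] is an integer; at [s = 0] there is one more. *)
Lemma count_shift (M : nat) (l s : R) : l \is a Num.int -> `|l| < M%:R ->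
  0 < s <= 1 ->
  \sum_(i < M.*2) (i%:R - M%:R + s <= l)%R%:R = l + M%:R :> R.
Proof.
move=> /intrP[z ->] zM /andP[s0 s1].
have {}zM : (`|z| < M)%N.
  by move: zM; rewrite -intr_norm -[M%:R]/(M%:Z%:~R) ltr_int; lia.
pose m : nat := absz (z + M%:Z).
have mE : m%:Z = z + M%:Z by rewrite /m; lia.
have mR : (z%:~R + M%:R : R) = m%:R.
  by rewrite -[M%:R]/(M%:Z%:~R) -intrD -mE.
have mM : (m <= M.*2)%N by lia.
rewrite mR (bigID (fun i : 'I_(M.*2) => (i < m)%N))/= [X in _ + X]big1; last first.
  move=> i; rewrite -leqNgt => mi; rewrite leNgt (_ : _ < _)//.
  have : m%:R <= i%:R :> R by rewrite ler_nat.
  by move: mR s0; lra.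
rewrite addr0 (eq_bigr (fun=> 1)); last first.
  move=> i im; rewrite (_ : (_ <= _) = true)//.
  have : i.+1%:R <= m%:R :> R by rewrite ler_nat.
  by rewrite -natr1; move: mR s1; lra.
rewrite sumr_const; congr _%:R.
have wi : injective (widen_ord mM) by move=> i j /(congr1 val) /= /val_inj.
rewrite -[RHS]card_ord -(card_imset _ wi).
apply: eq_card => i; apply/idP/imsetP => /= [im|[j _ ->]] /=; last first.
  exact: (ltn_ord j).
by exists (Ordinal im) => //; apply/val_inj.
Qed.

(** On the fibre over a lattice point the function is a combination of half-line
    indicators with integer endpoints. Each of the counts drops by one as soon as
    the translation parameter leaves 0, but the weights sum to 0. *)
Lemma shift_base k chi : lattice_step k.+1 chi ->
  exists M0, forall M, (M0 <= M)%N -> forall y, (forall i, (i < k)%N -> y i \is a Num.int) ->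
    forall s, 0 <= s <= 1 ->
    \sum_(i < M.*2) chi (upd y k (i%:R - M%:R + s)) = sum_coord M k chi y.
Proof.
move=> [I [z [a [c [Gc c0 chiE _]]]]].
have [N nc] := common_tame (fun i => lattice_step_tame (Gc i)).
have [B HB] := affine_bounded z a nc.
exists B.+1 => M BM y yint s /andP[s0 s1].
have E t : chi (upd y k t) = \sum_i (t <= affine (z i) (a i) k y)%R%:R * c i y.
  rewrite chiE; apply: eq_bigr => i _.
  by rewrite upd_same affine_upd// (lattice_step_upd _ _ (Gc i)).
rewrite /sum_coord; under eq_bigr do rewrite E.
under [RHS]eq_bigr do rewrite E.
rewrite exchange_big [RHS]exchange_big/=.
under eq_bigr do rewrite -mulr_suml.
under [RHS]eq_bigr do rewrite -mulr_suml.
move: s0; rewrite le_eqVlt => /predU1P[<-|s0].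
  by apply: eq_bigr => i _; congr (_ * _); apply: eq_bigr => j _; rewrite addr0.
transitivity (\sum_i (affine (z i) (a i) k y + M%:R) * c i y).
  apply: eq_bigr => i _.
  have [->|ci] := eqVneq (c i y) 0; first by rewrite !mulr0.
  rewrite count_shift ?s0//; first exact: affine_int.
  apply: lt_le_trans (HB _ _ i ci) _; rewrite ler_nat; exact: ltnW.
(* Adding the zero sum of the weights turns each count for a positive shift into
   the count for the shift 0. *)
transitivity (\sum_i (affine (z i) (a i) k y + M%:R) * c i y + \sum_i c i y).
  by rewrite c0 addr0.
rewrite -big_split/=; apply: eq_bigr => i _.
have [->|ci] := eqVneq (c i y) 0; first by rewrite !mulr0 addr0.
have lB := HB _ _ i ci.
rewrite -[X in _ + X]mul1r -mulrDl; congr (_ * _).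
rewrite addrAC -(@count_shift M (affine (z i) (a i) k y + 1) 1); last 3 first.
- by apply: rpredD; [exact: affine_int | exact: rpred1].
- apply: le_lt_trans (ler_normD _ _) _; rewrite normr1.
  apply: (@lt_le_trans _ _ B.+1%:R); last by rewrite ler_nat.
  by rewrite -natr1 ltrD2r.
- by rewrite ltr01 lexx.
by apply: eq_bigr => j _; rewrite lerD2r.
Qed.

Lemma sum_shift_telescope (M : nat) (F : R -> R) : F (M%:R) = 0 -> F (- M%:R) = 0 ->
  \sum_(i < M.*2) F (i%:R - M%:R + 1) = \sum_(i < M.*2) F (i%:R - M%:R).
Proof.
move=> FM FM'; pose G (i : nat) := F (i%:R - M%:R).
have e : \sum_(i < M.*2.+1) G i = \sum_(i < M.*2) G i.
  by rewrite big_ord_recr/= /G -addnn natrD addrK FM addr0.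
rewrite -[RHS]e big_ord_recl /G /= sub0r FM' add0r; apply: eq_bigr => i _.
by rewrite /bump leq0n add1n -natr1; congr F; ring.
Qed.

Lemma itv_int_shift (x s : R) (g : R -> R) : 0 <= s -> bounded_measurable g ->
  itv_int x (x + s) g = itv_int 0 s (fun u => g (x + u)).
Proof.
move=> s0 bg; have := @itv_int_affine R 1 x ltr01 0 s g s0 bg.
rewrite !mul1r add0r [s + x]addrC => <-.
by apply: eq_itv_int => u _; rewrite mul1r addrC.
Qed.

(** The sum over the translate of Z by [s] of the function obtained by integrating
    out the later coordinates does not depend on [s]. Its derivative in [s] is, by
    the derivative clause of lattice step functions, a combination of the same sums
    for the weights, which have one coordinate less and are independent of [s] by
    induction. So the sum is affine in [s], and its values at 0 and 1 agree. *)
Lemma shift_invariance j k chi : lattice_step (k.+1 + j) chi ->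
  exists M0, forall M, (M0 <= M)%N -> forall y, (forall i, (i < k)%N -> y i \is a Num.int) ->
    forall s, 0 <= s <= 1 ->
    \sum_(i < M.*2) int_iter k.+1 j chi (upd y k (i%:R - M%:R + s)) =
    sum_coord M k (int_iter k.+1 j chi) y.
Proof.
elim: j chi => [|j IH] chi; first by rewrite addn0; exact: shift_base.
move=> Gchi; have [M1 nF] := int_iter_tame (lattice_step_tame Gchi).
have nchi := lattice_step_tame Gchi.
move: Gchi nchi; rewrite addnS => -[I [z [a [c [Gc' c0 chiE hdef]]]]] nchi.
have Gc i : lattice_step (k.+1 + j) (c i) := Gc' i.
have nc i := lattice_step_tame (Gc i).
have [M2 H2] : exists M2, forall i, forall M, (M2 <= M)%N ->
    forall y, (forall i, (i < k)%N -> y i \is a Num.int) -> forall s, 0 <= s <= 1 ->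
    \sum_(i0 < M.*2) int_iter k.+1 j (c i) (upd y k (i0%:R - M%:R + s)) =
    sum_coord M k (int_iter k.+1 j (c i)) y.
  have /choice[m mP] := fun i => IH _ (Gc i).
  exists (\max_i m i) => i M mM; apply: mP; apply: leq_trans mM.
  exact: leq_bigmax.
exists (maxn M1 M2) => M; rewrite geq_max => /andP[M1M M2M] y yint.
pose F := int_iter k.+1 j.+1 chi; rewrite -/F.
pose g y := \sum_i (a i k)%:~R * c i y.
have ng : exists M, tame (k.+1 + j) M g by exact: tame_sum.
(* [h] is the height of [chi] and [g] its derivative in the direction [k]. *)
pose h := int_coord (k.+1 + j) chi.
have nh : exists M, tame (k.+1 + j) M h.
  by have [N /int_coord_tame] := nchi; exists (N + N * (N + N))%N.
have hg : deriv_along k h g.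
  move=> y' s t st; rewrite /h !(int_coord_lattice_step Gc c0 nchi chiE).
  by rewrite hdef//; rewrite ltn_addr.
have FG := deriv_along_int_iter nh ng hg.
rewrite -[int_iter k.+1 j h]/F in FG.
pose G := int_iter k.+1 j g; rewrite -/G in FG.
have GE : G = fun y => \sum_i (a i k)%:~R * int_iter k.+1 j (c i) y by exact: int_iter_sum.
have [MG nG] : exists M, tame k.+1 M G by exact: int_iter_tame.
pose C := \sum_i (a i k)%:~R * sum_coord M k (int_iter k.+1 j (c i)) y.
have GC u : 0 <= u <= 1 -> \sum_(i < M.*2) G (upd y k (i%:R - M%:R + u)) = C.
  move=> u01; rewrite GE exchange_big/= /C; apply: eq_bigr => i _.
  by rewrite -mulr_sumr H2.
have bG y' : bounded_measurable (fun u => G (upd y' k u)) by exact: tame_section nG.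
have HC s : 0 <= s <= 1 ->
    \sum_(i < M.*2) F (upd y k (i%:R - M%:R + s)) - sum_coord M k F y = C * s.
  move=> /andP[s0 s1]; rewrite /sum_coord -sumrB.
  transitivity (\sum_(i < M.*2) itv_int 0 s (fun u => G (upd y k (i%:R - M%:R + u)))).
    apply: eq_bigr => i _; rewrite FG ?lerDl//.
    exact: (@itv_int_shift _ _ (fun u => G (upd y k u))).
  rewrite -itv_int_sum; last first.
    move=> i; have := @bounded_measurable_affine R _ 1 (i%:R - M%:R) (bG y).
    by congr bounded_measurable; apply/funext => u; rewrite mul1r addrC.
  rewrite -[s in RHS]subr0 -itv_int_cst//; apply: eq_itv_int => u /andP[u0 us].
  by rewrite GC// ltW//= (le_trans us).
(* Comparing the shifts 0 and 1: the terms of the sum only move by one place. *)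
have C0 : C = 0.
  have := HC 1; rewrite ler01 lexx => /(_ isT); rewrite mulr1 => <-.
  apply/eqP; rewrite subr_eq0; apply/eqP.
  have [_ _ F0] := nF.
  apply: (@sum_shift_telescope M (fun x => F (upd y k x))).
    by apply: (F0 _ k) => //; rewrite upd_same normr_nat ler_nat.
  by apply: (F0 _ k) => //; rewrite upd_same normrN normr_nat ler_nat.
by move=> s s01; apply/eqP; rewrite -subr_eq0 HC// C0 mul0r.
Qed.

Fixpoint sum_iter M k j f : pt -> R :=
  if j is j'.+1 then sum_coord M k (sum_iter M k.+1 j' f) else f.

Lemma itv_int_chunks (M : nat) (g : R -> R) : bounded_measurable g ->
  itv_int (- M%:R) M%:R g =
  itv_int 0 1 (fun u => \sum_(i < M.*2) g (i%:R - M%:R + u)).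
Proof.
move=> bg.
have bgs (i : nat) : bounded_measurable (fun u => g (i%:R - M%:R + u)).
  have := @bounded_measurable_affine R _ 1 (i%:R - M%:R) bg.
  by congr bounded_measurable; apply/funext => u; rewrite mul1r addrC.
rewrite itv_int_sum//.
under eq_bigr => i _ do rewrite -itv_int_shift//.
(* The right endpoint is written so that the induction on the number of unit
   intervals applies. *)
have -> : itv_int (- M%:R) M%:R g = itv_int (- M%:R) (M.*2%:R - M%:R) g.
  by rewrite -addnn natrD addrK.
elim: M.*2 => [|n IH]; first by rewrite big_ord0 sub0r /itv_int set_itv_ge ?Rintegral_set0// bnd_simp ltxx.
rewrite big_ord_recr/= -IH -natr1 (_ : n%:R + 1 - M%:R = n%:R - M%:R + 1); last by ring.
by apply: itv_int_cat => //; rewrite ?lerDr ?lerDl.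
Qed.

(** The integral over a coordinate is the mean over [s] in [0, 1] of the sums over
    the translates of Z by [s]; all these sums are equal, so one integration can be
    replaced by a summation. This is applied from the first coordinate to the last,
    and therefore the earlier coordinates of [y] may be taken to be integers. *)
Lemma lattice_sum_integral_from n chi : lattice_step n chi ->
  forall j k, (k + j = n)%N ->
  exists M0, forall M, (M0 <= M)%N -> forall y, (forall i, (i < k)%N -> y i \is a Num.int) ->
    int_iter k j chi y = sum_iter M k j chi y.
Proof.
move=> Gchi; elim=> [|j IH] k kn; first by exists 0%N.
rewrite -addSnnS in kn; have [M1 H1] := IH k.+1 kn.
have := Gchi; rewrite -kn => Gk; have [M2 H2] := shift_invariance Gk.
have [M3 nF] := int_iter_tame (lattice_step_tame Gk).
exists (maxn M1 (maxn M2 M3)) => M; rewrite !geq_max => /and3P[M1M M2M M3M] y yint.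
rewrite int_iterS (int_coord_itv y (ltnSn k) M3M nF) itv_int_chunks; last exact: tame_section nF.
transitivity (sum_coord M k (int_iter k.+1 j chi) y).
  rewrite -[RHS]mulr1 -[1 in RHS]subr0 -itv_int_cst//; apply: eq_itv_int => u /andP[u0 u1].
  by rewrite (H2 M M2M)// ltW.
apply: eq_bigr => i _; apply: H1 => // l; rewrite ltnS leq_eqVlt => /predU1P[->|lk].
  by rewrite upd_same; apply: rpredB; exact: natr_int.
by rewrite upd_neq ?ltn_eqF// yint.
Qed.

Theorem lattice_sum_integral n chi y : lattice_step n chi ->
  exists M0, forall M, (M0 <= M)%N -> int_iter 0 n chi y = sum_iter M 0 n chi y.
Proof.
move=> Gchi; have [M0 H] := lattice_sum_integral_from Gchi (add0n n).
by exists M0 => M MM; apply: H.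
Qed.

End SumIntegral.

(** * Dilations, and Lebesgue measure as an iterated integral *)

Section Scaling.
Context {R : realType}.
Notation mu := (@lebesgue_measure R).
Local Notation pt := (nat -> R).
Implicit Types (y : pt) (f chi : pt -> R) (k n : nat).

Definition scale_pt (r : R) y : pt := fun j => r * y j.

Lemma scale_upd r y k x : scale_pt r (upd y k x) = upd (scale_pt r y) k (r * x).
Proof. by apply/funext => j; rewrite /scale_pt /upd; case: (j == k). Qed.

(** The dilation by an integer [m] multiplies the constant terms of the affine
    functions by [m] and leaves their slopes alone, so they stay integral. *)
Lemma lattice_step_scale n chi (m : nat) : (0 < m)%N -> lattice_step n chi ->
  lattice_step n (chi \o scale_pt m%:R^-1).
Proof.
move=> m0; have mR : 0 < m%:R :> R by rewrite ltr0n.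
have mR0 : m%:R != 0 :> R by rewrite gt_eqF.
elim: n chi => [|n IH] chi /=; first by move=> [c ->]; exists c.
move=> [I [z [a [c [Gc c0 chiE hdef]]]]].
exists I, (fun i => z i * m%:Z), a, (fun i => c i \o scale_pt m%:R^-1).
have affE i y : affine (z i * m%:Z) (a i) n y =
    m%:R * affine (z i) (a i) n (scale_pt m%:R^-1 y).
  rewrite /affine intrM mulrDr mulrC mulr_sumr; congr (_ + _).
  by apply: eq_bigr => j _; rewrite /scale_pt; field.
split=> [i|y|y|].
- exact: IH.
- exact: c0.
- rewrite chiE; apply: eq_bigr => i _ /=.
  by rewrite affE /scale_pt ler_pdivrMl.
move=> k y s t kn st.
transitivity (m%:R * (\sum_i affine (z i) (a i) n (upd (scale_pt m%:R^-1 y) k (m%:R^-1 * t))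
     * c i (upd (scale_pt m%:R^-1 y) k (m%:R^-1 * t)) -
   \sum_i affine (z i) (a i) n (upd (scale_pt m%:R^-1 y) k (m%:R^-1 * s))
     * c i (upd (scale_pt m%:R^-1 y) k (m%:R^-1 * s)))).
  rewrite mulrBr !mulr_sumr; congr (_ - _); apply: eq_bigr => i _.
    by rewrite affE /= scale_upd mulrA.
  by rewrite affE /= scale_upd mulrA.
have st' : m%:R^-1 * s <= m%:R^-1 * t by rewrite ler_pM2l// invr_gt0.
rewrite hdef//.
pose G u := \sum_i (a i k)%:~R * c i (upd (scale_pt m%:R^-1 y) k (m%:R^-1 * u)).
have bG : bounded_measurable G.
  apply: bounded_measurable_sum => i; apply: bounded_measurableZ.
  have [M nc] := lattice_step_tame (Gc i).
  have := @bounded_measurable_affine R _ m%:R^-1 0 (tame_section (scale_pt m%:R^-1 y) k nc).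
  by congr bounded_measurable; apply/funext => u; rewrite addr0.
transitivity (itv_int s t G); last first.
  by apply: eq_itv_int => u _; apply: eq_bigr => i _; rewrite /= scale_upd.
have := @itv_int_affine R m%:R 0 mR _ _ G st' bG.
rewrite !addr0 !mulrA !divff// !mul1r => <-; congr (_ * _).
apply: eq_itv_int => u _; apply: eq_bigr => i _.
by rewrite addr0 mulrA mulVf// mul1r.
Qed.

Lemma int_coord_scale n (r : R) f y : 0 < r -> (exists M, tame n.+1 M f) ->
  int_coord n (f \o scale_pt r^-1) y = r * int_coord n f (scale_pt r^-1 y).
Proof.
move=> r0 [M nf].
have rV : 0 < r^-1 by rewrite invr_gt0.
have M2 : - M%:R <= M%:R :> R by rewrite (@le_trans _ _ 0)// oppr_le0.
rewrite (int_coord_itv _ (ltnSn n) (leqnn M) nf).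
have := @itv_int_affine R r^-1 0 rV (r * - M%:R) (r * M%:R)
  (fun x => f (upd (scale_pt r^-1 y) n x)).
rewrite !addr0 !mulrA !mulVf ?gt_eqF// !mul1r => <-; last 2 first.
- by rewrite ler_pM2l.
- exact: tame_section nf.
rewrite mulrA divff ?gt_eqF// mul1r.
rewrite /int_coord (@itv_int_setT _ (r * - M%:R) (r * M%:R)); last first.
  move=> x xM; have [_ _ f0] := nf; apply: (f0 _ n) => //.
  rewrite /= scale_upd upd_same normrM (gtr0_norm rV).
  rewrite -ler_pdivrMl// invrK leNgt; apply: contra xM.
  by rewrite ltr_norml => /andP[x1 x2]; rewrite mulrN x1/= ltW.
by apply: eq_itv_int => x _; rewrite /= scale_upd addr0.
Qed.

Lemma tame_scale n (r : R) f : 0 < r -> (exists M, tame n M f) ->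
  exists M, tame n M (f \o scale_pt r^-1).
Proof.
move=> r0 [M [mf fM f0]].
exists (M + Num.bound (r * M%:R))%N; split.
- move=> dd X phi mphi; apply: (mf _ _ (fun x => scale_pt r^-1 (phi x))) => j.
  by apply: measurable_funM.
- by move=> y; rewrite (le_trans (fM _))// ler_nat leq_addr.
- move=> y k kn yk; apply: (f0 _ k) => //.
  rewrite /scale_pt normrM (@gtr0_norm _ r^-1) ?invr_gt0//.
  rewrite ler_pdivlMl// (le_trans _ yk)// natrD.
  have rM0 : 0 <= r * M%:R by rewrite mulr_ge0// ltW.
  by rewrite (le_trans (ltW (archi_boundP rM0)))// lerDr.
Qed.

Lemma int_iter_scale n k (r : R) f y : 0 < r -> (exists M, tame (k + n) M f) ->
  int_iter k n (f \o scale_pt r^-1) y = r ^+ n * int_iter k n f (scale_pt r^-1 y).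
Proof.
move=> r0; elim: n f => [|n IH] f nf; first by rewrite expr0 mul1r.
rewrite addnS in nf; rewrite /=.
have -> : int_coord (k + n) (f \o scale_pt r^-1) =
   (fun y => \sum_(i < 1) r * (int_coord (k + n) f \o scale_pt r^-1) y).
  by apply/funext => y'; rewrite int_coord_scale// big_ord1.
have nJ : exists M, tame (k + n) M (int_coord (k + n) f).
  by have [N /int_coord_tame] := nf; exists (N + N * (N + N))%N.
rewrite (@int_iter_sum _ k n _ (fun=> r) (fun=> int_coord (k + n) f \o scale_pt r^-1)); last first.
  by move=> _; exact: tame_scale.
by rewrite big_ord1 IH// mulrA -exprS.
Qed.

Definition tuple_pt n (t : n.-tuple (measurableTypeR R)) : pt := fun j => nth (0 : R) t j.

Lemma tuple_pt_snoc n (t : n.-tuple (measurableTypeR R)) x :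
  tuple_pt (tuple_snoc (t, x)) = upd (tuple_pt t) n x.
Proof.
apply/funext => j; rewrite /tuple_pt /tuple_snoc /upd /= nth_rcons size_tuple.
case: ltngtP => // jn; rewrite nth_default// size_tuple ltnW//.
Qed.

Lemma measurable_tuple_pt n j :
  measurable_fun setT (fun t : n.-tuple (measurableTypeR R) => tuple_pt t j).
Proof.
have [jn|nj] := ltnP j n.
  rewrite (_ : (fun _ => _) = fun t : n.-tuple (measurableTypeR R) => tnth t (Ordinal jn)).
    exact: measurable_tnth.
  by apply/funext => t; rewrite (tnth_nth 0).
rewrite (_ : (fun _ => _) = fun=> 0); first exact: measurable_cst.
by apply/funext => t; rewrite /tuple_pt nth_default// size_tuple.
Qed.

Lemma tame_integrable n M f y : tame n.+1 M f ->
  mu.-integrable setT (EFin \o (fun x => f (upd y n x))).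
Proof.
move=> nf; have [_ _ f0] := nf.
have := bounded_measurable_integrable (- M%:R) M%:R (tame_section y n nf).
move=> /integrable_mkcond => /(_ (measurable_itv _)).
congr integrable; apply/funext => x; rewrite patchE; case: ifPn => // xM.
rewrite /= (f0 _ n)// upd_same leNgt; apply: contra xM.
by rewrite ltr_norml inE /= in_itv/= => /andP[-> /ltW].
Qed.

(** Tonelli, one coordinate at a time. *)
Lemma integral_lebesgue_tuple n f : (exists M, tame n M f) -> (forall y, 0 <= f y) ->
  (\int[lebesgue_tuple n]_t (f (tuple_pt t))%:E = (int_iter 0 n f (fun=> 0))%:E)%E.
Proof.
elim: n f => [|n IH] f nf f0.
  rewrite /= integral_dirac//; last first.
    have [M [mf _ _]] := nf; apply/measurable_EFinP; apply: mf => j.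
    exact: measurable_tuple_pt.
  rewrite diracT mul1e; congr (f _)%:E; apply/funext => j.
  by rewrite /tuple_pt nth_default.
have [M nfM] := nf; have [mf _ _] := nfM.
have mft : measurable_fun setT (fun t : n.+1.-tuple (measurableTypeR R) => (f (tuple_pt t))%:E).
  by apply/measurable_EFinP; apply: mf => j; exact: measurable_tuple_pt.
transitivity (\int[lebesgue_tuple n \x mu]_p (f (tuple_pt (tuple_snoc p)))%:E)%E.
  have := @ge0_integral_pushforward _ _ _ _ R _ (@measurable_tuple_snoc R n)
    (lebesgue_tuple n \x mu)%E setT _ measurableT mft.
  by rewrite preimage_setT /=; apply => t _; rewrite lee_fin.
rewrite fubini_tonelli1; last 2 first.
- exact: (measurableT_comp mft (@measurable_tuple_snoc R n)).
- by move=> p; rewrite lee_fin.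
have nJ := int_coord_tame nfM.
rewrite /= -IH; last 2 first.
- by exists (M + M * (M + M))%N.
- by move=> y; apply: Rintegral_ge0.
apply: eq_integral => t _; rewrite /fubini_F /int_coord /Rintegral fineK.
  by apply: eq_integral => x _; rewrite tuple_pt_snoc.
apply: integrable_fin_num => //.
exact: tame_integrable nfM.
Qed.

Definition ind_set n (A : set 'rV[R]_n) : pt -> R :=
  fun y => (`[< A (\row_i y i) >])%:R.

Lemma Vol_int_iter n (A : set 'rV[R]_n) : (exists M, tame n M (ind_set A)) ->
  Vol A = (int_iter 0 n (ind_set A) (fun=> 0))%:E.
Proof.
move=> nA; rewrite -integral_lebesgue_tuple//.
rewrite /Vol; set S := [set t | _].
have SE t : S t = A (\row_i tuple_pt t i).
  rewrite /S /=; congr A; apply/rowP => i; rewrite !mxE.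
  by rewrite (tnth_nth 0).
have mS : measurable S.
  have [M [mA _ _]] := nA.
  have mf : measurable_fun setT (fun t : n.-tuple (measurableTypeR R) => ind_set A (tuple_pt t)).
    by apply: mA => j; exact: measurable_tuple_pt.
  have := mf measurableT [set 1] (measurable_set1 1); rewrite setTI.
  congr measurable; apply/seteqP; split=> t /=; rewrite /ind_set SE.
    case: asboolP => // _ /eqP; rewrite eq_sym oner_eq0//.
  by move=> At; case: asboolP.
rewrite -[S in LHS]setIT -integral_indic//; apply: eq_integral => t _.
by rewrite indicE /ind_set -SE; congr (_%:R%:E); apply/idP/asboolP; rewrite inE.
Qed.

End Scaling.

(** * Farkas lemma and convex hulls of finite families *)

Section Farkas.
Context {R : realFieldType}.

(** Bartl's induction on the number of generators. If the hypothesis holds without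
    [w 0], that vector gets the coefficient 0. Otherwise some [l0] is nonnegative on
    the other generators and negative on [b] and on [w 0]; projecting along [w 0] to
    the hyperplane where [l0] vanishes gives an instance with one generator less. *)
Lemma farkas m n (w : 'I_m -> 'rV[R]_n) (b : 'rV[R]_n) :
  (forall l : 'cV[R]_n, (forall i, 0 <= (w i *m l) 0 0) -> 0 <= (b *m l) 0 0) ->
  exists2 c : 'I_m -> R, forall i, 0 <= c i & b = \sum_i c i *: w i.
Proof.
have subE (A B : 'M[R]_1) : (A - B) 0 0 = A 0 0 - B 0 0 by rewrite !mxE.
have scE k (A : 'M[R]_1) : (k *: A) 0 0 = k * A 0 0 by rewrite mxE.
elim: m w b => [|m IH] w b H.
  exists (fun=> 0) => //; rewrite big_ord0; apply/rowP => j; rewrite mxE.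
  have Hb (s : R) : 0 <= s * b 0 j.
    have := H (s *: delta_mx j 0); rewrite -scalemxAr -colE !mxE; apply.
    by case.
  have := Hb (-1); rewrite mulN1r oppr_ge0 => b0.
  by have := Hb 1; rewrite mul1r => b1; apply/eqP; rewrite eq_le b0.
pose w0 := w ord0; pose w' i := w (lift ord0 i).
have [Hw|] := pselect (forall l : 'cV[R]_n, (forall i, 0 <= (w' i *m l) 0 0) -> 0 <= (b *m l) 0 0).
  have [c c0 bE] := IH w' b Hw.
  exists (fun i => oapp c 0 (unlift ord0 i)) => [i|]; first by case: unliftP => /=.
  rewrite big_ord_recl unlift_none scale0r add0r bE.
  by apply: eq_bigr => i _; rewrite liftK.
move=> /existsNP[l0 /not_implyP[l0w /negP]]; rewrite -ltNge => bl0.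
have w0l0 : (w0 *m l0) 0 0 < 0.
  rewrite ltNge; apply/negP => h; move: bl0; rewrite ltNge; case/negP.
  apply: H => i; case: (unliftP ord0 i) => [j|] ->; [exact: l0w | exact: h].
pose s := (w0 *m l0) 0 0.
(* Projections along [w0] to the kernel of [l0]. *)
pose w1 i := w' i - ((w' i *m l0) 0 0 / s) *: w0.
pose b1 := b - ((b *m l0) 0 0 / s) *: w0.
have s0 : s != 0 by rewrite lt_eqF.
have key u l : ((u - ((u *m l0) 0 0 / s) *: w0) *m l) 0 0 =
    (u *m (l - ((w0 *m l) 0 0 / s) *: l0)) 0 0.
  rewrite mulmxBl mulmxBr -scalemxAl -scalemxAr !subE !scE; congr (_ - _).
  by rewrite mulrAC [RHS]mulrAC; congr (_ / _); rewrite mulrC.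
have [] := IH w1 b1.
  move=> l Hl; rewrite /b1 key; apply: H => i.
  case: (unliftP ord0 i) => [j|] ->; first by rewrite -key; exact: Hl.
  rewrite mulmxBr -scalemxAr subE scE -/w0 -/s.
  by rewrite divfK// subrr.
move=> c c0 b1E.
exists (fun i => oapp c ((b *m l0) 0 0 / s - \sum_j c j * ((w' j *m l0) 0 0 / s)) (unlift ord0 i)).
  move=> i; case: unliftP => [j _ /=|_ /=]; first exact: c0.
  rewrite subr_ge0; apply: (@le_trans _ _ 0).
    apply: sumr_le0 => j _; rewrite mulr_ge0_le0// mulr_ge0_le0 ?l0w// invr_le0.
    exact: ltW.
  by rewrite mulr_le0// ?ltW// invr_lt0.
rewrite big_ord_recl unlift_none /= -/w0.
rewrite [X in _ = _ + X](eq_bigr (fun i => c i *: w' i)); last first.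
  by move=> i _; rewrite liftK.
transitivity (b1 + ((b *m l0) 0 0 / s) *: w0); first by rewrite /b1 subrK.
rewrite b1E /w1.
transitivity (\sum_i (c i *: w' i - (c i * ((w' i *m l0) 0 0 / s)) *: w0) + ((b *m l0) 0 0 / s) *: w0).
  by congr (_ + _); apply: eq_bigr => i _; rewrite scalerBr scalerA.
by rewrite sumrB scalerBl scaler_suml [RHS]addrC [RHS]addrA addrAC.
Qed.

End Farkas.

Section Hulls.
Context {R : realType}.
Implicit Types d : nat.

(** Sets of vertices are handled as sets of indices of one fixed family, so that
    faces of a polytope and their projections share their index sets. *)
Definition points_of N d (v : 'I_N -> 'rV[R]_d) (U : {set 'I_N}) : set 'rV[R]_d :=
  [set v i | i in [set i | i \in U]].

(** The predicate [Q] covers convex and affine combinations at once. *)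
Lemma gather_weights (Q : R -> Prop) N d (v : 'I_N -> 'rV[R]_d) (U : {set 'I_N}) x :
  Q 0 -> (forall a b, Q a -> Q b -> Q (a + b)) ->
  (exists n (p : 'I_n -> 'rV[R]_d) (c : 'I_n -> R),
    [/\ forall i, points_of v U (p i), forall i, Q (c i), \sum_i c i = 1
      & x = \sum_i c i *: p i]) <->
  exists c : 'I_N -> R,
    [/\ forall i, Q (c i), forall i, i \notin U -> c i = 0, \sum_i c i = 1
      & x = \sum_i c i *: v i].
Proof.
move=> Q0 QD; split=> [[n [p [c [pU Qc c1 xE]]]]|[c [Qc cU c1 xE]]].
  have /choice[f fP] : forall j, exists i, i \in U /\ v i = p j.
    by move=> j; have [i /= iU vi] := pU j; exists i.
  exists (fun i => \sum_(j | f j == i) c j); split.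
  - by move=> i; apply: big_ind.
  - move=> i iU; rewrite big1// => j /eqP fj; move: iU.
    by rewrite -fj (fP j).1.
  - by rewrite -c1 [RHS](partition_big f xpredT).
  - rewrite xE (partition_big f xpredT)//=; apply: eq_bigr => i _.
    rewrite scaler_suml; apply: eq_bigr => j /eqP <-.
    by rewrite (fP j).2.
exists #|U|, (fun k => v (enum_val k)), (fun k => c (enum_val k)); split=> //.
- by move=> k; exists (enum_val k) => //=; exact: enum_valP.
- rewrite -c1 (bigID (mem U))/= [X in _ = _ + X]big1 ?addr0; last exact: cU.
  by rewrite (big_enum_val c).
- rewrite xE (bigID (mem U))/= [X in _ + X = _]big1 ?addr0; last first.
    by move=> i /cU ->; rewrite scale0r.
  by rewrite (big_enum_val (fun i => c i *: v i)).
Qed.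

Lemma convP N d (v : 'I_N -> 'rV[R]_d) (U : {set 'I_N}) x :
  conv (points_of v U) x <-> exists c : 'I_N -> R,
    [/\ forall i, 0 <= c i, forall i, i \notin U -> c i = 0, \sum_i c i = 1
      & x = \sum_i c i *: v i].
Proof. by apply: (gather_weights (Q := fun a => 0 <= a)) => // a b; exact: addr_ge0. Qed.

Lemma affP N d (v : 'I_N -> 'rV[R]_d) (U : {set 'I_N}) x :
  aff (points_of v U) x <-> exists c : 'I_N -> R,
    [/\ forall i, i \notin U -> c i = 0, \sum_i c i = 1
      & x = \sum_i c i *: v i].
Proof.
have [H1 H2] := @gather_weights (fun=> True) N d v U x I (fun _ _ _ _ => I).
split=> [[n [p [c [pU c1 xE]]]]|[c [cU c1 xE]]].
  by have [|c' [_ ? ? ?]] := H1; [exists n, p, c | exists c'].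
by have [|n [p [c' [? _ ? ?]]]] := H2; [exists c | exists n, p, c'].
Qed.

Lemma sub_conv d (A : set 'rV[R]_d) : A `<=` conv A.
Proof.
move=> x Ax; exists 1%N, (fun=> x), (fun=> 1); split=> //.
  by rewrite big_ord1.
by rewrite big_ord1 scale1r.
Qed.

Lemma convS d (A B : set 'rV[R]_d) : A `<=` B -> conv A `<=` conv B.
Proof.
by move=> AB x [n [p [c [pA c0 c1 xE]]]]; exists n, p, c; split=> // i; exact: AB.
Qed.

Lemma conv_convex d (A : set 'rV[R]_d) x y t : conv A x -> conv A y ->
  0 <= t <= 1 -> conv A (t *: x + (1 - t) *: y).
Proof.
move=> [n [p [c [pA c0 c1 ->]]]] [m [q [e [qA e0 e1 ->]]]] /andP[t0 t1].
have sl i : fintype.split (lshift m i) = inl i := unsplitK (inl i).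
have sr i : fintype.split (rshift n i) = inr i := unsplitK (inr i).
exists (n + m)%N,
  (fun i => match fintype.split i with inl j => p j | inr j => q j end),
  (fun i => match fintype.split i with inl j => t * c j | inr j => (1 - t) * e j end).
split.
- by move=> i; case: (fintype.split i).
- by move=> i; case: (fintype.split i) => j; rewrite mulr_ge0// subr_ge0.
- rewrite big_split_ord/=.
  under eq_bigr => i _ do rewrite sl.
  under [X in _ + X]eq_bigr => i _ do rewrite sr.
  by rewrite -!mulr_sumr c1 e1; ring.
- rewrite big_split_ord/=.
  under [in RHS]eq_bigr => i _ do rewrite sl -scalerA.
  under [X in _ = _ + X]eq_bigr => i _ do rewrite sr -scalerA.
  by rewrite !scaler_sumr.
Qed.

Lemma conv_idem_coef d (A : set 'rV[R]_d) n (p : 'I_n -> 'rV[R]_d) (c : 'I_n -> R) :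
  (forall i, conv A (p i)) -> (forall i, 0 <= c i) -> \sum_i c i = 1 ->
  conv A (\sum_i c i *: p i).
Proof.
elim: n p c => [|n IH] p c pA c0; first by rewrite big_ord0 => /eqP; rewrite eq_sym oner_eq0.
rewrite !big_ord_recl /= => c1.
have [E|nE] := eqVneq (c ord0) 1.
  have s0 : \sum_(i < n) c (lift ord0 i) = 0 by move: c1; rewrite E; lra.
  have c0' i : c (lift ord0 i) = 0.
    by apply/eqP; move: s0 => /eqP; rewrite psumr_eq0// => /allP; apply; rewrite mem_index_enum.
  rewrite big1 ?addr0 ?E ?scale1r// => i _.
  by rewrite c0' scale0r.
have c01 : 1 - c ord0 != 0 by rewrite subr_eq0 eq_sym.
have cl1 : c ord0 <= 1.
  by rewrite -c1 lerDl sumr_ge0.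
have := IH (fun i => p (lift ord0 i)) (fun i => c (lift ord0 i) / (1 - c ord0)).
have -> : \sum_(i < n) c (lift ord0 i) / (1 - c ord0) *: p (lift ord0 i) =
  (1 - c ord0)^-1 *: \sum_(i < n) c (lift ord0 i) *: p (lift ord0 i).
  by rewrite scaler_sumr; apply: eq_bigr => i _; rewrite scalerA mulrC.
rewrite -mulr_suml => H.
have {}H : conv A ((1 - c ord0)^-1 *: \sum_(i < n) c (lift ord0 i) *: p (lift ord0 i)).
  apply: H => [i|i|]; first exact: pA.
    by rewrite divr_ge0// subr_ge0.
  by rewrite (_ : \sum_(i < n) _ = 1 - c ord0) ?divff// -c1 addrAC subrr add0r.
have := @conv_convex d A (p ord0) _ (c ord0) (pA _) H.
rewrite c0 cl1 => /(_ isT); by rewrite scalerA divff// scale1r.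
Qed.

Lemma conv_idem d (A B : set 'rV[R]_d) : A `<=` conv B -> conv A `<=` conv B.
Proof.
move=> AB x [n [p [c [pA c0 c1 ->]]]]; apply: conv_idem_coef => // i.
exact: AB.
Qed.

(** Nested combinations are flattened over the disjoint union of the index sets. *)
Lemma aff_conv d (A : set 'rV[R]_d) : aff (conv A) = aff A.
Proof.
apply/seteqP; split=> x [n [p [c [pA c1 ->]]]]; last first.
  by exists n, p, c; split=> // i; exact: sub_conv.
have /choice[f fP] : forall i, exists s : {n : nat & (('I_n -> 'rV[R]_d) * ('I_n -> R))%type},
    [/\ forall j, A ((projT2 s).1 j), forall j, 0 <= (projT2 s).2 j,
       \sum_j (projT2 s).2 j = 1 & p i = \sum_j (projT2 s).2 j *: (projT2 s).1 j].
  by move=> i; have [m [q [e H]]] := pA i; exists (existT _ m (q, e)).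
pose m i := projT1 (f i).
pose q i : 'I_(m i) -> 'rV[R]_d := (projT2 (f i)).1.
pose e i : 'I_(m i) -> R := (projT2 (f i)).2.
have H i : [/\ forall j, A (q i j), forall j, 0 <= e i j, \sum_j e i j = 1
   & p i = \sum_j e i j *: q i j] := fP i.
pose I := {i : 'I_n & 'I_(m i)}.
have big (V : nmodType) (F : I -> V) : \sum_(k < #|{: I}|) F (enum_val k) =
    \sum_i \sum_(j < m i) F (Tagged (fun i => 'I_(m i)) j).
  rewrite -(big_enum_val F) /=.
  by rewrite (sig_big_dep xpredT (fun=> xpredT) (fun i j => F (Tagged (fun i => 'I_(m i)) j))); apply: eq_bigr => -[].
exists #|{: I}|, (fun k => q (tag (enum_val k)) (tagged (enum_val k))),
  (fun k => c (tag (enum_val k)) * e (tag (enum_val k)) (tagged (enum_val k))); split.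
- by move=> k; have [qA _ _ _] := H (tag (enum_val k)); exact: qA.
- rewrite (big _ (fun k : I => c (tag k) * e (tag k) (tagged k))) /= -c1.
  apply: eq_bigr => i _; have [_ _ e1 _] := H i.
  by rewrite -mulr_sumr e1 mulr1.
- rewrite (big _ (fun k : I => (c (tag k) * e (tag k) (tagged k)) *: q (tag k) (tagged k))) /=.
  apply: eq_bigr => i _; have [_ _ _ ->] := H i.
  by rewrite scaler_sumr; apply: eq_bigr => j _; rewrite scalerA.
Qed.

End Hulls.

(** * Affine dimension as a matrix rank, and vertices *)

Section VspaceMatrix.
Context {F : fieldType}.

Lemma vspace_matrix d (W : {vspace 'rV[F]_d}) :
  exists2 M : 'M[F]_(\dim W, d), row_free M &
    forall u, (u \in W) = (u <= M)%MS.
Proof.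
pose M := \matrix_(i < \dim W) (vbasis W)`_i.
have rM i : row i M = (vbasis W)`_i by rewrite rowK.
have mulM c : c *m M = \sum_i c 0 i *: (vbasis W)`_i.
  by rewrite mulmx_sum_row; apply: eq_bigr => i _; rewrite rM.
exists M.
  apply: inj_row_free => c cM; apply/rowP => i; rewrite mxE.
  have /freeP := basis_free (vbasisP W); apply.
  by rewrite -mulM cM.
move=> u; apply/idP/submxP => [uW|[c ->]].
  exists (\row_i coord (vbasis W) i u); rewrite mulM [LHS](coord_vbasis uW).
  by apply: eq_bigr => i _; rewrite mxE.
rewrite mulM; apply: memv_suml => i _; apply: memvZ; apply: vbasis_mem.
by apply: mem_nth; rewrite size_tuple.
Qed.

Lemma matrix_vspace m d (M : 'M[F]_(m, d)) :
  exists2 W : {vspace 'rV[F]_d}, \dim W = \rank M & forall u, (u \in W) = (u <= M)%MS.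
Proof.
pose X := [tuple row i M | i < m]; pose W := <<X>>%VS.
have WE u : (u \in W) = (u <= M)%MS.
  apply/idP/idP => [|/submxP[c ->]].
    rewrite /W => /coord_span ->; rewrite summx_sub// => i _; apply: scalemx_sub.
    by rewrite -tnth_nth tnth_mktuple row_sub.
  rewrite mulmx_sum_row; apply: memv_suml => i _; apply: memvZ; apply: memv_span.
  by apply/tnthP; exists i; rewrite tnth_mktuple.
exists W => //; have [M' fM' ME] := vspace_matrix W.
rewrite -(eqP fM'); apply/eqP; rewrite eqn_leq !mxrankS//.
  by apply/row_subP => i; rewrite -ME WE row_sub.
by apply/row_subP => i; rewrite -WE ME row_sub.
Qed.

End VspaceMatrix.

Section AffineDimension.
Context {R : realType}.
Implicit Types d k : nat.

(** Homogeneous coordinates: affine relations between points become linear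
    relations between rows, and affine dimension becomes rank minus one. *)
Definition homog d (x : 'rV[R]_d) : 'rV[R]_(1 + d) := row_mx 1%:M x.

(** Rows outside [U] are zeroed instead of deleted, so that the matrix keeps its
    size when [U] varies. *)
Definition homog_mx N d (v : 'I_N -> 'rV[R]_d) (U : {set 'I_N}) : 'M[R]_(N, 1 + d) :=
  \matrix_i (if i \in U then homog (v i) else 0).

Lemma row_homog_mx N d (v : 'I_N -> 'rV[R]_d) (U : {set 'I_N}) i :
  row i (homog_mx v U) = if i \in U then homog (v i) else 0.
Proof. by rewrite rowK. Qed.

Lemma homog_mx_sub N d (v : 'I_N -> 'rV[R]_d) (U : {set 'I_N}) i :
  i \in U -> (homog (v i) <= homog_mx v U)%MS.
Proof.
by move=> iU; rewrite (_ : homog (v i) = row i (homog_mx v U)) ?row_sub// row_homog_mx iU.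
Qed.

Lemma homog_mx_subP N d (v : 'I_N -> 'rV[R]_d) (U : {set 'I_N}) m (A : 'M[R]_(m, 1 + d)) :
  (forall i, i \in U -> (homog (v i) <= A)%MS) -> (homog_mx v U <= A)%MS.
Proof.
move=> H; apply/row_subP => i; rewrite row_homog_mx.
by case: ifPn => [/H//|_]; exact: sub0mx.
Qed.

Lemma homog_mxS N d (v : 'I_N -> 'rV[R]_d) (U U' : {set 'I_N}) :
  U \subset U' -> (homog_mx v U <= homog_mx v U')%MS.
Proof.
by move=> /fintype.subsetP UU'; apply: homog_mx_subP => i /UU'; exact: homog_mx_sub.
Qed.

Lemma mul_homog_mx N d (v : 'I_N -> 'rV[R]_d) (U : {set 'I_N}) (c : 'rV[R]_N) :
  c *m homog_mx v U = \sum_(i in U) c 0 i *: homog (v i).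
Proof.
rewrite mulmx_sum_row [RHS]big_mkcond/=; apply: eq_bigr => i _.
by rewrite row_homog_mx; case: ifP => // _; rewrite scaler0.
Qed.

Lemma homog_lin d (I : finType) (c : I -> R) (v : I -> 'rV[R]_d) (P : pred I) :
  \sum_(i | P i) c i = 1 ->
  \sum_(i | P i) c i *: homog (v i) = homog (\sum_(i | P i) c i *: v i).
Proof.
move=> c1; rewrite /homog.
have -> : row_mx 1%:M (\sum_(i | P i) c i *: v i) =
  row_mx (\sum_(i | P i) c i *: 1%:M) (\sum_(i | P i) c i *: v i).
  by rewrite -scaler_suml c1 scale1r.
have H : forall s : seq I, row_mx (\sum_(i <- s | P i) c i *: 1%:M : 'M[R]_1) (\sum_(i <- s | P i) c i *: v i)
   = \sum_(i <- s | P i) c i *: row_mx 1%:M (v i).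
  elim=> [|i s IH]; first by rewrite !big_nil row_mx0.
  by rewrite !big_cons; case: ifP => // _; rewrite -IH scale_row_mx add_row_mx.
by rewrite H.
Qed.

Lemma homog_affP N d (v : 'I_N -> 'rV[R]_d) (U : {set 'I_N}) x :
  aff (points_of v U) x <-> (homog x <= homog_mx v U)%MS.
Proof.
rewrite affP; split=> [[c [cU c1 ->]]|/submxP[c]].
  rewrite -homog_lin//; apply: summx_sub => i _.
  have [iU|/cU ->] := boolP (i \in U); last by rewrite scale0r sub0mx.
  by apply: scalemx_sub; exact: homog_mx_sub.
rewrite mul_homog_mx => xE.
have c1 : \sum_(i in U) c 0 i = 1.
  have := congr1 (fun M : 'rV_(1 + d) => M 0 (lshift d 0)) xE.
  rewrite row_mxEl mxE eqxx summxE => e.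
  rewrite -[RHS]/(true%:R) e; apply: eq_bigr => i _.
  by rewrite mxE row_mxEl mxE eqxx mulr1.
exists (fun i => if i \in U then c 0 i else 0); split.
- by move=> i /negbTE ->.
- by rewrite -big_mkcond.
- move: xE; rewrite homog_lin// => /eq_row_mx[_ ->].
  by rewrite big_mkcond/=; apply: eq_bigr => i _; case: ifP => // _; rewrite scale0r.
Qed.

(** Directions, that is differences of points, are the rows with first entry 0. *)
Definition dirM m d (M : 'M[R]_(m, d)) : 'M[R]_(m, 1 + d) := row_mx 0 M.

Lemma row_dirM m d (M : 'M[R]_(m, d)) i : dirM (row i M) = row i (dirM M).
Proof.
by apply/rowP => j; rewrite !mxE; case: fintype.split => k; rewrite !mxE.
Qed.

Lemma dirME m d (M : 'M[R]_(m, d)) : dirM M = M *m row_mx 0 1%:M.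
Proof. by rewrite mul_mx_row mulmx0 mulmx1. Qed.

Lemma dirM_sub m1 m2 d (M1 : 'M[R]_(m1, d)) (M2 : 'M[R]_(m2, d)) :
  (dirM M1 <= dirM M2)%MS = (M1 <= M2)%MS.
Proof.
apply/idP/idP; rewrite !dirME; last exact: submxMr.
move=> /(submxMr (col_mx 0 1%:M)).
by rewrite -!mulmxA mul_row_col mul0mx add0r mul1mx !mulmx1.
Qed.

Lemma homogB d (x y : 'rV[R]_d) : homog x - homog y = dirM (x - y).
Proof. by rewrite /homog /dirM opp_row_mx add_row_mx subrr. Qed.

Lemma rank_homog_direct m d (x0 : 'rV[R]_d) (M : 'M[R]_(m, d)) :
  \rank (homog x0 + dirM M)%MS = (\rank M).+1.
Proof.
have E : (dirM M :=: dirM (row_base M))%MS.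
  by apply/eqmxP; rewrite !dirM_sub !eq_row_base submx_refl.
rewrite (adds_eqmx (eqmx_refl _) E) addsmxE.
suff /eqP -> : row_free (col_mx (homog x0) (dirM (row_base M))) by [].
apply: inj_row_free => c; rewrite -[c]hsubmxK mul_row_col /homog /dirM !mul_mx_row.
rewrite add_row_mx mulmx0 addr0 mulmx1 => /eqP; rewrite -[0]row_mx0.
move=> /eqP/eq_row_mx[-> ]; rewrite mul0mx add0r => H.
suff -> : rsubmx c = 0 by rewrite row_mx0.
apply: (row_free_inj (row_base_free M)); by rewrite H mul0mx.
Qed.

Lemma rank_homog_mx m N d (v : 'I_N -> 'rV[R]_d) (U : {set 'I_N}) (x0 : 'rV[R]_d)
    (M : 'M[R]_(m, d)) :
  (homog x0 <= homog_mx v U)%MS ->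
  (forall x, (homog x <= homog_mx v U)%MS = (x - x0 <= M)%MS) ->
  \rank (homog_mx v U) = (\rank M).+1.
Proof.
move=> x0U HM; rewrite -(rank_homog_direct x0).
apply/eqP; rewrite eqn_leq !mxrankS//; last first.
  apply: homog_mx_subP => i iU.
  rewrite -[homog (v i)](subrK (homog x0)) addrC addmx_sub_adds// homogB dirM_sub -HM.
  exact: homog_mx_sub.
rewrite addsmx_sub x0U; apply/row_subP => i.
have -> : row i (dirM M) = homog (x0 + row i M) - homog x0.
  by rewrite homogB addrAC subrr add0r row_dirM.
by rewrite addmx_sub ?eqmx_opp// HM addrAC subrr add0r row_sub.
Qed.

Definition shiftM N d (v : 'I_N -> 'rV[R]_d) (U : {set 'I_N}) (x0 : 'rV[R]_d) : 'M[R]_(N, d) :=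
  \matrix_i (if i \in U then v i - x0 else 0).

Lemma homog_shiftM N d (v : 'I_N -> 'rV[R]_d) (U : {set 'I_N}) x0 x :
  (homog x0 <= homog_mx v U)%MS ->
  (homog x <= homog_mx v U)%MS = (x - x0 <= shiftM v U x0)%MS.
Proof.
move=> x0U; apply/idP/idP => [/homog_affP/affP[c [cU c1 ->]]|].
  have -> : \sum_i c i *: v i - x0 = \sum_i c i *: (v i - x0).
    under [RHS]eq_bigr do rewrite scalerBr.
    by rewrite sumrB -scaler_suml c1 scale1r.
  apply: summx_sub => i _.
  have [iU|/cU ->] := boolP (i \in U); last by rewrite scale0r sub0mx.
  apply: scalemx_sub; rewrite (_ : v i - x0 = row i (shiftM v U x0)) ?row_sub//.
  by rewrite rowK iU.
rewrite -dirM_sub -homogB => H.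
rewrite -[homog x](subrK (homog x0)) addmx_sub//; apply: submx_trans H _.
apply/row_subP => i.
have -> : row i (dirM (shiftM v U x0)) = if i \in U then homog (v i) - homog x0 else 0.
  rewrite homogB -row_dirM rowK; case: (i \in U) => //.
  by rewrite /dirM row_mx0.
case: ifPn => iU; last exact: sub0mx.
by rewrite addmx_sub ?eqmx_opp// homog_mx_sub.
Qed.

(** The row space of the homogeneous matrix is the line through one of the points
    plus the directions of the affine hull. *)
Lemma affdimP N d (v : 'I_N -> 'rV[R]_d) (U : {set 'I_N}) k :
  affine_space_of_dim k (aff (points_of v U)) <-> \rank (homog_mx v U) = k.+1.
Proof.
split=> [[x0 [W [dW AE]]]|rU].
  have [M fM WM] := vspace_matrix W.
  have x0U : (homog x0 <= homog_mx v U)%MS.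
    by apply/homog_affP; rewrite AE /= subrr mem0v.
  rewrite (rank_homog_mx x0U (M := M)) ?(eqP fM) ?dW// => x.
  apply/idP/idP; first by move=> /homog_affP; rewrite AE /= WM.
  by rewrite -WM => xW; apply/homog_affP; rewrite AE.
have [U0|[i0 i0U]] := set_0Vmem U.
  move: rU; rewrite (_ : homog_mx v U = 0) ?mxrank0//.
  by apply/row_matrixP => i; rewrite row_homog_mx U0 inE row0.
have x0U := homog_mx_sub v i0U.
have [W dW WE] := matrix_vspace (shiftM v U (v i0)).
exists (v i0), W; split.
  by apply: succn_inj; rewrite dW -rU (rank_homog_mx x0U (M := shiftM v U (v i0)))// => x; exact: homog_shiftM.
apply/seteqP; split=> x /=; rewrite WE -homog_shiftM//; first by move/homog_affP.
by move=> ?; apply/homog_affP.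
Qed.

Lemma separating_functional m n (M : 'M[R]_(m, n)) (w : 'rV[R]_n) :
  ~~ (w <= M)%MS -> exists l : 'cV[R]_n, M *m l = 0 /\ (w *m l) 0 0 != 0.
Proof.
rewrite submxE => /eqP wM.
have [j wj] : exists j, (w *m cokermx M) 0 j != 0.
  apply/existsP; apply: contrapT => /negP; rewrite negb_exists => /forallP H.
  by apply: wM; apply/rowP => j; rewrite [RHS]mxE; apply/eqP; rewrite -[_ == _]negbK.
exists (col j (cokermx M)); split; first by rewrite colE mulmxA mulmx_coker mul0mx.
by rewrite colE mulmxA -colE mxE.
Qed.

Lemma vertices_sub d (P Q : set 'rV[R]_d) : P `<=` Q ->
  forall x, P x -> vertices Q x -> vertices P x.
Proof.
move=> PQ x Px [_ H]; split=> // y z t Py Pz; apply: H; exact: PQ.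
Qed.

Lemma points_of_sub N d (v : 'I_N -> 'rV[R]_d) (U T : {set 'I_N}) :
  U \subset T -> points_of v U `<=` points_of v T.
Proof. by move=> /fintype.subsetP UT x [i /= /UT iT <-]; exists i. Qed.

(** Renormalizing the other weights isolates the contribution of one point. *)
Lemma conv_split N d (v : 'I_N -> 'rV[R]_d) (U : {set 'I_N}) (c : 'I_N -> R) i :
  (forall j, 0 <= c j) -> (forall j, j \notin U -> c j = 0) -> \sum_j c j = 1 -> c i != 1 ->
  c i < 1 /\ exists2 y, conv (points_of v (U :\ i)) y &
    \sum_j c j *: v j = c i *: v i + (1 - c i) *: y.
Proof.
move=> c0 cU c1 ni.
have sE : \sum_(j | j != i) c j = 1 - c i.
  by rewrite -c1 [X in _ = X - _](bigD1 i)//= addrAC subrr add0r.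
have ci1 : c i < 1 by rewrite lt_def eq_sym ni -subr_ge0 -sE sumr_ge0.
have c1i : 1 - c i != 0 by rewrite subr_eq0 eq_sym.
pose e j := (if j == i then 0 else c j) / (1 - c i).
split=> //; exists (\sum_j e j *: v j); last first.
  rewrite (bigD1 i)//=; congr (_ + _).
  rewrite scaler_sumr [LHS]big_mkcond/=; apply: eq_bigr => j _.
  rewrite /e scalerA mulrC divfK//; case: eqP => //= _.
  by rewrite scale0r.
apply/convP; exists e; split=> //.
- by move=> j; rewrite divr_ge0 ?subr_ge0 ?(ltW ci1)//; case: ifP.
- move=> j; rewrite !inE negb_and negbK /e; case: eqP => /= [_ _|_ /cU ->]; by rewrite mul0r.
- rewrite -mulr_suml (_ : \sum_(j < N) _ = 1 - c i) ?divff//.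
  by rewrite -sE [RHS]big_mkcond/=; apply: eq_bigr => j _; case: eqP.
Qed.

Lemma single_weight N (c : 'I_N -> R) i :
  (forall j, 0 <= c j) -> \sum_j c j = 1 -> c i = 1 -> forall j, j != i -> c j = 0.
Proof.
move=> c0 c1 ci j ji.
have : \sum_(j | j != i) c j == 0.
  by move: c1; rewrite (bigD1 i)//= ci -[X in _ = X]addr0 => /addrI ->.
rewrite psumr_eq0// => /allP/(_ j); rewrite mem_index_enum ji => /(_ isT).
by move/eqP.
Qed.

(** A vertex written as a convex combination cannot lie strictly inside the
    segment from a point of positive weight to the rest of the combination. *)
Lemma vertices_conv N d (v : 'I_N -> 'rV[R]_d) (U : {set 'I_N}) x :
  vertices (conv (points_of v U)) x -> points_of v U x.
Proof.
move=> [/convP[c [c0 cU c1 xE]] H].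
have [i ci] : exists i, c i != 0.
  apply/existsP; apply: contrapT => /negP; rewrite negb_exists => /forallP h.
  move: c1; rewrite big1 => [/eqP|i _]; first by rewrite eq_sym oner_eq0.
  by apply/eqP; rewrite -[_ == _]negbK.
have iU : i \in U by apply: contraR ci => /cU ->.
have vi : conv (points_of v U) (v i) by apply: sub_conv; exists i.
have ci0 : 0 < c i by rewrite lt_def ci c0.
exists i => //.
have [E|nE] := eqVneq (c i) 1.
  have cj := single_weight c0 c1 E.
  by rewrite xE (bigD1 i)//= E scale1r big1 ?addr0// => j /cj ->; rewrite scale0r.
have [ci1 [y Py yE]] := @conv_split _ _ v _ _ _ c0 cU c1 nE.
have [] := H (v i) y (c i) vi _ _ _ => //; last by rewrite xE.
  by apply: convS Py; apply: points_of_sub; exact: subD1set.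
by rewrite ci0 ci1.
Qed.

Definition vertex_family N d (P : set 'rV[R]_d) (v : 'I_N -> 'rV[R]_d) (T : {set 'I_N}) :=
  [/\ {in T &, injective v}, vertices P = points_of v T & P = conv (points_of v T)].

Lemma vertex_family_sub N d (P : set 'rV[R]_d) (v : 'I_N -> 'rV[R]_d) (T U : {set 'I_N}) :
  vertex_family P v T -> U \subset T -> vertex_family (conv (points_of v U)) v U.
Proof.
move=> [vi vP PE] UT; split=> //.
  by move=> i j iU jU; apply: vi; apply: (fintype.subsetP UT).
apply/seteqP; split=> [x|x xU]; first exact: vertices_conv.
apply: (@vertices_sub _ _ P); [|exact: sub_conv|].
  by rewrite PE; apply: convS; exact: points_of_sub.
by rewrite vP; exact: points_of_sub xU.
Qed.

(** A generating set of minimal cardinality has only vertices: if one of its points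
    were not extreme, it would be a combination of the others and could be dropped. *)
Lemma exists_vertex_family d (P : set 'rV[R]_d) : full_dim_polytope P ->
  exists N (v : 'I_N -> 'rV[R]_d), vertex_family P v [set: 'I_N]%SET.
Proof.
move=> [[S finS PS] _].
have [s sE] : exists s : seq 'rV[R]_d, S = [set` s] by apply/finite_seqP.
pose N0 := size s; pose v0 (i : 'I_N0) := nth 0 s i.
have S0 : S = points_of v0 [set: 'I_N0]%SET.
  rewrite sE; apply/seteqP; split=> [x /= xs|x [i _ <-]] /=.
    have xi : (index x s < N0)%N by rewrite index_mem.
    by exists (Ordinal xi); rewrite /= ?inE// /v0/= nth_index.
  by apply: mem_nth; exact: ltn_ord.
pose good (U : {set 'I_N0}) := `[< P = conv (points_of v0 U) >].
have g0 : good [set: 'I_N0]%SET by apply/asboolP; rewrite -S0.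
case: (arg_minnP (fun U : {set 'I_N0} => #|U|) g0) => U /asboolP PU Umin.
have notin i : i \in U -> ~ conv (points_of v0 (U :\ i)) (v0 i).
  move=> iU Ci; have : good (U :\ i).
    apply/asboolP; rewrite PU; apply/seteqP; split; last first.
      by apply: convS; apply: points_of_sub; exact: subD1set.
    apply: conv_idem => x [j /= jU <-].
    have [->//|ji] := eqVneq j i.
    by apply: sub_conv; exists j => //=; rewrite !inE ji.
  by move=> /Umin; rewrite (cardsD1 i U) iU add1n ltnn.
have inj : {in U &, injective v0}.
  move=> i j iU jU vij; apply/eqP/negP => /negP ij; apply: (notin _ iU).
  by apply: sub_conv; exists j => //=; rewrite !inE eq_sym ij.
have VP : vertices P = points_of v0 U.
  apply/seteqP; split=> x; first by rewrite PU; exact: vertices_conv.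
  move=> [i /= iU <-]; split; first by rewrite PU; apply: sub_conv; exists i.
  move=> x1 y1 t; rewrite PU => /convP[a [a0 aU a1 ->]] /convP[b [b0 bU b1 ->]].
  move=> /andP[t0 t1] vE.
  pose g j := t * a j + (1 - t) * b j.
  have t1' : 0 < 1 - t by rewrite subr_gt0.
  have g0' j : 0 <= g j by rewrite addr_ge0// mulr_ge0// ltW.
  have gsum : \sum_j g j = 1.
    by rewrite big_split/= -!mulr_sumr a1 b1; ring.
  have gE : v0 i = \sum_j g j *: v0 j.
    rewrite {1}vE !scaler_sumr -big_split/=; apply: eq_bigr => j _.
    by rewrite !scalerA -scalerDl.
  have [E|nE] := eqVneq (g i) 1.
    have ab j : j != i -> a j = 0 /\ b j = 0.
      move=> /(single_weight g0' gsum E).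
      have ta : 0 <= t * a j by rewrite mulr_ge0// ltW.
      have tb : 0 <= (1 - t) * b j by rewrite mulr_ge0// ltW.
      move=> /eqP; rewrite /g paddr_eq0// !mulf_eq0 (gt_eqF t0) (gt_eqF t1')/=.
      by move=> /andP[/eqP -> /eqP ->].
    have single (c : 'I_N0 -> R) : (forall j, j != i -> c j = 0) -> \sum_j c j = 1 ->
        \sum_j c j *: v0 j = v0 i.
      move=> c0; rewrite (bigD1 i)//= big1 ?addr0 => [c1|j /c0//].
      rewrite (bigD1 i)//= big1 ?addr0 ?c1 ?scale1r// => j /c0 ->.
      by rewrite scale0r.
    by rewrite !single// => j /ab[].
  have gU j : j \notin U -> g j = 0 by move=> jU; rewrite /g aU// bU// !mulr0 addr0.
  have [_ [y Cy]] := @conv_split _ _ v0 _ _ _ g0' gU gsum nE.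
  rewrite -gE addrC => /eqP; rewrite -subr_eq -[X in X - _]scale1r -scalerBl => /eqP.
  move=> /(scalerI _) yE; exfalso; apply: (notin _ iU).
  by rewrite yE// subr_eq0 eq_sym.
exists #|U|, (fun k : 'I_#|U| => v0 (enum_val k)).
have imgE : points_of (fun k : 'I_#|U| => v0 (enum_val k)) [set: 'I_#|U|]%SET = points_of v0 U.
  apply/seteqP; split=> x [i /= iU <-]; first by exists (enum_val i) => //=; exact: enum_valP.
  by exists (enum_rank_in iU i); rewrite /= ?inE// enum_rankK_in.
split; rewrite ?imgE//.
by move=> i j _ _ /inj H; apply: enum_val_inj; apply: H; exact: enum_valP.
Qed.

End AffineDimension.

(** * Faces of lattice-face polytopes are never vertical *)

Section Facets.
Context {R : realType}.

Notation pr := (forget (leqnSn _)).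

Definition dropM n : 'M[R]_(n.+1, n) := \matrix_(i, j) (i == widen_ord (leqnSn n) j)%:R.

Lemma prE n (x : 'rV[R]_n.+1) : pr x = x *m dropM n.
Proof.
apply/rowP => j; rewrite !mxE (bigD1 (widen_ord (leqnSn n) j))//= mxE eqxx mulr1.
by rewrite big1 ?addr0// => i /negbTE ij; rewrite mxE ij mulr0.
Qed.

(** The projection [pr] in homogeneous coordinates; its kernel is the line spanned
    by [vertical]. *)
Definition dropH n : 'M[R]_(1 + n.+1, 1 + n) := block_mx 1%:M 0 0 (dropM n).

Lemma homog_pr n (x : 'rV[R]_n.+1) : homog (pr x) = homog x *m dropH n.
Proof. by rewrite /homog mul_row_block !mulmx0 mulmx1 addr0 add0r prE. Qed.

Lemma homog_mx_pr N n (v : 'I_N -> 'rV[R]_n.+1) (U : {set 'I_N}) :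
  homog_mx (fun i => pr (v i)) U = homog_mx v U *m dropH n.
Proof.
apply/row_matrixP => i; rewrite row_mul !row_homog_mx homog_pr.
by case: ifP => // _; rewrite mul0mx.
Qed.

Definition vertical n : 'rV[R]_(1 + n.+1) := dirM (delta_mx 0 ord_max).

Lemma vertical_drop n : vertical n *m dropH n = 0.
Proof.
rewrite /vertical /dirM mul_row_block !mulmx0 !mul0mx !add0r.
rewrite -prE (_ : pr _ = 0) ?row_mx0//.
by apply/rowP => j; rewrite !mxE andTb -val_eqE/= ltn_eqF.
Qed.

Lemma vertical_neq0 n : vertical n != 0.
Proof.
apply/eqP => /(congr1 (fun M : 'rV_(1 + n.+1) => M 0 (rshift 1 ord_max))).
by rewrite row_mxEr !mxE !eqxx => /eqP; rewrite oner_eq0.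
Qed.

Lemma pr_sum n (I : Type) (r : seq I) (c : I -> R) (v : I -> 'rV[R]_n.+1) :
  pr (\sum_(i <- r) c i *: v i) = \sum_(i <- r) c i *: pr (v i).
Proof.
by rewrite prE mulmx_suml; apply: eq_bigr => i _; rewrite -scalemxAl prE.
Qed.

Lemma conv_pr N n (v : 'I_N -> 'rV[R]_n.+1) (U : {set 'I_N}) :
  pr @` conv (points_of v U) = conv (points_of (fun i => pr (v i)) U).
Proof.
apply/seteqP; split=> x.
  move=> [y /convP[c [c0 cU c1 ->]] <-]; apply/convP.
  by exists c; split=> //; rewrite pr_sum.
move=> /convP[c [c0 cU c1 ->]]; exists (\sum_i c i *: v i); last exact: pr_sum.
by apply/convP; exists c.
Qed.

Lemma rank_homog_mx_setU1 N d (v : 'I_N -> 'rV[R]_d) (U : {set 'I_N}) i :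
  (\rank (homog_mx v (i |: U)) <= (\rank (homog_mx v U)).+1)%N.
Proof.
have H : (homog_mx v (i |: U) <= homog (v i) + homog_mx v U)%MS.
  apply: homog_mx_subP => j; rewrite !inE => /predU1P[->|jU]; first exact: addsmxSl.
  by apply: submx_trans (addsmxSr _ _); exact: homog_mx_sub.
apply: leq_trans (mxrankS H) _; apply: leq_trans (mxrank_adds_leqif _ _) _.
apply: (@leq_trans (1 + \rank (homog_mx v U))%N) => //.
by rewrite leq_add2r rank_leq_row.
Qed.

(** Adding a point raises the rank by at most one, so every intermediate rank is
    reached. *)
Lemma extend_rank N d (v : 'I_N -> 'rV[R]_d) (U T : {set 'I_N}) k :
  U \subset T -> (\rank (homog_mx v U) <= k)%N -> (k <= \rank (homog_mx v T))%N ->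
  exists2 U' : {set 'I_N}, U \subset U' /\ U' \subset T & \rank (homog_mx v U') = k.
Proof.
move=> UT Uk kT.
pose good (W : {set 'I_N}) := [&& U \subset W, W \subset T & (\rank (homog_mx v W) <= k)%N].
have g0 : good U by rewrite /good subxx UT.
case: (arg_maxnP (fun W : {set 'I_N} => #|W|) g0) => W /and3P[UW WT Wk] Wmax.
exists W => //; apply/eqP; rewrite eqn_leq Wk leqNgt; apply/negP => lt.
have [i iT iW] : exists2 i, i \in T & ~~ (homog (v i) <= homog_mx v W)%MS.
  apply: contrapT => h; suff /mxrankS : (homog_mx v T <= homog_mx v W)%MS.
    by move=> /(leq_trans kT); rewrite leqNgt lt.
  apply: homog_mx_subP => i iT; apply: contrapT => /negP ni; apply: h; exists i => //.
have iW' : i \notin W by apply: contra iW => /homog_mx_sub; apply.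
have : good (i |: W).
  rewrite /good (fintype.subset_trans UW (finset.subsetUr _ _)) finset.subUset finset.sub1set iT WT/=.
  exact: leq_trans (rank_homog_mx_setU1 _ _ _) lt.
by move=> /Wmax; rewrite cardsU1 iW' add1n /= ltnn.
Qed.

Lemma vertex_family_rank N n (P : set 'rV[R]_n) (v : 'I_N -> 'rV[R]_n) (T : {set 'I_N}) :
  full_dim_polytope P -> vertex_family P v T -> \rank (homog_mx v T) = n.+1.
Proof.
move=> [_ dP] [_ _ PE]; apply/affdimP.
by move: dP; rewrite PE aff_conv.
Qed.

Lemma lattice_face_full_dim n (P : set 'rV[R]_n.+1) :
  lattice_face P -> full_dim_polytope P.
Proof. by case: n P => [|n] P []. Qed.

Lemma lattice_face_facet N n (P : set 'rV[R]_n.+2) (v : 'I_N -> 'rV[R]_n.+2) (T U : {set 'I_N}) :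
  lattice_face P -> vertex_family P v T -> U \subset T -> \rank (homog_mx v U) = n.+2 ->
  lattice_face (conv (points_of (fun i => pr (v i)) U)) /\
  pr @` lattice_points (aff (points_of v U)) = @integer_lattice R n.+1.
Proof.
move=> [_ H] [_ vP _] UT rU.
have [] := H (points_of v U).
- by rewrite vP; exact: points_of_sub.
- exact/affdimP.
by rewrite conv_pr.
Qed.

(** Extend [U] to a set of vertices spanning a hyperplane. By condition (a) its
    projection is full-dimensional, so [pr] is injective on the hyperplane. *)
Lemma no_vertical N n (P : set 'rV[R]_n.+1) (v : 'I_N -> 'rV[R]_n.+1) (T U : {set 'I_N}) :
  lattice_face P -> vertex_family P v T -> U \subset T -> (\rank (homog_mx v U) <= n.+1)%N ->
  ~~ (vertical n <= homog_mx v U)%MS.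
Proof.
move=> lP vP UT rU; apply/negP => eU; case: n P v lP vP rU eU => [|n] P v lP vP rU eU.
  (* In dimension 1 the rank bound leaves at most one point. *)
  have [U0|[i0 i0U]] := set_0Vmem U.
    have H0 : homog_mx v U = 0.
      by apply/row_matrixP => i; rewrite row_homog_mx U0 inE row0.
    have := mxrankS eU; rewrite H0 mxrank0 leqn0 mxrank_eq0.
    by rewrite (negbTE (vertical_neq0 _)).
  have : (homog (v i0) + vertical 0 <= homog_mx v U)%MS by rewrite addsmx_sub eU homog_mx_sub.
  move/mxrankS; rewrite rank_homog_direct mxrank_delta => h.
  by have := leq_trans h rU.
have rT := vertex_family_rank (lattice_face_full_dim lP) vP.
have [|U' [UU' U'T] rU'] := extend_rank UT rU; first by rewrite rT.
have [lQ _] := lattice_face_facet lP vP U'T rU'.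
have [_] := lattice_face_full_dim lQ; rewrite aff_conv => /affdimP.
rewrite homog_mx_pr => rE.
have := mxrank_mul_ker (homog_mx v U') (dropH n.+1); rewrite rE rU' => /eqP.
rewrite -[X in _ == X]addn0 eqn_add2l mxrank_eq0 => /eqP E.
have : (vertical n.+1 <= homog_mx v U' :&: kermx (dropH n.+1))%MS.
  rewrite sub_capmx (submx_trans eU (homog_mxS v UU'))/=.
  by apply/sub_kermxP; exact: vertical_drop.
by move=> /mxrankS; rewrite E mxrank0 leqn0 mxrank_eq0 (negbTE (vertical_neq0 _)).
Qed.

(** As the face spanned by [U] contains no vertical direction, the projection is
    injective on it and carries vertices to vertices. *)
Lemma vertex_family_pr N n (P : set 'rV[R]_n.+1) (v : 'I_N -> 'rV[R]_n.+1) (T U : {set 'I_N}) :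
  lattice_face P -> vertex_family P v T -> U \subset T -> (\rank (homog_mx v U) <= n.+1)%N ->
  vertex_family (conv (points_of (fun i => pr (v i)) U)) (fun i => pr (v i)) U.
Proof.
move=> lP vP UT rU; have eU := no_vertical lP vP UT rU.
have [vi vV vE] := vertex_family_sub vP UT.
(* A difference of two points with the same projection is vertical. *)
have inj x y : conv (points_of v U) x -> conv (points_of v U) y -> pr x = pr y -> x = y.
  move=> cx cy pxy.
  have sub z : conv (points_of v U) z -> (homog z <= homog_mx v U)%MS.
    move=> [n' [p [c [pU c0 c1 zE]]]]; apply/homog_affP; exists n', p, c; split=> //.
  have dE : x - y = (x - y) 0 ord_max *: delta_mx 0 ord_max.
    apply/rowP => j; rewrite [RHS]mxE [delta_mx _ _ _ _]mxE eqxx/=.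
    have [->|jm] := eqVneq j ord_max; first by rewrite mulr1.
    rewrite mulr0 !mxE.
    have jn : (j < n)%N by rewrite ltn_neqAle -ltnS ltn_ord andbT; apply: contra jm => /eqP jE; apply/eqP/val_inj.
    have := congr1 (fun M : 'rV_n => M 0 (Ordinal jn)) pxy; rewrite !mxE.
    rewrite (_ : widen_ord _ _ = j); last exact: val_inj.
    by move=> ->; rewrite subrr.
  have [d0|d0] := eqVneq ((x - y) 0 ord_max) 0.
    by apply/eqP; rewrite -subr_eq0 dE d0 scale0r.
  exfalso; move: eU => /negP; apply.
  have : (homog x - homog y <= homog_mx v U)%MS by rewrite addmx_sub ?eqmx_opp ?sub.
  rewrite homogB dE => /(scalemx_sub ((x - y) 0 ord_max)^-1).
  rewrite (_ : _ *: dirM _ = vertical n)// /vertical /dirM scale_row_mx scaler0.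
  by rewrite scalerA mulVf// scale1r.
have iv i : i \in U -> conv (points_of v U) (v i) by move=> iU; apply: sub_conv; exists i.
split=> //.
  by move=> i j iU jU /inj E; apply: vi => //; apply: E; exact: iv.
apply/seteqP; split=> [x|x [i /= iU <-]]; first exact: vertices_conv.
split; first by apply: sub_conv; exists i.
rewrite -conv_pr => _ _ t [x1 cx1 <-] [y1 cy1 <-] t01 vxE.
have [t0 t1] := andP t01.
have cxy : conv (points_of v U) (t *: x1 + (1 - t) *: y1).
  by apply: conv_convex; rewrite // ltW//= ltW.
have vxy : v i = t *: x1 + (1 - t) *: y1.
  apply: inj => //; first exact: iv.
  by rewrite vxE !prE mulmxDl -!scalemxAl.
have : vertices (conv (points_of v U)) (v i) by rewrite vV; exists i.
by move=> [_ /(_ _ _ _ cx1 cy1 t01 vxy)[-> ->]].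
Qed.

End Facets.

(** * Facet inequalities with integer coefficients *)

Section HalfSpaces.
Context {R : realType}.

Definition form_at d (l : 'cV[R]_(1 + d)) (x : 'rV[R]_d) : R := (homog x *m l) 0 0.

Definition tight N d (v : 'I_N -> 'rV[R]_d) (T : {set 'I_N}) l : {set 'I_N} :=
  [set i in T | form_at l (v i) == 0].

Lemma form_atD d (l g : 'cV[R]_(1 + d)) t x : form_at (l + t *: g) x = form_at l x + t * form_at g x.
Proof. by rewrite /form_at mulmxDr -scalemxAr !mxE. Qed.

Lemma tight_mul N d (v : 'I_N -> 'rV[R]_d) (T : {set 'I_N}) l :
  homog_mx v (tight v T l) *m l = 0.
Proof.
apply/row_matrixP => i; rewrite row_mul row_homog_mx row0.
case: ifPn => [|_]; last by rewrite mul0mx.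
rewrite inE => /andP[_ /eqP e]; apply/matrixP => a b.
by rewrite !ord1 [RHS]mxE.
Qed.

Lemma separating_halfspace N n (P : set 'rV[R]_n) (v : 'I_N -> 'rV[R]_n) (T : {set 'I_N}) x :
  P = conv (points_of v T) -> ~ P x ->
  exists l, (forall i, i \in T -> 0 <= form_at l (v i)) /\ form_at l x < 0.
Proof.
move=> PE nPx; apply: contrapT => no.
have [|c c0 xE] := @farkas R N (1 + n) (fun i => if i \in T then homog (v i) else 0) (homog x).
  move=> l Hl; rewrite leNgt; apply/negP => lx; apply: no; exists l; split=> // i iT.
  by have := Hl i; rewrite iT.
apply: nPx; rewrite PE.
have xE' : homog x = \sum_(i in T) c i *: homog (v i).
  rewrite xE [RHS]big_mkcond/=; apply: eq_bigr => i _.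
  by case: ifP => // _; rewrite scaler0.
have c1 : \sum_(i in T) c i = 1.
  have := congr1 (fun M : 'rV_(1 + n) => M 0 (lshift n 0)) xE'.
  rewrite row_mxEl mxE eqxx summxE => e.
  rewrite -[RHS]/(true%:R) e; apply: eq_bigr => i _.
  by rewrite mxE row_mxEl mxE eqxx mulr1.
apply/convP; exists (fun i => if i \in T then c i else 0); split.
- by move=> i; case: ifP.
- by move=> i /negbTE ->.
- by rewrite -big_mkcond.
- move: xE'; rewrite homog_lin// => /eq_row_mx[_ ->].
  by rewrite big_mkcond/=; apply: eq_bigr => i _; case: ifP => // _; rewrite scale0r.
Qed.

(** Among the forms that separate [x] from [P], take one whose zeros among the
    vertices have the largest rank. If this rank were not that of a hyperplane, one
    could turn the form, fixing its values on these zeros and at [x], until a new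
    vertex becomes a zero. *)
Lemma facet_functional N n (P : set 'rV[R]_n) (v : 'I_N -> 'rV[R]_n) (T : {set 'I_N}) x :
  P = conv (points_of v T) -> \rank (homog_mx v T) = n.+1 -> ~ P x ->
  exists l, [/\ forall i, i \in T -> 0 <= form_at l (v i), form_at l x < 0
    & \rank (homog_mx v (tight v T l)) = n].
Proof.
move=> PE rT nPx; have [l0 [l0T l0x]] := separating_halfspace PE nPx.
pose good k := `[< exists l, [/\ forall i, i \in T -> 0 <= form_at l (v i), form_at l x < 0
    & \rank (homog_mx v (tight v T l)) = k] >].
have rle l : form_at l x < 0 -> (\rank (homog_mx v (tight v T l)) <= n)%N.
  move=> lx; have /mxrankS : (homog_mx v (tight v T l) <= kermx l)%MS.
    by apply/sub_kermxP; exact: tight_mul.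
  rewrite mxrank_ker => /leq_trans; apply.
  suff : (0 < \rank l)%N by lia.
  rewrite lt0n mxrank_eq0; apply: contraTneq lx => ->.
  by rewrite /form_at mulmx0 mxE ltxx.
have ex : exists k, good k.
  by exists (\rank (homog_mx v (tight v T l0))); apply/asboolP; exists l0.
have bd k : good k -> (k <= n)%N.
  by move=> /asboolP[l [_ lx <-]]; exact: rle.
case: (ex_maxnP ex bd) => k /asboolP[l [lT lx rk]] kmax.
exists l; split=> //; rewrite rk.
have kn : (k <= n)%N by rewrite -rk rle.
apply/eqP; rewrite eqn_leq kn leqNgt; apply/negP => ltk.
(* A form [g] that vanishes on [M] can be added to [l] without changing its value
   at [x] or its zeros. *)
pose M := (homog x + homog_mx v (tight v T l))%MS.
have rM : (\rank M < n.+1)%N.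
  rewrite ltnS; apply: leq_trans (mxrank_adds_leqif _ _) _; rewrite rk.
  apply: (@leq_trans (1 + k)%N) => //; rewrite leq_add2r rank_leq_row//.
have [i iT iM] : exists2 i, i \in T & ~~ (homog (v i) <= M)%MS.
  apply: contrapT => h; suff /mxrankS : (homog_mx v T <= M)%MS.
    by rewrite rT leqNgt rM.
  by apply: homog_mx_subP => i iT; apply: contrapT => /negP ni; apply: h; exists i.
have [g0 [Mg0 ig0]] := separating_functional iM.
have [g [Mg ig]] : exists g, M *m g = 0 /\ form_at g (v i) < 0.
  have [h|h] := ltP (form_at g0 (v i)) 0; first by exists g0.
  exists (- g0); rewrite mulmxN Mg0 oppr0; split=> //.
  by rewrite /form_at mulmxN mxE oppr_lt0 lt_def ig0 h.
have subg y : (homog y <= M)%MS -> form_at g y = 0.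
  by move=> /submxP[c yE]; rewrite /form_at yE -mulmxA Mg mulmx0 mxE.
have gx : form_at g x = 0 by apply: subg; exact: addsmxSl.
have gt j : j \in tight v T l -> form_at g (v j) = 0.
  by move=> jt; apply: subg; apply: submx_trans (addsmxSr _ _); exact: homog_mx_sub.
(* The multiple of [g] at which the first vertex becomes a zero. *)
pose ratio j := form_at l (v j) / - form_at g (v j).
have iA : (i \in T) && (form_at g (v i) < 0) by rewrite iT ig.
have [j /andP[jT jg] jmin] : exists2 j, (j \in T) && (form_at g (v j) < 0) &
    forall j', (j' \in T) && (form_at g (v j') < 0) -> ratio j <= ratio j'.
  case: (@arg_minP _ R 'I_N i (fun j => (j \in T) && (form_at g (v j) < 0)) ratio iA) => j jA jmin.
  by exists j.
pose l' := l + ratio j *: g.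
have r0 : 0 <= ratio j by rewrite divr_ge0 ?lT// oppr_ge0 ltW.
have l'T j' : j' \in T -> 0 <= form_at l' (v j').
  move=> jT'; rewrite form_atD; have [gneg|gpos] := ltP (form_at g (v j')) 0; last first.
    by apply: addr_ge0; [exact: lT | exact: mulr_ge0].
  have := jmin j'; rewrite jT' gneg => /(_ isT); rewrite {2}/ratio.
  by rewrite ler_pdivlMr ?oppr_gt0// mulrN -subr_ge0 opprK.
have l'x : form_at l' x < 0 by rewrite form_atD gx mulr0 addr0.
have sub : tight v T l \subset tight v T l'.
  apply/fintype.subsetP => a at1; have := at1; rewrite !inE => /andP[-> /eqP e] /=.
  by rewrite form_atD e gt// mulr0 addr0.
have jt : j \in tight v T l'.
  by rewrite inE jT form_atD /ratio invrN mulrN mulNr divfK ?subrr ?eqxx// (lt_eqF jg).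
have : good (\rank (homog_mx v (tight v T l'))) by apply/asboolP; exists l'.
move/kmax; rewrite -rk leqNgt; case/negP.
have sM := homog_mxS v sub.
rewrite ltn_neqAle mxrankS// andbT (mxrank_leqif_sup sM).
apply/negP => h; move: jg; rewrite (_ : form_at g (v j) = 0) ?ltxx//.
apply: subg; apply: submx_trans (addsmxSr _ _).
exact: submx_trans (homog_mx_sub v jt) h.
Qed.

Definition coords n (x : 'rV[R]_n.+1) : nat -> R := fun j => x 0 (inord j).

(** The sign +1 for upper facets ([b = false]) and -1 for lower ones
    ([b = true]), which lets both cases share their statements. *)
Definition side (b : bool) : R := (-1) ^+ b.

Definition gap n z a (x : 'rV[R]_n.+1) : R := affine z a n (coords x) - x 0 ord_max.

(** [P] lies below the facet if [b] is false and above it if [b] is true. The last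
    clause asks for all the vertices on the hyperplane, so that a facet is determined
    by its set of vertices and conversely. *)
Definition facet (b : bool) N n (v : 'I_N -> 'rV[R]_n.+1) (T U : {set 'I_N}) z a : Prop :=
  [/\ U \subset T, \rank (homog_mx v U) = n.+1,
     forall i, i \in T -> 0 <= side b * gap z a (v i)
   & forall i, i \in T -> (gap z a (v i) == 0) = (i \in U)].

Definition real_affine (c0 : R) (c : nat -> R) n (y : nat -> R) : R :=
  c0 + \sum_(j < n) c j * y j.

(** Evaluation at the origin and at the unit vectors recovers the coefficients. *)
Lemma real_affine_int c0 c n :
  (forall y, (forall j, (j < n)%N -> y j \is a Num.int) -> real_affine c0 c n y \is a Num.int) ->
  exists z a, forall y, real_affine c0 c n y = affine z a n y.
Proof.
move=> H.
have c0int : c0 \is a Num.int.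
  have := H (fun=> 0); rewrite /real_affine big1 ?addr0; first by apply => *; exact: rpred0.
  by move=> j _; rewrite mulr0.
have cint (j : 'I_n) : c j \is a Num.int.
  have h : real_affine c0 c n (fun i => (i == j)%:R) = c0 + c j.
    rewrite /real_affine (bigD1 j)//= eqxx mulr1 big1 ?addr0// => i ij.
    by rewrite -val_eqE/= in ij; rewrite (negbTE ij) mulr0.
  have := H (fun i => (i == j)%:R); rewrite h => /(_ _) h2.
  rewrite -[c j](addrK c0) addrC rpredD//; first by rewrite rpredN.
  by rewrite addrC h2// => i _; exact: natr_int.
move/intrP : c0int => [z zE].
have /choice[a aE] : forall j, exists m : int, (j < n)%N -> c j = m%:~R.
  move=> j; have [jn|] := ltnP j n; last by exists 0.
  by have /intrP[m mE] := cint (Ordinal jn); exists m.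
exists z, a => y; rewrite /real_affine zE; congr (_ + _).
by apply: eq_bigr => j _; rewrite aE.
Qed.

Lemma form_atE n (l : 'cV[R]_(1 + n.+1)) x :
  form_at l x = l (lshift n.+1 0) 0 + \sum_(j < n) l (rshift 1 (widen_ord (leqnSn n) j)) 0 * x 0 (widen_ord (leqnSn n) j)
    + l (rshift 1 ord_max) 0 * x 0 ord_max.
Proof.
rewrite /form_at mxE big_split_ord/= big_ord1 row_mxEl mxE eqxx mul1r -addrA; congr (_ + _).
rewrite big_ord_recr/=; congr (_ + _); last by rewrite row_mxEr mulrC.
by apply: eq_bigr => j _; rewrite row_mxEr mulrC.
Qed.

Lemma vertical_mul n (l : 'cV[R]_(1 + n.+1)) :
  (vertical n *m l) 0 0 = l (rshift 1 ord_max) 0.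
Proof.
rewrite mxE (bigD1 (rshift 1 ord_max))//= row_mxEr mxE !eqxx mul1r big1 ?addr0// => i.
case: (split_ordP i) => j -> ij; rewrite ?row_mxEl ?row_mxEr mxE ?mul0r//.
rewrite (_ : j == ord_max = false) ?andbF ?mul0r//; apply/negbTE.
by apply: contra ij => /eqP ->.
Qed.

(** In dimension 1 a facet is a vertex, which is integral by definition; in higher
    dimension this is condition (b) on the affine span. *)
Lemma facet_lattice_point N n (P : set 'rV[R]_n.+1) (v : 'I_N -> 'rV[R]_n.+1)
    (T U : {set 'I_N}) y :
  lattice_face P -> vertex_family P v T -> U \subset T -> \rank (homog_mx v U) = n.+1 ->
  (forall j, (j < n)%N -> y j \is a Num.int) ->
  exists w : 'rV[R]_n.+1, [/\ (homog w <= homog_mx v U)%MS, w 0 ord_max \is a Num.int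
    & forall j : 'I_n, w 0 (widen_ord (leqnSn n) j) = y j].
Proof.
case: n P v => [|n] P v lP vP UT rU yint.
  have [U0|[i iU]] := set_0Vmem U.
    move: rU; rewrite (_ : homog_mx v U = 0) ?mxrank0//.
    by apply/row_matrixP => i; rewrite row_homog_mx U0 inE row0.
  exists (v i); split; [exact: homog_mx_sub| |by case].
  have [_ vV _] := vP; have [_ vint] := lP.
  by apply: vint; rewrite vV; exists i => //=; exact: (fintype.subsetP UT).
have [_ lat] := lattice_face_facet lP vP UT rU.
have : @integer_lattice R n.+1 (\row_(j < n.+1) y j) by move=> j; rewrite mxE yint.
rewrite -lat => -[w [wU wint] wy]; exists w; split; [exact/homog_affP|exact: wint|].
by move=> j; have := congr1 (fun M : 'rV_(n.+1) => M 0 j) wy; rewrite !mxE.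
Qed.

(** The form given by [facet_functional] vanishes on a hyperplane that is not
    vertical, so it can be solved for the last coordinate. The hyperplane has a
    lattice point above every lattice point, so the solution takes integer values on
    the lattice and has integer coefficients. *)
Theorem facet_separates N n (P : set 'rV[R]_n.+1) (v : 'I_N -> 'rV[R]_n.+1) (T : {set 'I_N}) x :
  lattice_face P -> vertex_family P v T -> ~ P x ->
  exists b U z a, facet b v T U z a /\ side b * gap z a x < 0.
Proof.
move=> lP vP nPx; have fP := lattice_face_full_dim lP.
have rT := vertex_family_rank fP vP; have [_ vV PE] := vP.
have [l [lT lx rl]] := facet_functional PE rT nPx.
pose U := tight v T l; rewrite -/U in rl.
have UT : U \subset T by apply/fintype.subsetP => i; rewrite inE => /andP[].
have nv : ~~ (vertical n <= homog_mx v U)%MS by apply: (no_vertical lP vP); rewrite ?rl.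
pose al := l (rshift 1 ord_max) 0.
(* Otherwise the vertical direction would be in the kernel of [l], which is the
   span of [U]. *)
have al0 : al != 0.
  apply: contraNneq nv => al0.
  have Uk : (homog_mx v U <= kermx l)%MS by apply/sub_kermxP; exact: tight_mul.
  have kU : (kermx l <= homog_mx v U)%MS.
    rewrite -(mxrank_leqif_sup Uk) rl mxrank_ker.
    suff : (0 < \rank l)%N by move: (rank_leq_col l); lia.
    rewrite lt0n mxrank_eq0; apply: contraTneq lx => ->.
    by rewrite /form_at mulmx0 mxE ltxx.
  apply: submx_trans kU; apply/sub_kermxP/matrixP => i j.
  by rewrite !ord1 [RHS]mxE vertical_mul.
pose c0 := - l (lshift n.+1 0) 0 / al.
pose c (j : nat) := - l (rshift 1 (inord j)) 0 / al.
have inordw (j : 'I_n) : inord j = widen_ord (leqnSn n) j.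
  by apply/val_inj; rewrite /= inordK// ltnW// ltnS.
have evg y : form_at l y = al * (y 0 ord_max - real_affine c0 c n (coords y)).
  rewrite form_atE -/al mulrBr /real_affine mulrDr /c0 mulrCA divff// mulr1 opprD opprK.
  rewrite addrC; congr (_ + (_ + _)).
  rewrite mulr_sumr -sumrN; apply: eq_bigr => j _.
  by rewrite /c /coords inordw; field.
have [z [a zaE]] : exists z a, forall y, real_affine c0 c n y = affine z a n y.
  apply: real_affine_int => y yint.
  have onU w : (homog w <= homog_mx v U)%MS -> real_affine c0 c n (coords w) = w 0 ord_max.
    move=> /submxP[e wE]; have : form_at l w = 0 by rewrite /form_at wE -mulmxA tight_mul mulmx0 mxE.
    by rewrite evg => /eqP; rewrite mulf_eq0 (negbTE al0) subr_eq0 eq_sym => /eqP.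
  have ext (w : 'rV[R]_n.+1) : (forall j : 'I_n, w 0 (widen_ord (leqnSn n) j) = y j) ->
      real_affine c0 c n y = real_affine c0 c n (coords w).
    by move=> wy; congr (_ + _); apply: eq_bigr => j _; rewrite /coords inordw wy.
  have [w [wU wint wy]] := facet_lattice_point lP vP UT rl yint.
  by rewrite (ext w) ?onU.
have gapE y : form_at l y = - al * gap z a y.
  by rewrite evg zaE /gap; ring.
pose b := 0 < al.
have sgnE : - al = `|al| * side b.
  rewrite /side /b; have [h|h|h] := ltgtP 0 al.
  - by rewrite gtr0_norm// expr1 mulrN1.
  - by rewrite ltr0_norm// expr0 mulr1.
  - by rewrite -h eqxx in al0.
have nal : 0 < `|al| by rewrite normr_gt0.
exists b, U, z, a; split.
  split=> // i iT.
    by have := lT i iT; rewrite gapE sgnE -mulrA pmulr_rge0.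
  by rewrite inE iT gapE mulf_eq0 oppr_eq0 (negbTE al0).
by move: lx; rewrite gapE sgnE -mulrA pmulr_rlt0.
Qed.

End HalfSpaces.

(** * Facets, their shadows, and the upper part of a polytope *)

Section Upper.
Context {R : realType}.
Notation pr := (forget (leqnSn _)).
Local Notation pt := (nat -> R).

(** The points of [P] below which there is still another point of [P]; for a
    convex set these are the points off the lower boundary. The space of dimension 0
    has no direction to look in, and there nothing is removed, which makes the lattice
    points of [Omega P] and the volume agree there too. *)
Definition Omega n : set 'rV[R]_n -> set 'rV[R]_n :=
  match n with
  | 0 => fun P => P
  | n'.+1 => fun P =>
      [set x | P x /\ exists2 e, 0 < e & P (x - e *: delta_mx 0 ord_max)]
  end.

Definition rowpt n (y : pt) : 'rV[R]_n := \row_(i < n) y i.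

(** Lowers the last of the first [n] coordinates, and does nothing for [n = 0],
    which matches the convention for [Omega]. *)
Definition dn n (y : pt) (e : R) : pt :=
  if n is n'.+1 then upd y n' (y n' - e) else y.

Lemma rowpt_dn n y e : rowpt n.+1 (dn n.+1 y e) = rowpt n.+1 y - e *: delta_mx 0 ord_max.
Proof.
apply/rowP => j; rewrite !mxE eqxx /= /upd -val_eqE/=.
by case: eqP => [->|_]; rewrite ?mulr1// mulr0 subr0.
Qed.

Lemma OmegaE n (A : set 'rV[R]_n) y :
  Omega A (rowpt n y) <-> A (rowpt n y) /\ exists2 e, 0 < e & A (rowpt n (dn n y e)).
Proof.
case: n A => [|n] A /=; last by split=> -[Ay [e e0 He]]; split=> //; exists e; rewrite // ?rowpt_dn// -rowpt_dn.
by split=> [Ay|[]//]; split=> //; exists 1.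
Qed.

Lemma Omega_sub n (A B : set 'rV[R]_n) : A `<=` B -> Omega A `<=` Omega B.
Proof.
case: n A B => [|n] A B AB //= x [Ax [e e0 He]]; split; first exact: AB.
by exists e => //; exact: AB.
Qed.

Lemma pr_rowpt n y : pr (rowpt n.+1 y) = rowpt n y.
Proof. by apply/rowP => j; rewrite !mxE. Qed.

Lemma rowpt_ext n y y' : (forall j, (j < n)%N -> y j = y' j) -> rowpt n y = rowpt n y'.
Proof. by move=> H; apply/rowP => j; rewrite !mxE H. Qed.

Lemma rowpt_upd n y k x : (n <= k)%N -> rowpt n (upd y k x) = rowpt n y.
Proof.
move=> nk; apply: rowpt_ext => j jn; rewrite upd_neq// ltn_eqF//.
exact: leq_trans nk.
Qed.

Lemma rowpt_coords n (x : 'rV[R]_n.+1) : rowpt n.+1 (coords x) = x.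
Proof. by apply/rowP => j; rewrite !mxE /coords inord_val. Qed.

Lemma gap_rowpt n z a y : gap z a (rowpt n.+1 y) = affine z a n y - y n.
Proof.
rewrite /gap mxE; congr (_ - _); apply: affine_ext => j jn.
by rewrite /coords mxE inordK// ltnW.
Qed.

Lemma affine_lin z a n y k (t : R) : (k < n)%N ->
  affine z a n (upd y k t) = affine z a n (upd y k 0) + (a k)%:~R * t.
Proof.
move=> kn; rewrite /affine -addrA; congr (_ + _).
rewrite (bigD1 (Ordinal kn))//= [in RHS](bigD1 (Ordinal kn))//= !upd_same mulr0 add0r.
rewrite addrC; congr (_ + _); apply: eq_bigr => j.
by rewrite -val_eqE/= => jk; rewrite !upd_neq.
Qed.

Lemma gap_form n z a : exists l : 'cV[R]_(1 + n.+1),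
  l (rshift 1 ord_max) 0 = -1 /\ forall x : 'rV[R]_n.+1, gap z a x = form_at l x.
Proof.
exists (col_mx (const_mx z%:~R) (\col_(j < n.+1) (if (j < n)%N then (a j)%:~R else -1))).
split; first by rewrite col_mxEd mxE ltnn.
move=> x; rewrite form_atE col_mxEu col_mxEd !mxE ltnn mulN1r; congr (_ + _ - _).
apply: eq_bigr => j _; rewrite col_mxEd mxE /= ltn_ord; congr (_ * _).
by rewrite /coords; congr (x _ _); apply/val_inj; rewrite /= inordK// ltnW// ltnS.
Qed.

Lemma gap_conv n z a (I : finType) (c : I -> R) (v : I -> 'rV[R]_n.+1) :
  \sum_i c i = 1 -> gap z a (\sum_i c i *: v i) = \sum_i c i * gap z a (v i).
Proof.
move=> c1; have [l [_ lE]] := gap_form n z a.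
rewrite lE /form_at -homog_lin// mulmx_suml summxE; apply: eq_bigr => i _.
by rewrite -scalemxAl mxE lE.
Qed.

Lemma sideT : side true = -1 :> R. Proof. by rewrite /side expr1. Qed.
Lemma sideF : side false = 1 :> R. Proof. by rewrite /side expr0. Qed.

(** The lexicographic order on value and slope decides the order to the right of 0. *)
Lemma affine_le_germ (p q p' q' : R) : (p < p') || ((p == p') && (q <= q')) ->
  exists2 d, 0 < d & forall t, 0 <= t <= d -> p + q * t <= p' + q' * t.
Proof.
move=> /orP[pp'|/andP[/eqP -> qq']]; last first.
  by exists 1 => // t /andP[t0 _]; rewrite lerD2l ler_wpM2r.
exists ((p' - p) / (`|q - q'| + 1)); first by rewrite divr_gt0 ?subr_gt0// ltr_pwDr.
move=> t /andP[t0]; rewrite ler_pdivlMr ?ltr_pwDr// => ht.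
have : (q - q') * t <= `|q - q'| * t by rewrite ler_wpM2r// ler_norm.
nra.
Qed.

(** Finitely many affine functions of one variable are totally ordered on a small
    interval to the right of 0, so one of them is the smallest throughout. *)
Lemma affine_germ (I : eqType) (s : seq I) (i0 : I) (p q : I -> R) (A : pred I) : A i0 ->
  exists i, A i /\ exists2 e, 0 < e & forall t, 0 <= t <= e ->
    p i + q i * t <= p i0 + q i0 * t /\
    forall j, j \in s -> A j -> p i + q i * t <= p j + q j * t.
Proof.
move=> Ai0; elim: s => [|j s [i [Ai [e e0 He]]]].
  by exists i0; split=> //; exists 1 => // t _.
have [Aj|nAj] := boolP (A j); last first.
  exists i; split=> //; exists e => // t /He[H1 H2]; split=> // j'; rewrite inE => /predU1P[->|]; last exact: H2.
  by rewrite (negbTE nAj).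
have [/affine_le_germ[d d0 Hd]|H] := boolP ((p i < p j) || ((p i == p j) && (q i <= q j))).
  exists i; split=> //; exists (Num.min e d); first by rewrite lt_min e0.
  move=> t; rewrite le_min => /and3P[t0 te td].
  have [|H1 H2] := He t; first by rewrite t0.
  by split=> // j'; rewrite inE => /predU1P[-> _|]; [apply: Hd; rewrite t0 | exact: H2].
have /affine_le_germ[d d0 Hd] : (p j < p i) || ((p j == p i) && (q j <= q i)).
  move: H; rewrite negb_or negb_and -leNgt -ltNge => /andP[pji /orP H].
  rewrite [p j < p i]lt_neqAle pji andbT [p i == p j]eq_sym in H *.
  by case: eqP H => //= _ [//|/ltW].
exists j; split=> //; exists (Num.min e d); first by rewrite lt_min e0.
move=> t; rewrite le_min => /and3P[t0 te td].
have Hdt : p j + q j * t <= p i + q i * t by apply: Hd; rewrite t0.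
have [|H1 H2] := He t; first by rewrite t0.
split; first exact: le_trans H1.
by move=> j'; rewrite inE => /predU1P[-> //|j's Aj']; apply: (le_trans Hdt); exact: H2.
Qed.

Section FixedPolytope.
Variables (N n : nat) (P : set 'rV[R]_n.+1) (v : 'I_N -> 'rV[R]_n.+1) (T : {set 'I_N}).
Hypotheses (lP : lattice_face P) (vP : vertex_family P v T).

Definition is_facet b U := `[< exists z a, facet b v T U z a >].

(** The vertices of a facet and the vertical direction span the whole space, and
    two gaps agree on both. *)
Lemma facet_unique b b' U z a z' a' (x : 'rV[R]_n.+1) :
  facet b v T U z a -> facet b' v T U z' a' -> gap z a x = gap z' a' x.
Proof.
move=> [UT rU f0 ft] [_ _ f0' ft'].
have [l [lm lE]] := gap_form n z a; have [l' [lm' lE']] := gap_form n z' a'.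
suff : l - l' = 0 by rewrite lE lE' => /eqP; rewrite subr_eq0 => /eqP ->.
have nv : ~~ (vertical n <= homog_mx v U)%MS by apply: (no_vertical lP vP); rewrite ?rU.
pose M := (homog_mx v U + vertical n)%MS.
have rM : row_full M.
  rewrite /row_full eqn_leq rank_leq_col /= ltnNge; apply: contra nv => rM.
  apply: submx_trans (addsmxSr (homog_mx v U) (vertical n)) _.
  by rewrite -(mxrank_leqif_sup (addsmxSl _ _)) eqn_leq mxrankS ?addsmxSl//= rU.
have : (M <= kermx (l - l'))%MS.
  rewrite addsmx_sub; apply/andP; split; last first.
    apply/sub_kermxP/matrixP => i j; rewrite !ord1 [RHS]mxE vertical_mul !mxE lm lm'.
    by rewrite subrr.
  apply: homog_mx_subP => i iU; apply/sub_kermxP/matrixP => k j; rewrite !ord1 [RHS]mxE.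
  have iT := fintype.subsetP UT _ iU.
  rewrite mulmxBr mxE [X in _ + X]mxE -/(form_at l (v i)) -/(form_at l' (v i)) -lE -lE'.
  have /eqP -> : gap z a (v i) == 0 by rewrite ft.
  have /eqP -> : gap z' a' (v i) == 0 by rewrite ft'.
  by rewrite subrr.
have /submxP[D MD] := submx_full 1%:M rM.
move=> /sub_kermxP Ml; rewrite -[l - l']mul1mx MD -mulmxA Ml mulmx0//.
Qed.

(** With one pair of coefficients fixed for each facet, facet heights become
    functions of the set of vertices. *)
Lemma exists_facet_data : exists fd : bool -> {set 'I_N} -> int * (nat -> int),
  forall b U, is_facet b U -> facet b v T U (fd b U).1 (fd b U).2.
Proof.
have /choice[f fP] : forall bU : bool * {set 'I_N}, exists d : int * (nat -> int),
    is_facet bU.1 bU.2 -> facet bU.1 v T bU.2 d.1 d.2.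
  move=> [b U]; have [/asboolP[z [a H]]|_] := boolP (is_facet b U).
    by exists (z, a).
  by exists (0, fun=> 0).
by exists (fun b U => f (b, U)) => b U; exact: fP (b, U).
Qed.

Variable fd : bool -> {set 'I_N} -> int * (nat -> int).
Hypothesis fdP : forall b U, is_facet b U -> facet b v T U (fd b U).1 (fd b U).2.

Definition facet_height b U (y : pt) : R := affine (fd b U).1 (fd b U).2 n y.
Definition shadow U := conv (points_of (fun i => pr (v i)) U).
Local Notation ell := facet_height.
Local Notation Qf := shadow.

(** Each point outside is cut off by a facet, by [facet_separates]. *)
Lemma facet_inequalities y : P (rowpt n.+1 y) <->
  forall b U, is_facet b U -> 0 <= side b * (ell b U y - y n).
Proof.
have [_ _ PE] := vP; split=> [Py b U bU|H].
  have [UT rU f0 ft] := fdP bU.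
  move: Py; rewrite PE => /convP[c [c0 cT c1 yE]].
  rewrite /facet_height -gap_rowpt yE gap_conv// mulr_sumr sumr_ge0// => i _.
  have [iT|/cT ->] := boolP (i \in T); last by rewrite mul0r mulr0.
  by rewrite mulrCA mulr_ge0// f0.
apply: contrapT => nPy.
have [b [U [z [a [bU lt0]]]]] := facet_separates lP vP nPy.
have isbU : is_facet b U by apply/asboolP; exists z, a.
have := H b U isbU.
by rewrite /facet_height -gap_rowpt (facet_unique _ (fdP isbU) bU) leNgt lt0.
Qed.

Lemma conv_on_facet b U x : is_facet b U -> conv (points_of v U) x ->
  gap (fd b U).1 (fd b U).2 x = 0.
Proof.
move=> /fdP[UT rU f0 ft] /convP[c [c0 cU c1 ->]].
rewrite gap_conv// big1// => i _.
have [iU|/cU ->] := boolP (i \in U); last by rewrite mul0r.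
have /eqP -> : gap (fd b U).1 (fd b U).2 (v i) == 0.
  by rewrite ft// (fintype.subsetP UT).
by rewrite mulr0.
Qed.

(** The gap has constant sign on [P], so in a convex combination with gap 0 only
    vertices with gap 0 have positive weight. *)
Lemma on_facet_conv b U (W : {set 'I_N}) x : is_facet b U -> conv (points_of v W) x -> W \subset T ->
  gap (fd b U).1 (fd b U).2 x = 0 -> conv (points_of v (W :&: U)) x.
Proof.
move=> /fdP[UT rU f0 ft] /convP[c [c0 cW c1 xE]] WT; rewrite xE gap_conv// => s0.
have : \sum_i c i * (side b * gap (fd b U).1 (fd b U).2 (v i)) == 0.
  by under eq_bigr do rewrite mulrCA; rewrite -mulr_sumr s0 mulr0.
have ge0 i : 0 <= c i * (side b * gap (fd b U).1 (fd b U).2 (v i)).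
  have [iW|/cW ->] := boolP (i \in W); last by rewrite mul0r.
  by rewrite mulr_ge0// f0// (fintype.subsetP WT).
rewrite psumr_eq0// => /allP H.
apply/convP; exists c; split=> // i.
rewrite inE negb_and => /orP[|iU]; first exact: cW.
have [iW|/cW //] := boolP (i \in W).
have := H i (mem_index_enum _); rewrite /= !mulf_eq0 => /orP[/eqP//|].
rewrite (_ : side b == 0 = false); last first.
  by apply/negbTE; rewrite /side signr_eq0.
by rewrite ft ?(fintype.subsetP WT)// (negbTE iU).
Qed.

Definition mem_pt y := P (rowpt n.+1 y).
Definition mem_shadow y := (pr @` P) (rowpt n y).
Local Notation Pp := mem_pt.
Local Notation Qp := mem_shadow.

Lemma facet_height_upd b U y t : ell b U (upd y n t) = ell b U y.
Proof. exact: affine_upd. Qed.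

Lemma mem_shadowP y : Qp y <-> exists t, Pp (upd y n t).
Proof.
split=> [[x Px xy]|[t Pt]]; last first.
  by exists (rowpt n.+1 (upd y n t)) => //; rewrite pr_rowpt rowpt_upd.
exists (x 0 ord_max); rewrite /mem_pt (_ : rowpt _ _ = x)//.
apply/rowP => j; rewrite !mxE /upd.
have [jn|jn] := eqVneq (j : nat) n; first by congr (x _ _); apply/val_inj.
have jn' : (j < n)%N by rewrite ltn_neqAle jn -ltnS ltn_ord.
have := congr1 (fun M : 'rV_n => M 0 (Ordinal jn')) xy; rewrite !mxE => <-.
by congr (x _ _); apply/val_inj.
Qed.

Lemma shadow_lift b U y : is_facet b U -> Qf U (rowpt n y) ->
  conv (points_of v U) (rowpt n.+1 (upd y n (ell b U y))).
Proof.
move=> bU; rewrite /shadow -conv_pr => -[x xU xy].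
have := conv_on_facet bU xU; rewrite /gap => /eqP; rewrite subr_eq0 => /eqP gE.
rewrite (_ : rowpt _ _ = x)//.
have xj (j : 'I_n) : x 0 (widen_ord (leqnSn n) j) = y j.
  by have := congr1 (fun M : 'rV_n => M 0 j) xy; rewrite !mxE.
have ex : ell b U y = x 0 ord_max.
  rewrite -gE; apply: affine_ext => j jn; rewrite -(xj (Ordinal jn)).
  by rewrite /coords; congr (x _ _); apply/val_inj; rewrite /= inordK// ltnW.
apply/rowP => j; rewrite !mxE /upd.
have [jn|jn] := eqVneq (j : nat) n.
  by rewrite ex; congr (x _ _); apply/val_inj.
have jn' : (j < n)%N by rewrite ltn_neqAle jn -ltnS ltn_ord.
by rewrite -(xj (Ordinal jn')); congr (x _ _); apply/val_inj.
Qed.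

Lemma shadow_top b U y : is_facet b U -> Qf U (rowpt n y) -> Pp (upd y n (ell b U y)).
Proof.
move=> bU /(shadow_lift bU); have [UT _ _ _] := fdP bU; have [_ _ PE] := vP.
rewrite /mem_pt PE; apply: convS; exact: points_of_sub.
Qed.

Lemma shadow_sub b U : is_facet b U -> Qf U `<=` pr @` P.
Proof.
move=> /fdP[UT _ _ _]; have [_ _ PE] := vP.
rewrite PE conv_pr; apply: convS; exact: points_of_sub.
Qed.

(** Over its shadow a facet belongs to [P], so there it satisfies the inequalities
    of all the other facets of its side: it is the lowest upper, or the highest
    lower, hyperplane. *)
Lemma shadow_height_min b U U' y : is_facet b U -> is_facet b U' -> Qf U (rowpt n y) ->
  side b * ell b U y <= side b * ell b U' y.
Proof.
move=> bU bU' /(shadow_top bU)/facet_inequalities/(_ _ _ bU').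
by rewrite facet_height_upd upd_same mulrBr subr_ge0.
Qed.

Lemma lower_le_upper U L y : is_facet false U -> is_facet true L -> Qp y ->
  ell true L y <= ell false U y.
Proof.
move=> bU bL /mem_shadowP[t /facet_inequalities H].
have := H _ _ bU; have := H _ _ bL; rewrite !facet_height_upd !upd_same sideT sideF.
lra.
Qed.

(** Converse of [shadow_height_min]: the point on the lowest of the upper
    hyperplanes satisfies all the facet inequalities, so it is in [P], hence in the
    hull of the vertices on that hyperplane. *)
Lemma min_height_shadow b U y : is_facet b U -> Qp y ->
  (forall U', is_facet b U' -> side b * ell b U y <= side b * ell b U' y) ->
  Qf U (rowpt n y).
Proof.
move=> bU Qy Umin.
have Pt : Pp (upd y n (ell b U y)).
  apply/facet_inequalities => b' U' bU'; rewrite facet_height_upd upd_same.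
  have [bb|bb] := eqVneq b' b.
    by subst b'; rewrite mulrBr subr_ge0 Umin.
  case: b b' bb bU bU' {Umin} => -[]// _ bU bU'; rewrite ?sideT ?sideF.
    by rewrite mul1r subr_ge0; exact: lower_le_upper.
  by rewrite mulN1r opprB subr_ge0; exact: lower_le_upper.
have [_ _ PE] := vP; move: (Pt); rewrite /mem_pt PE => ct.
have := on_facet_conv bU ct (fintype.subxx _).
rewrite gap_rowpt upd_same -/(ell b U _) facet_height_upd subrr => /(_ erefl).
have [UT _ _ _] := fdP bU; rewrite (finset.setIidPr UT) => cU.
by rewrite /shadow -conv_pr; exists (rowpt n.+1 (upd y n (ell b U y))) => //; rewrite pr_rowpt rowpt_upd.
Qed.

Lemma P_bounded : exists B : R, forall y, Pp y -> forall j, (j < n.+1)%N -> `|y j| <= B.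
Proof.
exists (\sum_i \sum_j `|v i 0 j|) => y; have [_ _ PE] := vP.
rewrite /mem_pt PE => /convP[c [c0 cT c1 yE]] j jn.
have := congr1 (fun M : 'rV_n.+1 => M 0 (Ordinal jn)) yE; rewrite /= mxE => ->.
rewrite summxE (le_trans (ler_norm_sum _ _ _))// ler_sum// => i _.
rewrite mxE normrM (ger0_norm (c0 i)) (bigD1 (Ordinal jn))//=.
apply: (@le_trans _ _ (1 * `|v i 0 (Ordinal jn)|)); last first.
  by rewrite mul1r lerDl sumr_ge0.
rewrite ler_wpM2r// -c1 (bigD1 i)//= lerDl sumr_ge0//.
Qed.

(** Without facets on one side, the polytope would contain a vertical half-line. *)
Lemma exists_facet b y : Qp y -> exists U, is_facet b U.
Proof.
move=> /mem_shadowP[t0 Pt]; apply: contrapT => no.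
have [B HB] := P_bounded; pose t := t0 + side b * (`|t0| + `|B| + 1).
have : Pp (upd y n t).
  apply/facet_inequalities => b' U' bU'; have [bb|bb] := eqVneq b' b.
    by subst b'; exfalso; apply: no; exists U'.
  have := facet_inequalities (upd y n t0) => -[/(_ Pt) H _].
  have := H _ _ bU'; rewrite !facet_height_upd !upd_same /t.
  have p0 : 0 <= `|t0| + `|B| by rewrite addr_ge0.
  by case: b b' bb bU' {no t H} => -[]// _ bU'; rewrite ?sideT ?sideF; lra.
move=> /HB/(_ n (ltnSn n)); rewrite upd_same /t.
have : B <= `|B| := ler_norm B; have : t0 <= `|t0| := ler_norm t0.
have : - t0 <= `|t0| by rewrite -normrN ler_norm.
by case: b {no t}; rewrite ?sideT ?sideF ler_norml; lra.
Qed.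

End FixedPolytope.
End Upper.

(** * The shadows of the upper facets tile the shadow of the polytope *)

Section Pieces.
Context {R : realType}.
Notation pr := (forget (leqnSn _)).
Local Notation pt := (nat -> R).

Lemma conv_dn n (A : set 'rV[R]_n) y e t : conv A (rowpt n y) ->
  conv A (rowpt n (dn n y e)) -> 0 <= t <= e -> conv A (rowpt n (dn n y t)).
Proof.
case: n A => [//|n] A cy ce /andP[t0]; rewrite le_eqVlt => /predU1P[->//|te].
have e0 : 0 < e by exact: le_lt_trans te.
have := @conv_convex R n.+1 _ _ _ (t / e) ce cy.
rewrite divr_ge0 ?(ltW e0)// ler_pdivrMr// mul1r (ltW te) => /(_ isT).
congr (conv _ _); rewrite !rowpt_dn; apply/rowP => j; rewrite !mxE.
by field; exact: lt0r_neq0.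
Qed.

(** The shadow of a facet is again a lattice-face polytope, and the proper faces
    of that polytope are not vertical for the projection one dimension lower. *)
Lemma facet_no_direction N n (P : set 'rV[R]_n.+1) (v : 'I_N -> 'rV[R]_n.+1)
    (T U W : {set 'I_N}) y t :
  lattice_face P -> vertex_family P v T -> U \subset T -> \rank (homog_mx v U) = n.+1 ->
  (\rank (homog_mx v W) <= n)%N -> W \subset U -> 0 < t ->
  aff (points_of (fun i => pr (v i)) W) (rowpt n y) ->
  ~ aff (points_of (fun i => pr (v i)) W) (rowpt n (dn n y t)).
Proof.
move=> lP vP UT rU rW WU t0 /homog_affP h0 /homog_affP h1.
have vQ : vertex_family (conv (points_of (fun i => pr (v i)) U)) (fun i => pr (v i)) U.
  by apply: vertex_family_pr lP vP UT _; rewrite rU.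
have rWp : (\rank (homog_mx (fun i => pr (v i)) W) <= n)%N.
  by rewrite homog_mx_pr (leq_trans _ rW)// mxrankM_maxl.
case: n P v lP vP rU rW UT vQ rWp h0 h1 => [|n] P v lP vP rU rW UT vQ rWp h0 h1.
  move: (leq_trans (mxrankS h0) rWp); rewrite leqn0 mxrank_eq0 => /eqP.
  move=> /(congr1 (fun M : 'rV_(1 + 0) => M 0 (lshift 0 0))).
  by rewrite row_mxEl !mxE eqxx => /eqP; rewrite oner_eq0.
have [lQf _] := lattice_face_facet lP vP UT rU.
have /negP := no_vertical lQf vQ WU rWp; apply.
have : (homog (rowpt n.+1 y) - homog (rowpt n.+1 (dn n.+1 y t)) <= homog_mx (fun i => pr (v i)) W)%MS.
  by rewrite addmx_sub ?eqmx_opp.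
rewrite homogB rowpt_dn opprB addrC subrK => /(scalemx_sub t^-1).
rewrite (_ : _ *: dirM _ = vertical n)// /vertical /dirM scale_row_mx scaler0.
by rewrite scalerA mulVf ?scale1r// gt_eqF.
Qed.

Section FixedPolytope.
Variables (N n : nat) (P : set 'rV[R]_n.+1) (v : 'I_N -> 'rV[R]_n.+1) (T : {set 'I_N}).
Hypotheses (lP : lattice_face P) (vP : vertex_family P v T).
Variable fd : bool -> {set 'I_N} -> int * (nat -> int).
Notation is_facet := (is_facet v T).
Hypothesis fdP : forall b U, is_facet b U -> facet b v T U (fd b U).1 (fd b U).2.
Notation ell := (@facet_height R N n fd).
Notation Qf := (shadow v).
Notation Qp := (mem_shadow P).

Definition upper_shadow (y : pt) := Omega (pr @` P) (rowpt n y).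
Definition upper_facet U (y : pt) := Omega (Qf U) (rowpt n y).
Local Notation OmQ := upper_shadow.
Local Notation OmU := upper_facet.

Lemma facet_height_dn b U y : exists q, forall t, ell b U (dn n y t) = ell b U y + q * t.
Proof.
move: (fd); case: n => [|n'] f; first by exists 0 => t; rewrite mul0r addr0.
exists (- ((f b U).2 n')%:~R) => t.
have := affine_lin (f b U).1 (f b U).2 y (y n') (ltnSn n'); rewrite upd_id => H.
rewrite /facet_height /dn H (affine_lin _ _ _ _ (ltnSn n')).
ring.
Qed.

(** Starting at [y] and moving down in the last remaining coordinate, one facet
    height stays extremal for a while ([affine_germ]); the shadow of that facet then
    contains [y] and the points slightly below it. *)
Lemma upper_facet_cover b y : OmQ y -> exists U, is_facet b U /\ OmU U y.
Proof.
move=> /OmegaE[Qy [e e0 Qe]].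
have Qt t : 0 <= t <= e -> Qp (dn n y t).
  have [_ _ PE] := vP; move: Qy Qe; rewrite /mem_shadow PE conv_pr => Qy Qe.
  exact: conv_dn.
have [U0 bU0] := exists_facet lP vP fdP b Qy.
have /choice[q qE] := fun U => facet_height_dn b U y.
have [U [bU [e1 e10 H]]] := @affine_germ R _ (enum {set 'I_N}) U0
   (fun U => side b * ell b U y) (fun U => side b * q U) (is_facet b) bU0.
exists U; split=> //; pose t := Num.min e e1.
have t0 : 0 < t by rewrite lt_min e0.
have te : t <= e by rewrite ge_min lexx.
have te1 : t <= e1 by rewrite ge_min lexx orbT.
have QU s : 0 <= s <= t -> Qp (dn n y s) -> Qf U (rowpt n (dn n y s)).
  move=> /andP[s0 st] Qs; apply: (min_height_shadow lP vP fdP bU Qs) => U' bU'.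
  have [|_ /(_ U')] := H s; first by rewrite s0 (le_trans st).
  by rewrite mem_enum bU' !qE !mulrDr !mulrA => /(_ isT isT).
have dn0 : rowpt n (dn n y 0) = rowpt n y.
  by case: n y {Qt H qE QU Qy Qe} => [//|n' y']; rewrite rowpt_dn scale0r subr0.
apply/OmegaE; split.
  by rewrite -dn0; apply: QU; rewrite ?lexx ?(ltW t0)//; apply: Qt; rewrite lexx ltW.
exists t => //; apply: QU; rewrite ?lexx ?(ltW t0)//; apply: Qt; rewrite te ltW//.
Qed.

Lemma sideI b (x y : R) : side b * x <= side b * y -> side b * y <= side b * x -> x = y.
Proof. by case: b; rewrite ?sideT ?sideF; lra. Qed.

(** Over a common point of the shadows both facets have the extremal height, so the
    point above it lies in both facets, hence in the hull of their common vertices. *)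
Lemma facet_meet b U U' y : is_facet b U -> is_facet b U' -> Qf U (rowpt n y) -> Qf U' (rowpt n y) ->
  conv (points_of (fun i => pr (v i)) (U :&: U')) (rowpt n y).
Proof.
move=> bU bU' QU QU'.
have E : ell b U y = ell b U' y.
  by apply: (@sideI b); [exact: (shadow_height_min lP vP fdP bU bU' QU)|exact: (shadow_height_min lP vP fdP bU' bU QU')].
have [UT _ _ _] := fdP bU.
have := on_facet_conv fdP bU' (shadow_lift fdP bU QU) UT.
rewrite gap_rowpt upd_same -/(ell b U' _) facet_height_upd E subrr => /(_ erefl) c.
rewrite -conv_pr; exists (rowpt n.+1 (upd y n (ell b U' y))) => //.
by rewrite pr_rowpt rowpt_upd.
Qed.

(** If the common vertices span the hyperplane of one facet, the two hyperplanes
    coincide. *)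
Lemma full_rank_facet b U U' : is_facet b U -> is_facet b U' ->
  \rank (homog_mx v (U :&: U')) = n.+1 -> U \subset U'.
Proof.
move=> bU bU' rW; have [UT rU _ _] := fdP bU; have [_ _ _ ft'] := fdP bU'.
apply/fintype.subsetP => i iU; rewrite -ft' ?(fintype.subsetP UT)//.
have UW : (homog_mx v U <= homog_mx v (U :&: U'))%MS.
  by rewrite -(mxrank_leqif_sup (homog_mxS v (finset.subsetIl U U'))) rU rW.
have [l [_ lE]] := @gap_form R n (fd b U').1 (fd b U').2.
have Wl : homog_mx v (U :&: U') *m l = 0.
  apply/row_matrixP => j; rewrite row_mul row_homog_mx row0.
  case: ifPn => [|_]; last by rewrite mul0mx.
  rewrite inE => /andP[jU jU']; apply/matrixP => a a'; rewrite !ord1 [RHS]mxE -/(form_at l _) -lE.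
  by apply/eqP; rewrite ft' ?(fintype.subsetP UT).
have /submxP[D DE] := submx_trans (homog_mx_sub v iU) UW.
by rewrite lE /form_at DE -mulmxA Wl mulmx0 mxE.
Qed.

(** If two facets both claimed [y], a segment going down from [y] would lie in the
    shadow of their intersection, against [facet_no_direction]. *)
Lemma upper_facet_unique b U U' y : is_facet b U -> is_facet b U' -> OmU U y -> OmU U' y -> U = U'.
Proof.
move=> bU bU' /OmegaE[QU [e e0 QUe]] /OmegaE[QU' [e' e'0 QUe']].
pose t := Num.min e e'.
have t0 : 0 < t by rewrite lt_min e0.
have te : t <= e by rewrite ge_min lexx.
have te' : t <= e' by rewrite ge_min lexx orbT.
have QUt : Qf U (rowpt n (dn n y t)) by apply: conv_dn QU QUe _; rewrite te ltW.
have QUt' : Qf U' (rowpt n (dn n y t)) by apply: conv_dn QU' QUe' _; rewrite te' ltW.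
have c0 := facet_meet bU bU' QU QU'; have c1 := facet_meet bU bU' QUt QUt'.
have [UT rU _ _] := fdP bU.
pose W := U :&: U'; have WU : W \subset U := finset.subsetIl U U'.
have [rW|rW] := eqVneq (\rank (homog_mx v W)) n.+1.
  apply/eqP; rewrite finset.eqEsubset (full_rank_facet bU bU')//=.
  by apply: (full_rank_facet bU' bU); rewrite finset.setIC.
exfalso.
have {}rW : (\rank (homog_mx v W) <= n)%N.
  have : (\rank (homog_mx v W) <= n.+1)%N.
    by apply: (@leq_trans (\rank (homog_mx v U))); [rewrite mxrankS// homog_mxS | rewrite rU].
  by rewrite leq_eqVlt (negbTE rW).
have sub y' : conv (points_of (fun i => pr (v i)) W) (rowpt n y') -> aff (points_of (fun i => pr (v i)) W) (rowpt n y').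
  by move=> [m [p [c [pA c0' c1' xE]]]]; exists m, p, c; split.
by apply: (facet_no_direction lP vP UT rU rW WU t0 (sub _ c0)); exact: sub.
Qed.

End FixedPolytope.
End Pieces.

(** * The upper part of a lattice-face polytope is a lattice step function *)

Section Assembly.
Context {R : realType}.
Local Notation pt := (nat -> R).

Lemma lattice_step_mul n (w : R) (chi : pt -> R) : lattice_step n chi ->
  lattice_step n (fun y => w * chi y).
Proof.
elim: n chi => [|n IH] chi /=; first by move=> [c ->]; exists (w * c).
move=> [I [z [a [c [Gc c0 chiE hdef]]]]].
exists I, z, a, (fun i y => w * c i y); split.
- by move=> i; exact: IH.
- by move=> y; rewrite -mulr_sumr c0 mulr0.
- by move=> y; rewrite chiE mulr_sumr; apply: eq_bigr => i _; rewrite mulrCA.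
- move=> k y s t kn st.
  transitivity (w * (\sum_i affine (z i) (a i) n (upd y k t) * c i (upd y k t) -
     \sum_i affine (z i) (a i) n (upd y k s) * c i (upd y k s))).
    by rewrite mulrBr !mulr_sumr; congr (_ - _); apply: eq_bigr => i _; rewrite mulrCA.
  rewrite hdef// -itv_intZ.
    by apply: eq_itv_int => u _; rewrite mulr_sumr; apply: eq_bigr => i _; rewrite mulrCA.
  apply: bounded_measurable_sum => i; apply: bounded_measurableZ.
  by have [M nc] := lattice_step_tame (Gc i); exact: tame_section nc.
Qed.

Lemma lattice_step_zero n : lattice_step n (fun=> 0 : R).
Proof.
elim: n => [|n IH] /=; first by exists 0.
exists 'I_0, (fun=> 0), (fun _ _ => 0), (fun _ _ => 0); split.
- by [].
- by move=> y; rewrite big_ord0.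
- by move=> y; rewrite big_ord0.
- move=> k y s t kn st; rewrite !big_ord0 subrr.
  rewrite -[LHS](mul0r (t - s)) -itv_int_cst//.
Qed.

Lemma Omega_convex n (S : set 'rV[R]_n) x y w c :
  Omega (conv S) x -> Omega (conv S) y -> 0 <= c <= 1 ->
  w = c *: x + (1 - c) *: y -> Omega (conv S) w.
Proof.
case: n S x y w => [|n] S x y w /=.
  by move=> cx cy c01 ->; exact: conv_convex.
move=> [cx [e e0 cxe]] [cy [e' e'0 cye]] c01 ->; split; first exact: conv_convex.
pose t := Num.min e e'.
have t0 : 0 < t by rewrite lt_min e0.
have te : t <= e by rewrite ge_min lexx.
have te' : t <= e' by rewrite ge_min lexx orbT.
have seg z d : 0 < d -> t <= d -> conv S z -> conv S (z - d *: delta_mx 0 ord_max) ->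
    conv S (z - t *: delta_mx 0 ord_max).
  move=> d0 td cz czd; have := @conv_convex R n.+1 _ _ _ (t / d) czd cz.
  rewrite divr_ge0 ?(ltW d0) ?(ltW t0)// ler_pdivrMr// mul1r td => /(_ isT).
  congr (conv _ _); apply/rowP => j; rewrite !mxE; field; exact: lt0r_neq0.
exists t => //; have := conv_convex (seg _ _ e0 te cx cxe) (seg _ _ e'0 te' cy cye) c01.
by congr (conv _ _); apply/rowP => j; rewrite !mxE; ring.
Qed.

Section FixedPolytope.
Variables (N n : nat) (P : set 'rV[R]_n.+1) (v : 'I_N -> 'rV[R]_n.+1) (T : {set 'I_N}).
Hypotheses (lP : lattice_face P) (vP : vertex_family P v T).
Variable fd : bool -> {set 'I_N} -> int * (nat -> int).
Notation is_facet := (is_facet v T).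
Hypothesis fdP : forall b U, is_facet b U -> facet b v T U (fd b U).1 (fd b U).2.
Notation ell := (@facet_height R N n fd).
Notation Qf := (shadow v).
Notation Qp := (mem_shadow P).
Notation Pp := (mem_pt P).
Notation OmQ := (upper_shadow P).
Notation OmU := (upper_facet v).

Lemma shadow_nonempty : exists y, Qp y.
Proof.
have rT := vertex_family_rank (lattice_face_full_dim lP) vP.
have [T0|[i iT]] := set_0Vmem T.
  move: rT; rewrite (_ : homog_mx v T = 0) ?mxrank0//.
  by apply/row_matrixP => i; rewrite row_homog_mx T0 inE row0.
exists (coords (v i)), (v i); last by rewrite -[v i in LHS]rowpt_coords pr_rowpt.
by have [_ _ ->] := vP; apply: sub_conv; exists i.
Qed.

(** If all upper heights exceed all lower heights at [y], the same level fits
    between them slightly below [y] too. *)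
Lemma strict_upper_shadow y :
  (forall U L, is_facet false U -> is_facet true L -> ell true L y < ell false U y) -> OmQ y.
Proof.
move=> H; have [y0 Qy0] := shadow_nonempty.
have [U1 bU1] := exists_facet lP vP fdP false Qy0.
have [L1 bL1] := exists_facet lP vP fdP true Qy0.
have [U bU Umin] : exists2 U, is_facet false U & forall U', is_facet false U' -> ell false U y <= ell false U' y.
  by case: (@arg_minP _ R {set 'I_N} U1 (is_facet false) (fun U => ell false U y) bU1) => U bU Um; exists U.
have [L bL Lmax] : exists2 L, is_facet true L & forall L', is_facet true L' -> ell true L' y <= ell true L y.
  by case: (@arg_maxP _ R {set 'I_N} L1 (is_facet true) (fun U => ell true U y) bL1) => L bL Lm; exists L.
have UL := H _ _ bU bL.
(* A level strictly between the lower and the upper heights at [y]. *)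
pose x := (ell true L y + ell false U y) / 2.
have pos b W : is_facet b W -> 0 < side b * (ell b W y - x).
  case: b => bW; rewrite ?sideT ?sideF.
    by have := Lmax _ bW; rewrite /x; lra.
  by have := Umin _ bW; rewrite /x; lra.
have /choice[q qE] := fun bU : bool * {set 'I_N} => @facet_height_dn R N n fd bU.1 bU.2 y.
have [i e e' e'0 ee' Qi|[b W]|e e0 He] := @common_radius R (bool * {set 'I_N})%type
  (fun i e => is_facet i.1 i.2 -> forall t, 0 <= t <= e -> 0 <= side i.1 * (ell i.1 i.2 (dn n y t) - x)).
- by move=> bi t /andP[t0 te]; apply: Qi => //; rewrite t0 (le_trans te).
- have [bW|nbW] := boolP (is_facet b W); last by exists 1 => //= bW; rewrite bW in nbW.
  have [|d d0 Hd] := @affine_le_germ _ 0 0 (side b * (ell b W y - x)) (side b * q (b, W)).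
    by rewrite pos.
  exists d => // _ t /Hd; rewrite (qE (b, W)) mul0r addr0 => /le_trans; apply.
  by rewrite le_eqVlt; apply/orP; left; apply/eqP => /=; ring.
- apply/OmegaE; split; last exists e => //.
    apply/mem_shadowP; exists x; apply/(facet_inequalities lP vP fdP) => b W bW.
    by rewrite facet_height_upd upd_same ltW// pos.
  apply/mem_shadowP; exists x; apply/(facet_inequalities lP vP fdP) => b W bW.
  by rewrite facet_height_upd upd_same; apply: (He (b, W)) => //; rewrite lexx ltW.
Qed.

Lemma upper_facet_sub b U y : is_facet b U -> OmU U y -> OmQ y.
Proof. by move=> bU; apply: Omega_sub; exact: (shadow_sub vP fdP bU). Qed.

(** The signed weight of a facet; indices that are not facets get the weight 0,
    so that the family is indexed by a fixed finite type. *)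
Definition piece (i : bool * {set 'I_N}) (y : pt) : R :=
  if is_facet i.1 i.2 then side i.1 * ind_set (Omega (Qf i.2)) y else 0.

Lemma piece0 i y : ~ OmQ y -> piece i y = 0.
Proof.
move=> nO; rewrite /piece; case: ifPn => // bi; rewrite /ind_set.
by case: asboolP => [/(upper_facet_sub bi)//|_]; rewrite mulr0.
Qed.

Lemma sum_piece_side b y : OmQ y -> exists U0, [/\ is_facet b U0, OmU U0 y &
  forall F : {set 'I_N} -> R, \sum_U F U * piece (b, U) y = side b * F U0].
Proof.
move=> /(upper_facet_cover lP vP fdP b)[U0 [bU0 OU0]]; exists U0; split=> // F.
rewrite (bigD1 U0)//= big1 ?addr0; last first.
  move=> U UU0; rewrite /piece /=; case: ifPn => [bU|_]; last by rewrite mulr0.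
  rewrite /ind_set; case: asboolP => [OU|_]; last by rewrite !mulr0.
  by rewrite (upper_facet_unique lP vP fdP bU bU0 OU OU0) eqxx in UU0.
rewrite /piece /= bU0 /ind_set; case: asboolP => [_|//].
by rewrite mulr1 mulrC.
Qed.

Lemma sum_pieces (F : bool * {set 'I_N} -> R) y :
  \sum_i F i * piece i y =
  \sum_U F (false, U) * piece (false, U) y + \sum_U F (true, U) * piece (true, U) y.
Proof.
transitivity (\sum_b \sum_U F (b, U) * piece (b, U) y).
  by rewrite pair_big/=; apply: eq_bigr => -[b U].
by rewrite big_bool addrC.
Qed.

(** Over a point of the upper part of the shadow exactly one upper and one lower
    facet have nonzero weight, so every weighted sum is a difference of two terms. *)
Lemma sum_pieces_on y : OmQ y -> exists U L, [/\ is_facet false U, is_facet true L, OmU U y, OmU L y &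
  forall F, \sum_i F i * piece i y = F (false, U) - F (true, L)].
Proof.
move=> Oy; have [U [bU OU FU]] := sum_piece_side false Oy.
have [L [bL OL FL]] := sum_piece_side true Oy.
exists U, L; split=> // F; rewrite sum_pieces.
by rewrite (FU (fun U => F (false, U))) (FL (fun U => F (true, U))) sideT sideF mul1r mulN1r.
Qed.

Lemma upper_facet_shadow U y : OmU U y -> Qf U (rowpt n y).
Proof. by move=> /OmegaE[]. Qed.

(** Over [y] the set [Omega P] is the half-open interval from the lower facet
    (excluded) to the upper facet (included), a difference of two half-lines. *)
Lemma indOmega_pieces y : ind_set (Omega P) y =
  \sum_i (y n <= ell i.1 i.2 y)%R%:R * piece i y.
Proof.
have POm : `[< Omega P (rowpt n.+1 y) >] <-> Pp y /\ exists2 e, 0 < e & Pp (upd y n (y n - e)).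
  by split=> [/asboolP/OmegaE//|H]; apply/asboolP/OmegaE.
have [Oy|nO] := pselect (OmQ y); last first.
  rewrite big1; last by move=> i _; rewrite piece0// mulr0.
  rewrite /ind_set; case: asboolP => [Oy|//].
  exfalso; apply: nO; apply: strict_upper_shadow => U L bU bL.
  have [Py [e e0 Pe]] : Pp y /\ exists2 e, 0 < e & Pp (upd y n (y n - e)).
    by apply/POm/asboolP.
  have /(facet_inequalities lP vP fdP)/(_ _ _ bU) := Py; have /(facet_inequalities lP vP fdP)/(_ _ _ bL) := Pe.
  by rewrite facet_height_upd upd_same sideT sideF; lra.
have [U [L [bU bL OU OL sE]]] := sum_pieces_on Oy.
rewrite (sE (fun i => (y n <= ell i.1 i.2 y)%R%:R)) /=.
have PU := shadow_top vP fdP bU (upper_facet_shadow OU); have PL := shadow_top vP fdP bL (upper_facet_shadow OL).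
have LU : ell true L y <= ell false U y.
  apply: (lower_le_upper lP vP fdP bU bL); apply: (shadow_sub vP fdP bU); exact: upper_facet_shadow.
have Pmid t : ell true L y <= t -> t <= ell false U y -> Pp (upd y n t).
  move=> h1 h2; apply/(facet_inequalities lP vP fdP) => -[] W bW; rewrite facet_height_upd upd_same ?sideT ?sideF.
    have := shadow_height_min lP vP fdP bL bW (upper_facet_shadow OL); rewrite sideT; lra.
  have := shadow_height_min lP vP fdP bU bW (upper_facet_shadow OU); rewrite sideF; lra.
have -> : ind_set (Omega P) y = ((ell true L y < y n) && (y n <= ell false U y))%R%:R.
  rewrite /ind_set; congr (nat_of_bool _)%:R; apply/idP/idP => [/POm[Py [e e0 Pe]]|/andP[h1 h2]].
    have /(facet_inequalities lP vP fdP)/(_ _ _ bU) := Py; have /(facet_inequalities lP vP fdP)/(_ _ _ bL) := Pe.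
    by rewrite facet_height_upd upd_same sideT sideF => a1 a2; apply/andP; split; lra.
  apply/POm; split; first by have := Pmid (y n); rewrite upd_id; apply => //; exact: ltW.
  exists (y n - ell true L y); first by rewrite subr_gt0.
  by apply: Pmid; lra.
have [h1|h1] := ltP (ell true L y) (y n); first by rewrite andTb subr0.
by rewrite (le_trans h1 LU) subrr.
Qed.

(** The length of the vertical section of [P] over [y]. *)
Definition height (y : pt) : R := \sum_i ell i.1 i.2 y * piece i y.

(** The height is the smallest upper minus the largest lower facet height, cut off
    at 0, so it moves by at most twice the largest change of a facet height. Off the
    upper part of the shadow the pieces vanish; there some lower height reaches some
    upper one ([strict_upper_shadow]), so that this formula gives 0 too. *)
Lemma height_le y y' D : 0 <= D ->
  (forall b U, `|ell b U y - ell b U y'| <= D) -> height y <= height y' + 2 * D.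
Proof.
move=> D0 HD.
have h0 z : 0 <= height z.
  have [Oz|nO] := pselect (OmQ z); last first.
    by rewrite /height big1// => i _; rewrite piece0// mulr0.
  have [U [L [bU bL OU OL hz]]] := sum_pieces_on Oz.
  rewrite /height hz subr_ge0; apply: (lower_le_upper lP vP fdP bU bL).
  by apply: (shadow_sub vP fdP bU); exact: upper_facet_shadow.
have HD' b U : ell b U y <= ell b U y' + D /\ ell b U y' <= ell b U y + D.
  by have := HD b U; rewrite ler_norml => /andP[]; split; lra.
have [Oy|nO] := pselect (OmQ y); last first.
  rewrite {1}/height big1; first by rewrite addr_ge0// mulr_ge0.
  by move=> i _; rewrite piece0// mulr0.
have [U [L [bU bL OU OL hy]]] := sum_pieces_on Oy.
rewrite {1}/height hy /=.
have Um W : is_facet false W -> ell false U y <= ell false W y.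
  by move=> bW; have := shadow_height_min lP vP fdP bU bW (upper_facet_shadow OU); rewrite sideF !mul1r.
have Lm W : is_facet true W -> ell true W y <= ell true L y.
  by move=> bW; have := shadow_height_min lP vP fdP bL bW (upper_facet_shadow OL); rewrite sideT !mulN1r lerN2.
have [Oy'|nO'] := pselect (OmQ y').
  have [U' [L' [bU' bL' OU' OL' hy']]] := sum_pieces_on Oy'.
  rewrite /height hy' /=.
  have := Um _ bU'; have := Lm _ bL'; have [] := HD' false U'; have [] := HD' true L'.
  lra.
have [U' [L' [bU' bL' le']]] : exists U' L', [/\ is_facet false U', is_facet true L' &
    ell false U' y' <= ell true L' y'].
  apply: contrapT => no; apply: nO'; apply: strict_upper_shadow => U' L' bU' bL'.
  by rewrite ltNge; apply/negP => h; apply: no; exists U', L'.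
have := h0 y'; have := Um _ bU'; have := Lm _ bL'.
have [] := HD' false U'; have [] := HD' true L'.
lra.
Qed.

(** Along a coordinate line the height is Lipschitz by [height_le], and affine on
    the convex sets where a piece is constant. *)
Lemma height_increment k y s t : (k < n)%N -> s <= t ->
  height (upd y k t) - height (upd y k s) =
  itv_int s t (fun u => \sum_i ((fd i.1 i.2).2 k)%:~R * piece i (upd y k u)).
Proof.
move=> kn st.
pose q (i : bool * {set 'I_N}) : R := ((fd i.1 i.2).2 k)%:~R.
pose p (i : bool * {set 'I_N}) : R := ell i.1 i.2 (upd y k 0).
pose I (i : bool * {set 'I_N}) : pred R :=
  fun u => is_facet i.1 i.2 && `[< OmU i.2 (upd y k u) >].
have cfE i u : piece i (upd y k u) = side i.1 * (I i u)%:R.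
  by rewrite /piece /I; case: ifP => //= _; rewrite mulr0.
have ellE i u : ell i.1 i.2 (upd y k u) = p i + q i * u by exact: affine_lin.
pose A : R := \sum_i `|q i|.
have A0 : 0 <= A by rewrite sumr_ge0.
have ellL i u u' : `|ell i.1 i.2 (upd y k u) - ell i.1 i.2 (upd y k u')| <= A * `|u - u'|.
  rewrite !ellE (_ : _ - _ = q i * (u - u')); last by ring.
  rewrite normrM ler_wpM2r// /A (bigD1 i)//= lerDl sumr_ge0//.
have := @piecewise_affine_increment R (bool * {set 'I_N})%type
  (fun i => side i.1 * p i) (fun i => side i.1 * q i) I
  (fun u => height (upd y k u)) (2 * A).
move=> -> //.
- by apply: eq_itv_int => u _; apply: eq_bigr => i _; rewrite cfE mulrCA mulrA.
- move=> [b U] x1 x2 x3 x12 x23 /andP[/= bU /asboolP h1] /andP[_ /asboolP h3].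
  rewrite /I /= bU /=; apply/asboolP.
  have [/=|x31] := leP x3 x1.
    by move=> x31; rewrite (_ : x2 = x1)//; apply/eqP; rewrite eq_le x12 (le_trans x23).
  pose c := (x3 - x2) / (x3 - x1).
  have d0 : 0 < x3 - x1 by rewrite subr_gt0.
  have c01 : 0 <= c <= 1.
    by rewrite /c divr_ge0 ?subr_ge0// ?(ltW x31)// ler_pdivrMr// mul1r lerD2l lerN2.
  have rowE : rowpt n (upd y k x2) = c *: rowpt n (upd y k x1) + (1 - c) *: rowpt n (upd y k x3).
    apply/rowP => j; rewrite !mxE /upd /c; case: eqP => _; field; exact: lt0r_neq0.
  exact: Omega_convex h1 h3 c01 rowE.
- move=> u; apply: eq_bigr => i _; rewrite ellE cfE; ring.
- move=> u u'; rewrite ler_norml; apply/andP; split.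
    have := @height_le (upd y k u') (upd y k u) (A * `|u - u'|).
    rewrite mulr_ge0// => /(_ isT) H; rewrite lerNl opprB lerBlDl -mulrA; apply: H => b U.
    by rewrite distrC; exact: (ellL (b, U)).
  have := @height_le (upd y k u) (upd y k u') (A * `|u - u'|).
  rewrite mulr_ge0// => /(_ isT) H; rewrite lerBlDl -mulrA; apply: H => b U.
  exact: (ellL (b, U)).
Qed.

Lemma lattice_step_Omega_of_facets :
  (forall b U, is_facet b U -> lattice_step n (ind_set (Omega (Qf U)))) ->
  lattice_step n.+1 (ind_set (Omega P)).
Proof.
move=> IH; exists (bool * {set 'I_N})%type, (fun i => (fd i.1 i.2).1),
  (fun i => (fd i.1 i.2).2), piece; split.
- move=> i; have [bi|nbi] := boolP (is_facet i.1 i.2).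
    have -> : piece i = fun y => side i.1 * ind_set (Omega (Qf i.2)) y.
      by apply/funext => y; rewrite /piece bi.
    exact: lattice_step_mul (IH _ _ bi).
  have -> : piece i = fun=> 0 by apply/funext => y; rewrite /piece (negbTE nbi).
  exact: lattice_step_zero.
- move=> y; have [Oy|nO] := pselect (OmQ y); last first.
    by rewrite big1// => i _; rewrite piece0.
  have [U [L [_ _ _ _ sE]]] := sum_pieces_on Oy.
  have := sE (fun=> 1); rewrite subrr => e.
  rewrite -[RHS]e; apply: eq_bigr => i _.
  by rewrite mul1r.
- exact: indOmega_pieces.
- by move=> k y s t kn st; exact: height_increment.
Qed.

End FixedPolytope.

(** Induction on the dimension, through the shadows of the facets. In dimension 1
    these are points, and all functions of no coordinates are constant. *)
Theorem lattice_step_Omega n (P : set 'rV[R]_n.+1) : lattice_face P ->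
  lattice_step n.+1 (ind_set (Omega P)).
Proof.
elim: n P => [|n IH] P lP.
  have [N [v vP]] := exists_vertex_family (lattice_face_full_dim lP).
  have [fd fdP] := exists_facet_data v [set: 'I_N]%SET.
  apply: (lattice_step_Omega_of_facets lP vP fdP) => b U bU.
  exists (ind_set (Omega (shadow v U)) (fun=> 0)); apply/funext => y.
  by rewrite /ind_set (_ : \row_i y i = \row_i 0)//; apply/rowP => -[].
have [N [v vP]] := exists_vertex_family (lattice_face_full_dim lP).
have [fd fdP] := exists_facet_data v [set: 'I_N]%SET.
apply: (lattice_step_Omega_of_facets lP vP fdP) => b U bU.
have [UT rU _ _] := fdP _ _ bU.
by apply: IH; have [] := lattice_face_facet lP vP UT rU.
Qed.

End Assembly.

(** * Projections of lattice-face polytopes, and the lower boundary *)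

Section Projection.
Context {R : realType}.
Notation pr := (forget (leqnSn _)).

Lemma finite_points_of N d (v : 'I_N -> 'rV[R]_d) (U : {set 'I_N}) : finite_set (points_of v U).
Proof. by apply: finite_image; exact: finite_finset. Qed.

Lemma homog_mx0 N d (v : 'I_N -> 'rV[R]_d) : homog_mx v finset.set0 = 0.
Proof. by apply/row_matrixP => i; rewrite row_homog_mx inE row0. Qed.

(** A set of vertices that spans at least a hyperplane contains a set spanning
    exactly a hyperplane, whose projection is full-dimensional by condition (a). *)
Lemma rank_homog_mx_pr_full N n (P : set 'rV[R]_n.+2) (v : 'I_N -> 'rV[R]_n.+2) (T U : {set 'I_N}) :
  lattice_face P -> vertex_family P v T -> U \subset T -> (n.+2 <= \rank (homog_mx v U))%N ->
  \rank (homog_mx (fun i => pr (v i)) U) = n.+2.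
Proof.
move=> lP vP UT rU.
have [|||W [_ WU] rW] := @extend_rank R N _ v finset.set0 U n.+2.
- exact: finset.sub0set.
- by rewrite homog_mx0 mxrank0.
- exact: rU.
have WT := fintype.subset_trans WU UT.
have [lW _] := lattice_face_facet lP vP WT rW.
have [_] := lattice_face_full_dim lW; rewrite aff_conv => /affdimP rE.
apply/eqP; rewrite eqn_leq rank_leq_col /= -[X in (X <= _)%N]rE mxrankS//.
exact: homog_mxS.
Qed.

(** Vertices of the projection that span a hyperplane are projections of vertices of
    [P] that span no more than a hyperplane, because otherwise their projections
    would span the whole space. So they extend to vertices of [P] spanning a
    hyperplane, whose projected hull is a lattice-face polytope by condition (a); its
    own conditions (a) and (b) apply to the given vertices. *)
Theorem lattice_face_pr n (P : set 'rV[R]_n.+2) : lattice_face P -> lattice_face (pr @` P).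
Proof.
move=> lP; have fP := lattice_face_full_dim lP.
have [N [v vP]] := exists_vertex_family fP; set T := [set: 'I_N]%SET in vP.
have rT := vertex_family_rank fP vP; have [_ vV PE] := vP.
have QE : pr @` P = conv (points_of (fun i => pr (v i)) T) by rewrite PE conv_pr.
have fQ : full_dim_polytope (pr @` P).
  split; first by exists (points_of (fun i => pr (v i)) T) => //; exact: finite_points_of.
  rewrite QE aff_conv; apply/affdimP; apply: (rank_homog_mx_pr_full lP vP) => //.
  by rewrite rT.
have ext U : (\rank (homog_mx v U) <= n.+2)%N -> exists2 U1 : {set 'I_N}, U \subset U1 &
    [/\ \rank (homog_mx v U1) = n.+2, lattice_face (conv (points_of (fun i => pr (v i)) U1))
      & vertex_family (conv (points_of (fun i => pr (v i)) U1)) (fun i => pr (v i)) U1].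
  move=> rU; have [||U1 [UU1 U1T] rU1] := @extend_rank R N _ v U T n.+2 _ rU.
  - exact: finset.subsetT.
  - by rewrite rT.
  exists U1 => //; split=> //; first by have [] := lattice_face_facet lP vP U1T rU1.
  by apply: vertex_family_pr lP vP U1T _; rewrite rU1.
case: n P lP fP v vP rT vV PE QE fQ ext => [|n] P lP fP v vP rT vV PE QE fQ ext.
  split=> // x; rewrite QE => /vertices_conv[i _ <-].
  have [|U1 iU1 [rU1 [_ lU1] [_ vU1 _]]] := ext [set i]%SET.
    have := rank_homog_mx_setU1 v finset.set0 i; rewrite finset.setU0 homog_mx0 mxrank0.
    by move=> /leq_trans; apply.
  apply: lU1; rewrite vU1; exists i => //=.
  by rewrite -finset.sub1set.
split=> // U' U'V dU'.
(* All vertices of [P] that project into [U']: the vertices of the projection are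
   among the projections of the vertices. *)
pose U : {set 'I_N} := [set i | `[< U' (pr (v i)) >]]%SET.
have U'E : U' = points_of (fun i => pr (v i)) U.
  apply/seteqP; split=> x; last by move=> [i /=]; rewrite inE => /asboolP + <-.
  move=> U'x; have := U'V _ U'x; rewrite QE => /vertices_conv[i _ xE].
  by exists i => //=; rewrite inE; apply/asboolP; rewrite xE.
have rU : \rank (homog_mx (fun i => pr (v i)) U) = n.+2 by apply/affdimP; rewrite -U'E.
have rvU : (\rank (homog_mx v U) <= n.+3)%N.
  rewrite leqNgt; apply/negP => lt.
  have := rank_homog_mx_pr_full lP vP (finset.subsetT U) (ltnW lt).
  by rewrite rU => /eqP; rewrite eqn_leq ltnn andbF.
have [U1 UU1 [rU1 lU1 vU1]] := ext U rvU.
by have := lattice_face_facet lU1 vU1 UU1 rU; rewrite U'E conv_pr.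
Qed.

End Projection.

Section VolumeOmega.
Context {R : realType}.
Notation pr := (forget (leqnSn _)).

Lemma itv_int_off_point (a b p : R) f g : bounded_measurable f -> bounded_measurable g ->
  (forall x, x != p -> f x = g x) -> itv_int a b f = itv_int a b g.
Proof.
move=> bf bg fg.
have [/andP[ap pb]|np] := boolP (a < p <= b); last first.
  apply: eq_itv_int => x xab; apply: fg; apply: contraNneq np => <-; exact: xab.
rewrite !(itv_int_cat (ltW ap) pb)//; congr (_ + _); last first.
  by apply: eq_itv_int => x /andP[px _]; apply: fg; rewrite gt_eqF.
rewrite /itv_int -!Rintegral_itv_bndo_bndc.
- apply: eq_Rintegral => x; rewrite inE/= in_itv/= => /andP[_ xp].
  by apply: fg; rewrite lt_eqF.
- have := bounded_measurable_integrable a p bg; apply: integrableS => //.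
  by apply: subset_itvl; rewrite bnd_simp.
- have := bounded_measurable_integrable a p bf; apply: integrableS => //.
  by apply: subset_itvl; rewrite bnd_simp.
Qed.

Section FixedPolytope.
Variables (N n : nat) (P : set 'rV[R]_n.+1) (v : 'I_N -> 'rV[R]_n.+1) (T : {set 'I_N}).
Hypotheses (lP : lattice_face P) (vP : vertex_family P v T).
Variable fd : bool -> {set 'I_N} -> int * (nat -> int).
Notation is_facet := (is_facet v T).
Hypothesis fdP : forall b U, is_facet b U -> facet b v T U (fd b U).1 (fd b U).2.
Notation ell := (@facet_height R N n fd).

Lemma tame_ind_of_facets : exists M, tame n.+1 M (ind_set P).
Proof.
have [B HB] := P_bounded vP.
have B0 : 0 <= `|B| + 1 by rewrite addr_ge0.
exists (Num.bound (`|B| + 1)).+1; split.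
- have -> : ind_set P = fun y => \prod_i
      (~~ is_facet i.1 i.2 || (0 <= side i.1 * (ell i.1 i.2 y - y n)))%R%:R.
    apply/funext => y; rewrite /ind_set; case: asboolP => [Py|nPy].
      rewrite big1// => i _; have [bi|_] := boolP (is_facet i.1 i.2) => //=.
      have /(facet_inequalities lP vP fdP)/(_ _ _ bi) -> // := Py.
    apply/esym/eqP/prodf_eq0; apply: contrapT => no; apply: nPy.
    apply/(facet_inequalities lP vP fdP) => b U bU; rewrite leNgt; apply/negP => lt0.
    apply: no; exists (b, U) => //=; rewrite bU leNgt lt0 //.
  move=> dd X phi mphi.
  elim: (index_enum _) => [|i s IH].
    rewrite (_ : (fun _ => _) = fun=> 1); first exact: measurable_cst.
    by apply/funext => x; rewrite big_nil.
  rewrite (_ : (fun _ => _) = fun x =>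
     (~~ is_facet i.1 i.2 || (0 <= side i.1 * (ell i.1 i.2 (phi x) - phi x n)))%R%:R *
     \prod_(i <- s) (~~ is_facet i.1 i.2 || (0 <= side i.1 * (ell i.1 i.2 (phi x) - phi x n)))%R%:R); last first.
    by apply/funext => x; rewrite big_cons.
  apply: measurable_funM => //; apply: measurable_bool_natr.
  have [bi|nbi] /= := boolP (is_facet i.1 i.2); last exact: measurable_cst.
  apply: measurable_fun_ler; first exact: measurable_cst.
  apply: measurable_funM; first exact: measurable_cst.
  by apply: measurable_funB => //; exact: plot_measurable_affine.
- move=> y; rewrite /ind_set normr_nat ler_nat; apply: (@leq_trans 1%N) => //.
  exact: leq_b1.
- move=> y k kn yk; rewrite /ind_set; case: asboolP => // Py; exfalso.
  have := HB _ Py k kn; have := ler_norm B.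
  have := archi_boundP B0; move: yk; rewrite -natr1; lra.
Qed.

(** Each vertical line meets the lower boundary in at most one point. *)
Lemma int_coord_ind_Omega y : int_coord n (ind_set P) y = int_coord n (ind_set (Omega P)) y.
Proof.
have [M1 n1] := tame_ind_of_facets.
have [M2 n2] := lattice_step_tame (lattice_step_Omega lP).
pose M := maxn M1 M2.
rewrite (int_coord_itv y (ltnSn n) (leq_maxl _ _ : (M1 <= M)%N) n1).
rewrite (int_coord_itv y (ltnSn n) (leq_maxr _ _ : (M2 <= M)%N) n2).
(* The two indicators differ only at a lowest point of [P] on the line. *)
have OP x : ind_set P (upd y n x) != ind_set (Omega P) (upd y n x) ->
    mem_pt P (upd y n x) /\ forall x', x' < x -> ~ mem_pt P (upd y n x').
  rewrite /ind_set; case: asboolP => [Px|nPx]; case: asboolP => //; rewrite ?eqxx//.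
    move=> nO _; split=> // x' x'x Px'; apply: nO; apply/OmegaE; split=> //.
    exists (x - x'); first by rewrite subr_gt0.
    by rewrite /dn updK upd_same opprB addrC subrK.
  by move=> /OmegaE[].
have [[p pP]|no] := pselect (exists p, ind_set P (upd y n p) != ind_set (Omega P) (upd y n p)); last first.
  apply: eq_itv_int => x _; apply/eqP; apply: contrapT => /negP h; apply: no; by exists x.
have [Pp0 pmin] := OP _ pP.
apply: (@itv_int_off_point _ _ p); [exact: tame_section n1|exact: tame_section n2|].
move=> x xp; apply/eqP; apply: contrapT => /negP /OP[Px xmin].
by move: xp; rewrite neq_lt => /orP[/pmin//|/xmin].
Qed.

(** The line over a lattice point of the shadow of the dilate meets the lower
    boundary at the height [m * l], where [l] is the largest lower facet height.
    After dilation the facet height is still integer affine, so this single extra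
    point is a lattice point. *)
Lemma sum_coord_Omega (m : nat) : (0 < m)%N ->
  exists M0, forall M, (M0 <= M)%N -> forall y, (forall j, (j < n)%N -> y j \is a Num.int) ->
    sum_coord M n (ind_set P \o scale_pt m%:R^-1) y =
    sum_coord M n (ind_set (Omega P) \o scale_pt m%:R^-1) y +
    ind_set (pr @` P) (scale_pt m%:R^-1 y).
Proof.
move=> m0; have mR : 0 < m%:R :> R by rewrite ltr0n.
have mR0 : m%:R != 0 :> R by rewrite gt_eqF.
have [B HB] := P_bounded vP.
have mB0 : 0 <= m%:R * `|B| by rewrite mulr_ge0.
exists (Num.bound (m%:R * `|B|)) => M MM y yint.
set y' := scale_pt _ y.
have diff t : (ind_set P \o scale_pt m%:R^-1) (upd y n t) = ind_set P (upd y' n (m%:R^-1 * t)).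
  by rewrite /= scale_upd.
have diff' t : (ind_set (Omega P) \o scale_pt m%:R^-1) (upd y n t) = ind_set (Omega P) (upd y' n (m%:R^-1 * t)).
  by rewrite /= scale_upd.
rewrite /sum_coord; under eq_bigr do rewrite diff.
under [in RHS]eq_bigr do rewrite diff'.
have [Qy|nQy] := pselect (mem_shadow P y'); last first.
  have z x : ~ mem_pt P (upd y' n x) by move=> h; apply: nQy; apply/mem_shadowP; exists x.
  rewrite [X in _ = _ + X](_ : _ = 0); last first.
    by rewrite /ind_set; case: asboolP.
  rewrite addr0; apply: eq_bigr => i _; rewrite /ind_set.
  case: asboolP => [/z//|_]; case: asboolP => // /OmegaE[/z//].
rewrite [X in _ = _ + X](_ : _ = 1); last first.
  by rewrite /ind_set; case: asboolP.
have [L0 bL0] := exists_facet lP vP fdP true Qy.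
have [L bL Lmin] : exists2 L, is_facet true L & forall L', is_facet true L' -> side true * ell true L y' <= side true * ell true L' y'.
  by case: (@arg_minP _ R {set 'I_N} L0 (is_facet true) (fun U => side true * ell true U y') bL0) => L bL Lm; exists L.
have PL := shadow_top vP fdP bL (min_height_shadow lP vP fdP bL Qy Lmin).
set l := ell true L y' in PL.
have lle x : mem_pt P (upd y' n x) -> l <= x.
  move=> /(facet_inequalities lP vP fdP)/(_ _ _ bL); rewrite facet_height_upd upd_same sideT -/l; lra.
have up x : l <= x -> mem_pt P (upd y' n x) -> l < x -> Omega P (rowpt n.+1 (upd y' n x)).
  move=> lx Px lx'; apply/OmegaE; split=> //; exists (x - l); first by rewrite subr_gt0.
  by rewrite /dn updK upd_same opprB addrC subrK.
have ind1 x : ind_set P (upd y' n x) = ind_set (Omega P) (upd y' n x) + (x == l)%:R.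
  have [->|xl] := eqVneq x l.
    rewrite /ind_set; case: asboolP => // _; case: asboolP; rewrite ?add0r//.
    move=> /OmegaE[_ [e e0]]; rewrite /dn updK upd_same => /lle; lra.
  rewrite addr0 /ind_set; congr (nat_of_bool _)%:R; apply/asboolP/asboolP => [Px|/OmegaE[]//].
  by apply: up; rewrite ?lle// lt_def xl lle.
under eq_bigr do rewrite ind1.
rewrite big_split/=; congr (_ + _).
have lint : m%:R * l \is a Num.int.
  rewrite (_ : m%:R * l = affine ((fd true L).1 * m%:Z) (fd true L).2 n y); last first.
    rewrite /l /facet_height /affine intrM mulrDr mulrC mulr_sumr; congr (_ + _).
    by apply: eq_bigr => j _; rewrite /y' /scale_pt; field.
  exact: affine_int.
have lB : `|m%:R * l| < M%:R.
  apply: (@le_lt_trans _ _ (m%:R * `|B|)); last first.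
    by apply: (lt_le_trans (archi_boundP mB0)); rewrite ler_nat.
  rewrite normrM normr_nat ler_wpM2l//.
  by have := HB _ PL n (ltnSn n); rewrite upd_same => /le_trans; apply; exact: ler_norm.
move/intrP : lint => [w wE].
have wM : (`|w| < M)%N.
  by move: lB; rewrite wE -intr_norm -[M%:R]/(M%:Z%:~R) ltr_int; lia.
(* The index of the extra point: the sum runs from [- M], which is less than
   [m * l]. *)
pose i0 := absz (w + M%:Z).
have i0M : (i0 < M.*2)%N by rewrite /i0; lia.
have i0E : i0%:R - M%:R = m%:R * l.
  rewrite wE -[i0%:R]/(i0%:Z%:~R) -[M%:R]/(M%:Z%:~R) -intrB; congr (_%:~R).
  by rewrite /i0; lia.
rewrite (bigD1 (Ordinal i0M))//= i0E mulrA mulVf// mul1r eqxx big1 ?addr0// => i ii0.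
rewrite (_ : (_ == _) = false)//; apply/negbTE; apply: contra ii0 => /eqP e.
have : i%:R - M%:R = m%:R * l :> R by rewrite -e mulrA divff// mul1r.
rewrite -i0E => /addIr/eqP; rewrite eqr_nat => /eqP ie.
by apply/eqP/val_inj.
Qed.

End FixedPolytope.
End VolumeOmega.

(** * Counting lattice points *)

Section Counting.
Context {R : realType}.
Local Notation pt := (nat -> R).

Lemma sum_iterSr M k j (f : pt -> R) :
  sum_iter M k j.+1 f = sum_iter M k j (sum_coord M (k + j) f).
Proof.
elim: j k => [|j IH] k; first by rewrite /= addn0.
rewrite -[LHS]/(sum_coord M k (sum_iter M k.+1 j.+1 f)) IH.
by rewrite -[RHS]/(sum_coord M k (sum_iter M k.+1 j (sum_coord M (k + j.+1) f))) addSnnS.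
Qed.

Fixpoint box (M d : nat) : seq pt :=
  if d is d'.+1 then
    [seq upd p d' (i%:R - M%:R) | p <- box M d', i <- iota 0 M.*2]
  else [:: fun=> 0].

Lemma sum_iter_box M d (f : pt -> R) :
  sum_iter M 0 d f (fun=> 0) = \sum_(p <- box M d) f p.
Proof.
elim: d f => [|d IH] f; first by rewrite /= big_seq1.
rewrite sum_iterSr add0n IH /= /allpairs big_flatten big_map; apply: eq_bigr => p _.
by rewrite big_map /sum_coord -[LHS](big_mkord xpredT (fun i => f (upd p d (i%:R - M%:R)))) /index_iota subn0.
Qed.

Lemma mem_box M d p : reflect
  ((forall j, (j < d)%N -> exists2 i, (i < M.*2)%N & p j = i%:R - M%:R) /\
   (forall j, (d <= j)%N -> p j = 0)) (p \in box M d).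
Proof.
elim: d p => [|d IH] p.
  rewrite /= inE; apply: (iffP eqP) => [->//|[_ H]].
  by apply/funext => j; exact: H.
apply: (iffP allpairsP) => [[[q i] /= [/IH[q1 q0] iM ->]]|[p1 p0]].
  rewrite mem_iota add0n /= in iM; split=> j; last first.
    by move=> dj; rewrite upd_neq ?gtn_eqF// q0// ltnW.
  rewrite ltnS leq_eqVlt => /predU1P[->|jd]; first by exists i; rewrite ?upd_same.
  by rewrite upd_neq ?ltn_eqF//; exact: q1.
have [i iM pd] := p1 d (ltnSn d).
exists (upd p d 0, i); split=> /=.
- apply/IH; split=> j jd.
    by rewrite upd_neq ?ltn_eqF//; apply: p1; exact: ltnW.
  move: jd; rewrite leq_eqVlt => /predU1P[<-|dj]; first by rewrite upd_same.
  by rewrite upd_neq ?gtn_eqF// p0.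
- by rewrite mem_iota.
- by rewrite updK -pd upd_id.
Qed.

Lemma box_int M d p : p \in box M d -> forall j, (j < d)%N -> p j \is a Num.int.
Proof.
move=> /mem_box[H _] j /H[i _ ->]; apply: rpredB; exact: natr_int.
Qed.

Lemma uniq_box M d : uniq (box M d).
Proof.
elim: d => [//|d IH]; apply: allpairs_uniq => //; first exact: iota_uniq.
move=> [p i] [q j] /allpairsP[[p' i'] /= [pb _ [-> ->]]] /allpairsP[[q' j'] /= [qb _ [-> ->]]] e.
have /mem_box[_ p0] := pb; have /mem_box[_ q0] := qb.
have := congr1 (fun f : pt => f d) e; rewrite !upd_same => /addIr/eqP.
rewrite eqr_nat => /eqP ->; congr (_, _).
rewrite -[p'](upd_id _ d) -[q'](upd_id _ d) p0// q0//.
by have := congr1 (fun f => upd f d 0) e; rewrite !updK.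
Qed.

Lemma rowpt_box_inj M d : {in box M d &, injective (@rowpt R d)}.
Proof.
move=> p q /mem_box[_ p0] /mem_box[_ q0] e; apply/funext => j.
have [jd|dj] := ltnP j d; last by rewrite p0// q0.
by have := congr1 (fun M : 'rV_d => M 0 (Ordinal jd)) e; rewrite !mxE.
Qed.

Lemma card_lattice_points M d (A : set 'rV[R]_d) :
  (forall x, A x -> forall j, `|x 0 j| < M%:R) ->
  (#|` fset_set (lattice_points A)|%fset)%:R = sum_iter M 0 d (ind_set A) (fun=> 0).
Proof.
move=> AM; rewrite sum_iter_box.
pose s := [seq rowpt d p | p <- box M d & `[< A (rowpt d p) >]].
have us : uniq s.
  rewrite map_inj_in_uniq; first exact/filter_uniq/uniq_box.
  by move=> p q; rewrite !mem_filter => /andP[_ pb] /andP[_ qb]; exact: (rowpt_box_inj pb qb).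
have sE : lattice_points A = [set` [fset x in s]%fset].
  apply/seteqP; split=> x /=; rewrite inE /=.
    move=> [Ax xint].
    pose p : pt := fun j => if insub j is Some i then x 0 i else 0.
    have px : rowpt d p = x.
      by apply/rowP => j; rewrite !mxE /p valK.
    apply/mapP; exists p; last by [].
    rewrite mem_filter px; apply/andP; split; first exact/asboolP.
    apply/mem_box; split=> j jd; rewrite /p; last by rewrite insubN// -leqNgt.
    rewrite -[j]/(val (Ordinal jd)) valK; set xj := x 0 _.
    have /intrP[w wE] : xj \is a Num.int by exact: xint.
    have : `|xj| < M%:R by exact: AM.
    rewrite wE -intr_norm -[M%:R]/(M%:Z%:~R) ltr_int => wM.
    pose i0 := absz (w + M%:Z).
    exists i0; first by rewrite /i0; lia.
    rewrite -[i0%:R]/(i0%:Z%:~R) -intrB.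
    by congr (_%:~R); rewrite /i0; lia.
  move=> /mapP[p]; rewrite mem_filter => /andP[/asboolP Ap pb ->]; split=> // j.
  by rewrite mxE; exact: (box_int pb).
rewrite sE set_fsetK card_fseq undup_id// size_map size_filter -sum1_count natr_sum.
rewrite [LHS]big_mkcond; apply: eq_bigr => p _.
by rewrite /ind_set -/(rowpt d p); case: asboolP.
Qed.

End Counting.

Section Ehrhart.
Context {R : realType}.
Notation pr := (forget (leqnSn _)).
Local Notation origin := (fun=> 0 : R).

Lemma ind_dilate d (A : set 'rV[R]_d) (m : nat) : (0 < m)%N ->
  ind_set (dilate m A) = ind_set A \o scale_pt m%:R^-1.
Proof.
move=> m0; have mR0 : m%:R != 0 :> R by rewrite pnatr_eq0 -lt0n.
apply/funext => y; rewrite /ind_set /=; congr (nat_of_bool _)%:R.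
apply/asboolP/asboolP => [[x Ax xy]|Ay].
  rewrite (_ : \row_i _ = x)//; apply/rowP => j; rewrite !mxE /scale_pt.
  have := congr1 (fun M : 'rV_d => M 0 j) xy; rewrite !mxE => <-.
  by rewrite mulrA mulVf// mul1r.
exists (\row_i scale_pt m%:R^-1 y i) => //; apply/rowP => j; rewrite !mxE /scale_pt.
by rewrite mulrA divff// mul1r.
Qed.

Lemma scale_origin r : scale_pt r origin = origin.
Proof. by apply/funext => j; rewrite /scale_pt mulr0. Qed.

Lemma tame_ind n (P : set 'rV[R]_n.+1) : lattice_face P -> exists M, tame n.+1 M (ind_set P).
Proof.
move=> lP; have [N [v vP]] := exists_vertex_family (lattice_face_full_dim lP).
have [fd fdP] := exists_facet_data v [set: 'I_N]%SET.
exact: tame_ind_of_facets lP vP fd fdP.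
Qed.

Definition volume n (P : set 'rV[R]_n) : R := int_iter 0 n (ind_set P) origin.

Lemma Vol_dilate n (P : set 'rV[R]_n.+1) (m : nat) : lattice_face P -> (0 < m)%N ->
  Vol (dilate m P) = (volume P * m%:R ^+ n.+1)%:E.
Proof.
move=> lP m0; have mR : 0 < m%:R :> R by rewrite ltr0n.
have nP := tame_ind lP; rewrite Vol_int_iter ind_dilate//; last exact: tame_scale.
by rewrite int_iter_scale// scale_origin mulrC.
Qed.

Lemma Vol_volume n (P : set 'rV[R]_n.+1) : lattice_face P -> Vol P = (volume P)%:E.
Proof. by move=> lP; rewrite Vol_int_iter//; exact: tame_ind. Qed.

Lemma volume_Omega n (P : set 'rV[R]_n.+1) : lattice_face P -> volume P = volume (Omega P).
Proof.
move=> lP; have [N [v vP]] := exists_vertex_family (lattice_face_full_dim lP).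
have [fd fdP] := exists_facet_data v [set: 'I_N]%SET.
rewrite /volume /= add0n; congr (int_iter 0 n _ _); apply/funext => y.
exact: (int_coord_ind_Omega lP vP fdP).
Qed.

Lemma lattice_face_bounded n (P : set 'rV[R]_n.+1) : lattice_face P ->
  exists B : R, forall x, P x -> forall j, `|x 0 j| <= B.
Proof.
move=> lP; have [N [v vP]] := exists_vertex_family (lattice_face_full_dim lP).
have [B HB] := P_bounded vP; exists B => x Px j.
have := HB (coords x); rewrite /mem_pt rowpt_coords => /(_ Px j (ltn_ord j)).
by rewrite /coords inord_val.
Qed.

(** The points of the lower boundary project bijectively to the lattice points of
    the shadow, and the remaining ones are counted by the volume. *)
Lemma lattice_count_pr n (P : set 'rV[R]_n.+1) (m : nat) : lattice_face P -> (0 < m)%N ->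
  (lattice_count P m)%:R = volume P * m%:R ^+ n.+1 + (lattice_count (pr @` P) m)%:R :> R.
Proof.
move=> lP m0; have mR : 0 < m%:R :> R by rewrite ltr0n.
have [N [v vP]] := exists_vertex_family (lattice_face_full_dim lP).
have [fd fdP] := exists_facet_data v [set: 'I_N]%SET.
have [M1 H1] := sum_coord_Omega lP vP fdP m0.
have GO := lattice_step_Omega lP.
have [M2 H2] := lattice_sum_integral origin (lattice_step_scale m0 GO).
have [B HB] := lattice_face_bounded lP.
have mB0 : 0 <= m%:R * `|B| by rewrite mulr_ge0.
pose M := maxn (maxn M1 M2) (Num.bound (m%:R * `|B|)).
have M1M : (M1 <= M)%N by rewrite /M -maxnA leq_maxl.
have M2M : (M2 <= M)%N by rewrite /M [maxn M1 _]maxnC -maxnA leq_maxl.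
have BM : m%:R * `|B| < M%:R.
  by apply: (lt_le_trans (archi_boundP mB0)); rewrite ler_nat leq_maxr.
have coord (t : R) : `|t| <= B -> `|m%:R * t| < M%:R.
  move=> tB; apply: le_lt_trans BM; rewrite normrM normr_nat ler_wpM2l//.
  exact: le_trans tB (ler_norm B).
rewrite /lattice_count (@card_lattice_points _ M); last first.
  by move=> _ [x Px <-] j; rewrite mxE; apply: coord; exact: HB.
rewrite (@card_lattice_points _ M); last first.
  by move=> _ [_ [x Px <-] <-] j; rewrite !mxE; apply: coord; exact: HB.
rewrite !ind_dilate// volume_Omega//.
have -> : volume (Omega P) * m%:R ^+ n.+1 =
    sum_iter M 0 n.+1 (ind_set (Omega P) \o scale_pt m%:R^-1) origin.
  have nO := lattice_step_tame GO.
  by rewrite -H2// int_iter_scale// scale_origin mulrC.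
rewrite !sum_iterSr !add0n !sum_iter_box -big_split/= big_seq [RHS]big_seq.
by apply: eq_bigr => p pb; rewrite H1//; exact: box_int pb.
Qed.

Lemma lattice_face_nonempty n (P : set 'rV[R]_n.+1) : lattice_face P -> exists x, P x.
Proof.
move=> lP; have [N [v vP]] := exists_vertex_family (lattice_face_full_dim lP).
by have [y [x Px _]] := shadow_nonempty lP vP; exists x.
Qed.

Lemma lattice_count0 (A : set 'rV[R]_0) (m : nat) : (exists x, A x) -> lattice_count A m = 1%N.
Proof.
move=> [x Ax]; rewrite /lattice_count.
have -> : lattice_points (dilate m A) = [set x].
  apply/seteqP; split=> z /=; first by move=> _; apply/rowP => -[].
  move=> ->; split; last by case.
  by exists x => //; apply/rowP => -[].
by rewrite fset_set1 cardfs1.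
Qed.

Lemma Vol0 (A : set 'rV[R]_0) : (exists x, A x) -> Vol A = 1%E.
Proof.
move=> [x Ax]; rewrite /Vol /= diracE mem_set//=.
by rewrite (_ : \row_i _ = x)//; apply/rowP => -[].
Qed.

Lemma forget_comp a b c (h1 : (a <= b)%N) (h2 : (b <= c)%N) (h3 : (a <= c)%N) (P : set 'rV[R]_c) :
  forget h1 @` (forget h2 @` P) = forget h3 @` P.
Proof.
have E x : forget h1 (forget h2 x) = forget h3 x.
  by apply/rowP => j; rewrite !mxE; congr (x _ _); apply/val_inj.
apply/seteqP; split=> y.
  by move=> [_ [x Px <-] <-]; exists x.
by move=> [x Px <-]; exists (forget h2 x) => //; exists x.
Qed.

Lemma forget_id d (h : (d <= d)%N) (P : set 'rV[R]_d) : forget h @` P = P.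
Proof.
have E (x : 'rV[R]_d) : forget h x = x.
  by apply/rowP => j; rewrite !mxE; congr (x _ _); apply/val_inj.
by apply/seteqP; split=> y; [move=> [x Px <-]; rewrite E | move=> Py; exists y].
Qed.

(** Iterates [lattice_count_pr] over the successive projections down to the point
    in dimension 0. *)
Lemma ehrhart_coefficients n (P : set 'rV[R]_n.+1) : lattice_face P ->
  exists V : nat -> R,
    (forall k (h : (k <= n.+1)%N), Vol (forget h @` P) = (V k)%:E) /\
    (forall m : nat, (0 < m)%N -> (lattice_count P m)%:R = \sum_(k < n.+2) V k * m%:R ^+ k).
Proof.
elim: n P => [|n IH] P lP.
  have [x Px] := lattice_face_nonempty lP.
  exists (fun k => if k is 0 then 1 else volume P); split=> [k h|m m0].
    case: k h => [|[|//]] h; first by apply: Vol0; exists (forget h x), x.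
    by rewrite forget_id; exact: Vol_volume.
  rewrite lattice_count_pr// lattice_count0; last by exists (pr x), x.
  by rewrite !big_ord_recl big_ord0 /= /bump /= expr0 mulr1 addr0 addrC.
have [V [VE VS]] := IH _ (lattice_face_pr lP).
exists (fun k => if k == n.+2 then volume P else V k); split=> [k h|m m0].
  have [kE|kn] := eqVneq k n.+2.
    by subst k; rewrite forget_id; exact: Vol_volume.
  have h' : (k <= n.+1)%N by rewrite -ltnS ltn_neqAle kn.
  by rewrite -(forget_comp h' (leqnSn _)) VE.
rewrite lattice_count_pr// VS// [RHS]big_ord_recr/= eqxx addrC; congr (_ + _).
by apply: eq_bigr => k _; rewrite ltn_eqF.
Qed.

(** The difference has more roots than its degree allows. *)
Lemma poly_eq_nat (p q : {poly R}) :
  (forall m : nat, (0 < m)%N -> p.[m%:R] = q.[m%:R]) -> p = q.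
Proof.
move=> H; apply/eqP; rewrite -subr_eq0; apply/eqP.
apply: (@roots_geq_poly_eq0 _ _ [seq (m%:R : R) | m <- iota 1 (size (p - q))]).
- apply/allP => x /mapP[m]; rewrite mem_iota => /andP[m0 _] ->.
  by rewrite /root !hornerE H// subrr.
- by rewrite map_inj_uniq ?iota_uniq// => a b /eqP; rewrite eqr_nat => /eqP.
- by rewrite size_map size_iota.
Qed.

End Ehrhart.

Theorem theorem1p1 (R : realType) (d : nat) (hd : (1 <= d)%N)
    (P : set 'rV[R]_d) (hP : lattice_face P) :
  (forall m : nat, (0 < m)%N ->
     ((lattice_count P m)%:R%:E =
        Vol (dilate m P)
        + (lattice_count (forget (leq_pred d) @` P) m)%:R%:E)%E
     /\ ((lattice_count P m)%:R%:E =
        \sum_(k < d.+1) Vol (forget (leq_ord k) @` P) * (m%:R ^+ k)%:E)%E)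
  /\ (forall p : {poly R}, is_ehrhart_polynomial P p ->
        forall k : 'I_d.+1, (p`_k)%:E = Vol (forget (leq_ord k) @` P)).
Proof.
case: d hd P hP => [//|n] _ P lP.
have [V [VE VS]] := ehrhart_coefficients lP.
split=> [m m0|p pE k].
  split.
    rewrite Vol_dilate// lattice_count_pr// EFinD; congr (_ + _%:R%:E)%E.
    by rewrite (_ : leqnSn n = leq_pred n.+1)//; exact: bool_irrelevance.
  rewrite VS// -sumEFin; apply: eq_bigr => k _.
  by rewrite VE EFinM.
rewrite VE; congr _%:E.
have -> : p = \poly_(k < n.+2) V k.
  by apply: poly_eq_nat => m m0; rewrite pE// VS// horner_poly.
by rewrite coef_poly ltn_ord.
Qed.
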